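(* There is an absolute constant $C>1$ such that the following holds. Let $G=(V,E)$ be any finite graph on $n$ vertices with maximum degree $D$. Then there is a $C/D$-spread distribution on proper $(D+1)$-colorings of $G$; that is, there is a random proper coloring $\sigma: V\to[D+1]$ of $G$ such that, viewing $\sigma$ as the set $\{(v,\sigma(v)) : v\in V\}\subseteq V\times[D+1]$, for every set $T\subseteq V\times[D+1]$, $$\mathbb{P}\big(\{(v,\sigma(v)):v\in V\}\supseteq T\big)\le (C/D)^{|T|}.$$ Consequently, there is an absolute constant $C'>1$ such that the following holds: for a graph $G$ on $n$ vertices with maximum degree $D$ and an integer $k$ with $C'\log n\le k\le D+1$, if for every vertex $v$ the list $L(v)$ is chosen uniformly at random from the $k$-element subsets of $[D+1]$, independently over $v$, then $\mathbb{P}(G \text{ is } L\text{-colorable}) = 1-o(1)$ as $n\to\infty$ (uniformly over such $G$, $D$, $k$).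
   Context: A random set $S$ is $p$-spread if for all sets $T$, $\mathbb{P}(S\supseteq T)\le p^{|T|}$. A proper $(D+1)$-coloring of $G$ is a map $\sigma:V\to[D+1]=\{1,\dots,D+1\}$ with $\sigma(u)\ne\sigma(v)$ for every edge $uv$. Given lists $L(v)$, $G$ is $L$-colorable if there is a proper coloring $\sigma$ with $\sigma(v)\in L(v)$ for all $v$. *)

(* Defs.v *)
From HB Require Import structures.
From mathcomp Require Import all_boot all_order all_algebra.
From mathcomp Require Import reals exp.
Set Implicit Arguments. Unset Strict Implicit. Unset Printing Implicit Defensive.
Import Order.TTheory GRing.Theory Num.Theory.
Local Open Scope ring_scope.

Definition simple_graph (T : finType) (e : rel T) : Prop :=
  symmetric e /\ irreflexive e.

(* Maximum degree (0 for the empty graph). *)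
Definition maxdeg (T : finType) (e : rel T) : nat :=
  (\max_(v : T) #|[set u | e v u]|)%N.

Definition proper_col (T : finType) (e : rel T) (K : nat)
  (s : {ffun T -> 'I_K}) : bool :=
  [forall u, forall v, e u v ==> (s u != s v)].

Definition col_graph (T : finType) (K : nat) (s : {ffun T -> 'I_K})
  : {set T * 'I_K} := [set (v, s v) | v : T].

Definition is_distr (R : realType) (X : finType) (mu : {ffun X -> R}) : Prop :=
  (forall x, 0 <= mu x) /\ \sum_(x : X) mu x = 1.

Definition col_spread (R : realType) (T : finType) (K : nat)
  (mu : {ffun {ffun T -> 'I_K} -> R}) (p : R) : Prop :=
  forall S : {set T * 'I_K},
    \sum_(s | S \subset col_graph s) mu s <= p ^+ #|S|.

Definition L_colorable (T : finType) (e : rel T) (K : nat)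
  (L : {ffun T -> {set 'I_K}}) : bool :=
  [exists s : {ffun T -> 'I_K}, proper_col e s && [forall v, s v \in L v]].

Definition klists (T : finType) (K k : nat) : {set {ffun T -> {set 'I_K}}} :=
  [set L : {ffun T -> {set 'I_K}} | [forall v, #|L v| == k]].

(* Probability that G is L-colorable, L(v) independent uniform k-subsets of [K]. *)
Definition prob_L_colorable (R : realType) (T : finType) (e : rel T) (K k : nat) : R :=
  (#|[set L in klists T K k | L_colorable e L]|%:R) / (#|klists T K k|%:R).

(* Main.v *)
(** A random partial colouring is a random set of pairs (vertex, colour). If two
    random sets, the second one given the first, are a-spread and b-spread, their
    union is (a + b)-spread, and it stays a-spread when a = b and they live on disjoint
    sets of vertices.  So a colouring can be built in boundedly many O(1/D)-spread
    steps, and vertex-disjoint pieces can be coloured one after another at no cost.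

    Vertices whose neighbourhood is almost a clique are covered by disjoint clusters
    of size about D.  The remaining vertices have many non-adjacent pairs of
    neighbours: after one trial round conditioned by the local lemma, many
    colours are repeated around each of them, so a uniform greedy completion always has a
    linear number of choices.  In a cluster, enough pairs of non-adjacent vertices
    are first given a common colour; the colours forbidden at many vertices are used up next,
    and what remains is completed by a random perfect matching conditioned, by the lopsided
    local lemma, to avoid the forbidden pairs.

    For random lists, the spread measure is fed to the minimum-fragment argument:
    in each of about log n rounds of binomial sampling, the part of the
    colouring still uncovered is halved with overwhelming probability, and a last round
    of density of order log n / D finishes.  Permuting the palette at each vertex converts
    binomial lists into uniform k-subsets. *)
Require Import Defs.
From HB Require Import structures.
From mathcomp Require Import all_boot all_order all_algebra all_fingroup.
From mathcomp Require Import boolp reals sequences exp ring lra zify.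
Import Order.TTheory GRing.Theory Num.Theory.
Local Open Scope ring_scope.

Set Implicit Arguments. Unset Strict Implicit. Unset Printing Implicit Defensive.

(** * Spread random sets *)

(** The delicate case is a cluster [Q] with slightly more vertices than colours: some colours must
    then be repeated. The degree bound says how many can be: [#|us v| + #|Q| <= K + nb v] charges
    surplus vertices and colours forbidden from outside to non-adjacent pairs. A random bipartition
    keeps a quarter of these ordered pairs and lets one side repeat colours of the other, so that
    repeating colours becomes picking a matching among many candidates. Around a sparse vertex,
    bounded differences cannot be applied directly to the surviving repetitions, since order D^2
    vertices at distance two can each destroy one. Only the repetitions formed inside the
    neighbourhood are concentrated in that way; the outside vertices are integrated out one by one
    in the exponential moment of the number of survivors, and the eightfold palette keeps their
    total effect small. For lists, the measures passed from round to round have mass at most one.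
    The missing mass is what failed to shrink, so failure probabilities simply add. Halving stops at
    a size [m] that depends on the allowed error only. *)

Lemma prod_addE (R : comPzRingType) (X : finType) (S : {set X}) (F G : X -> R) :
  \prod_(i in S) (F i + G i) =
  \sum_(J : {set X} | J \subset S)
     (\prod_(i in J) F i) * \prod_(i in S :\: J) G i.
Proof.
pose F' i := if i \in S then F i else 0.
pose G' i := if i \in S then G i else 1.
have -> : \prod_(i in S) (F i + G i) = \prod_i (F' i + G' i).
  rewrite [LHS]big_mkcond /=; apply: eq_bigr => i _.
  by rewrite /F' /G'; case: ifP => // _; rewrite add0r.
rewrite bigA_distr (bigID (fun J : {set X} => J \subset S)) /= addrC big1 ?add0r.
  rewrite big_mkcond [RHS]big_mkcond; apply: eq_bigr => J _.
  rewrite /=; case: ifP => // sJS.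
  rewrite [X in _ = X * _]big_mkcond [X in _ = _ * X]big_mkcond -big_split /=.
  apply: eq_bigr => i _; rewrite inE /F' /G'.
  case: ifP => iJ /=; first by rewrite (subsetP sJS) // mulr1.
  by case: ifP; rewrite mul1r.
move=> J /= /subsetPn [i iJ iS].
by rewrite (bigD1 i) //= iJ /F' (negbTE iS) mul0r.
Qed.

Section Spread.
Variables (R : realFieldType) (X : finType).
Implicit Types (a b : R) (M S : {set X}).

(* Some a-spread random set lies in P almost surely. *)
Definition spr (a : R) (P : {set X} -> Prop) : Prop :=
  exists nu : {set X} -> R,
    [/\ forall M, 0 <= nu M, \sum_(M : {set X}) nu M = 1,
        forall M, nu M != 0 -> P M
      & forall S, \sum_(M : {set X} | S \subset M) nu M <= a ^+ #|S| ].

Lemma spr_sub a b (P Q : {set X} -> Prop) : 0 <= a -> a <= b ->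
  (forall M, P M -> Q M) -> spr a P -> spr b Q.
Proof.
move=> a0 ab PQ [nu [n0 n1 n2 n3]]; exists nu; split => // [M /n2 /PQ //|S].
by apply: (le_trans (n3 S)); apply: lerXn2r; rewrite ?nnegrE // (le_trans a0).
Qed.

(** All basic random sets enter here, as push-forwards of a uniform choice by a possibly
    non-injective [f]. The spread condition is a plain count, the form in which the local lemma
    delivers it. *)
Lemma spr_unif (O : finType) (G : pred O) (f : O -> {set X}) a
  (P : {set X} -> Prop) :
  (0 < #|G|)%N -> (forall o, G o -> P (f o)) ->
  (forall S, (#|[pred o | G o & S \subset f o]|%:R) <= a ^+ #|S| * #|G|%:R) ->
  spr a P.
Proof.
move=> G0 GP Ga; have g0 : 0 < #|G|%:R :> R by rewrite ltr0n.
pose nu M : R := (#|[pred o | G o & f o == M]|%:R) / #|G|%:R.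
have sumE (p : pred {set X}) :
    \sum_(M : {set X} | p M) nu M = (#|[pred o | G o & p (f o)]|%:R) / #|G|%:R.
  rewrite -mulr_suml -natr_sum; congr (_%:R / _).
  rewrite -sum1_card (partition_big f p) /=; last by move=> o /andP [].
  apply: eq_bigr => M pM; rewrite -sum1_card; apply: eq_bigl => o.
  by rewrite !unfold_in /=; case: eqP => [->|]; rewrite ?pM ?andbT ?andbF.
exists nu; split.
- by move=> M; rewrite divr_ge0 ?ler0n.
- rewrite sumE (eq_card (B := G)) ?divff ?gt_eqF // => o.
  by rewrite !inE andbT.
- move=> M; rewrite /nu mulf_eq0 negb_or pnatr_eq0 -lt0n => /andP [/card_gt0P].
  by case=> o /andP [/GP Po /eqP <-].
- by move=> S; rewrite sumE ler_pdivrMr.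
Qed.

Lemma spr1 a (P : {set X} -> Prop) M : 0 <= a -> (#|M| <= 0)%N \/ 1 <= a ->
  P M -> spr a P.
Proof.
move=> a0 aM PM.
apply: (@spr_unif unit xpredT (fun=> M)) => // [|S]; first by rewrite card_unit.
rewrite card_unit mulr1; case: (boolP (S \subset M)) => SM; last first.
  by rewrite [X in X%:R <= _]eq_card0 ?exprn_ge0.
rewrite [X in X%:R <= _](eq_card (B := {: unit})) ?card_unit //.
case: aM => [|a1]; last exact: exprn_ege1.
rewrite leqn0 cards_eq0 => /eqP M0.
by move: SM; rewrite M0 subset0 => /eqP ->; rewrite cards0 expr0.
Qed.

Lemma spr0 a (P : {set X} -> Prop) : 0 <= a -> P set0 -> spr a P.
Proof. by move=> a0; apply: spr1 => //; left; rewrite cards0. Qed.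

Definition bindw (nu1 : {set X} -> R) (nu2 : {set X} -> {set X} -> R) M :=
  \sum_(M1 : {set X}) \sum_(M2 : {set X} | M1 :|: M2 == M) nu1 M1 * nu2 M1 M2.

Lemma bindwE nu1 nu2 (p : pred {set X}) :
  \sum_(M : {set X} | p M) bindw nu1 nu2 M =
  \sum_(M1 : {set X}) nu1 M1 * \sum_(M2 : {set X} | p (M1 :|: M2)) nu2 M1 M2.
Proof.
rewrite /bindw exchange_big /=; apply: eq_bigr => M1 _.
rewrite mulr_sumr [RHS](partition_big (fun M2 => M1 :|: M2) p) //=.
apply: eq_bigr => M pM; apply: eq_bigl => M2.
by case: eqP => [->|]; rewrite ?pM ?andbF.
Qed.

Definition unionP (P : {set X} -> Prop) (Q : {set X} -> {set X} -> Prop) M :=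
  exists M1 M2, [/\ P M1, Q M1 M2 & M = M1 :|: M2].

Lemma bind_ok (P : {set X} -> Prop) (Q : {set X} -> {set X} -> Prop)
    (nu1 : {set X} -> R) (nu2 : {set X} -> {set X} -> R) :
    (forall M, 0 <= nu1 M) -> \sum_(M : {set X}) nu1 M = 1 -> (forall M, nu1 M != 0 -> P M) ->
    (forall M1, P M1 -> [/\ (forall M, 0 <= nu2 M1 M), \sum_(M : {set X}) nu2 M1 M = 1
        & forall M, nu2 M1 M != 0 -> Q M1 M]) ->
  [/\ forall M, 0 <= bindw nu1 nu2 M, \sum_(M : {set X}) bindw nu1 nu2 M = 1
    & forall M, bindw nu1 nu2 M != 0 -> unionP P Q M].
Proof.
move=> n0 n1 nP h2.
have pos M1 M2 : 0 <= nu1 M1 * nu2 M1 M2.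
  (* Outside [P] the kernel is arbitrary, but there [nu1] vanishes. *)
  have [->|/nP /h2 [h _ _]] := eqVneq (nu1 M1) 0; first by rewrite mul0r.
  exact: mulr_ge0.
split.
- by move=> M; apply: sumr_ge0 => M1 _; apply: sumr_ge0.
- rewrite bindwE -[RHS]n1; apply: eq_bigr => M1 _.
  have [->|/nP /h2 [_ h _]] := eqVneq (nu1 M1) 0; first by rewrite mul0r.
  by rewrite h mulr1.
- move=> M; apply: contra_neqP => nU.
  rewrite /bindw big1 // => M1 _; rewrite big1 // => M2 /eqP eM.
  apply/eqP; apply/negPn/negP; rewrite mulf_eq0 negb_or => /andP [/nP PM1].
  have [_ _ h] := h2 _ PM1; move=> /h QM; apply: nU.
  by exists M1, M2.
Qed.

Lemma spr_choice b (P : {set X} -> Prop) (Q : {set X} -> {set X} -> Prop) :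
  (forall M1, P M1 -> spr b (Q M1)) ->
  exists nu2 : {set X} -> {set X} -> R, forall M1, P M1 ->
    [/\ forall M, 0 <= nu2 M1 M, \sum_(M : {set X}) nu2 M1 M = 1,
        forall M, nu2 M1 M != 0 -> Q M1 M
      & forall S, \sum_(M : {set X} | S \subset M) nu2 M1 M <= b ^+ #|S| ].
Proof.
move=> h.
have /choice [f hf] : forall M1, exists nu2 : {set X} -> R, P M1 ->
    [/\ forall M, 0 <= nu2 M, \sum_(M : {set X}) nu2 M = 1,
        forall M, nu2 M != 0 -> Q M1 M
      & forall S, \sum_(M : {set X} | S \subset M) nu2 M <= b ^+ #|S| ].
  move=> M1; have [/h [nu hnu]|nP] := pselect (P M1); first by exists nu.
  by exists (fun=> 0).
by exists f.
Qed.

(* S is split between the two sets: sum over J of a^|J| b^|S \ J| = (a + b)^|S|. *)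
Lemma spr_bind a b (P : {set X} -> Prop) (Q : {set X} -> {set X} -> Prop) :
  0 <= b -> spr a P -> (forall M1, P M1 -> spr b (Q M1)) ->
  spr (a + b) (unionP P Q).
Proof.
move=> b0 [nu1 [n0 n1 nP nS]] /spr_choice [nu2 h2].
exists (bindw nu1 nu2).
have [|B0 B1 BP] := @bind_ok P Q nu1 nu2 n0 n1 nP.
  by move=> M1 /h2 [].
split => // S.
rewrite bindwE -prodr_const prod_addE.
apply: (@le_trans _ _ (\sum_(M1 : {set X}) nu1 M1 * b ^+ #|S :\: M1|)).
  apply: ler_sum => M1 _.
  have [->|nz] := eqVneq (nu1 M1) 0; first by rewrite !mul0r.
  rewrite ler_wpM2l //; have [_ _ _ h] := h2 _ (nP _ nz).
  rewrite (le_trans _ (h _)) // le_eqVlt; apply/orP; left; apply/eqP.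
  by apply: eq_bigl => M2; rewrite subDset.
(* The wanted term is [J = S :&: M1]. Allowing every [J] inside both [S] and [M1] only adds
   nonnegative terms and makes the sums exchangeable. *)
apply: (@le_trans _ _ (\sum_(M1 : {set X}) \sum_(J : {set X} | J \subset S)
    (if J \subset M1 then nu1 M1 * b ^+ #|S :\: J| else 0))).
  apply: ler_sum => M1 _; rewrite (bigD1 (S :&: M1)) ?subsetIl //= subsetIr.
  rewrite setDIr setDv set0U lerDl sumr_ge0 // => J _; case: ifP => // _.
  by rewrite mulr_ge0 ?exprn_ge0.
rewrite exchange_big /=; apply: ler_sum => J _.
by rewrite -big_mkcond /= -mulr_suml !prodr_const ler_wpM2r ?exprn_ge0.
Qed.

(** Separation dictates how [S] splits: [S :&: A] must come from the first set and [S :\: A] from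
    the second. The exponents add, and no sum over splittings is paid. *)
Lemma spr_bind_sep a (A : {set X}) (P : {set X} -> Prop)
    (Q : {set X} -> {set X} -> Prop) :
  0 <= a -> spr a P -> (forall M1, P M1 -> spr a (Q M1)) ->
  (forall M1, P M1 -> M1 \subset A) ->
  (forall M1 M2, P M1 -> Q M1 M2 -> [disjoint M2 & A]) ->
  spr a (unionP P Q).
Proof.
move=> a0 [nu1 [n0 n1 nP nS]] /spr_choice [nu2 h2] PA QA.
exists (bindw nu1 nu2).
have [|B0 B1 BP] := @bind_ok P Q nu1 nu2 n0 n1 nP.
  by move=> M1 /h2 [].
split => // S; rewrite bindwE.
rewrite -(cardsID A S) exprD.
apply: (@le_trans _ _ (\sum_(M1 : {set X} | S :&: A \subset M1) nu1 M1 * a ^+ #|S :\: A|)).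
  rewrite [leRHS]big_mkcond /=; apply: ler_sum => M1 _.
  have [->|nz] := eqVneq (nu1 M1) 0; first by rewrite !mul0r if_same.
  have PM1 := nP _ nz; have [m0 _ mQ mS] := h2 _ PM1.
  have key M2 : nu2 M1 M2 != 0 -> S \subset M1 :|: M2 ->
      (S :&: A \subset M1) && (S :\: A \subset M2).
    move=> /mQ /(QA _ _ PM1) dj /subsetP sU; apply/andP; split; apply/subsetP => x.
      rewrite inE => /andP [/sU]; rewrite inE => /orP [//|xM2] xA.
      by move/disjoint_setI0/setP: dj => /(_ x); rewrite !inE xM2 xA.
    rewrite inE => /andP [xA /sU]; rewrite inE => /orP [xM1|//].
    by rewrite (subsetP (PA _ PM1)) in xA.
  case: ifP => SA; last first.
    rewrite big1 ?mulr0 // => M2 sM2; apply/eqP/negPn/negP => /key /(_ sM2).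
    by rewrite SA.
  rewrite ler_wpM2l // (le_trans _ (mS _)) // big_mkcond [leRHS]big_mkcond.
  apply: ler_sum => M2 _; case: ifP => sM2; last by case: ifP.
  by have [->|/key /(_ sM2) /andP [_ ->]] := eqVneq (nu2 M1 M2) 0; rewrite ?if_same.
by rewrite -mulr_suml ler_wpM2r ?exprn_ge0.
Qed.

End Spread.

(** * The lopsided local lemma, by counting *)

Section LLL.
Variables (R : realFieldType) (O I : finType) (B : I -> {set O}).
Implicit Types (J : {set I}) (E : {set O}).

Definition avoid J : {set O} := [set o | [forall (j | j \in J), o \notin B j]].

Lemma avoidU1 j J : avoid (j |: J) = avoid J :\: B j.
Proof.
apply/setP => o; rewrite !inE; apply/forallP/andP => [h|[nB /forallP h] i].
  split; first by have /implyP := h j; rewrite setU11 => /(_ isT).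
  apply/forallP => i; apply/implyP => iJ; have /implyP := h i; apply.
  by rewrite inE iJ orbT.
by apply/implyP; rewrite !inE => /orP [/eqP ->//|]; apply/implyP.
Qed.

Lemma avoidS J J' : J \subset J' -> avoid J' \subset avoid J.
Proof.
move=> /subsetP s; apply/subsetP => o; rewrite !inE => /forallP h.
by apply/forallP => i; apply/implyP => /s; apply/implyP.
Qed.

Lemma avoid0 : avoid set0 = setT.
Proof. by apply/setP => o; rewrite !inE; apply/forallP => i; rewrite inE. Qed.

Variables (x : R) (d : nat) (G : I -> {set I}).
Hypotheses (x0 : 0 <= x) (x1 : x <= 1 / 2) (xd : x * d%:R <= 1 / 2).
Hypothesis Gd : forall i, (#|G i| <= d)%N.
(* Lopsidedness: only an upper bound given the avoidance of non-neighbours is required. *)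
Hypothesis Gindep : forall i J, [disjoint J & G i] ->
  (#|B i :&: avoid J|%:R : R) <= x / 2 * #|avoid J|%:R.

(** Bernoulli's inequality, with [x * d <= 1 / 2]. *)
Lemma half_le_pow k : (k <= d)%N -> 1 / 2 <= (1 - x) ^+ k.
Proof.
move=> kd; apply: (@le_trans _ _ (1 - x * k%:R)).
  have : x * k%:R <= x * d%:R by rewrite ler_wpM2l // ler_nat.
  by move: xd; lra.
elim: k {kd} => [|k IH]; first by rewrite mulr0 subr0 expr0.
rewrite exprS -natr1; have k0 : 0 <= (k%:R : R) by [].
have := ler_wpM2l (_ : 0 <= 1 - x) IH; rewrite subr_ge0 => /(_ _).
by move=> h; apply: le_trans (h _); move: x1; nra.
Qed.

(** The events of [J1] are avoided one after another, each keeping a proportion at least [1 - x].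
    The hypothesis is the conclusion of [LLL_claim] below size [n], so the lemma serves both inside
    that induction and after it. *)
Lemma LLL_peel (n : nat) J1 J2 :
  (forall J i, (#|J| < n)%N -> i \notin J ->
    (#|B i :&: avoid J|%:R : R) <= x * #|avoid J|%:R) ->
  [disjoint J1 & J2] -> (#|J1| + #|J2| <= n)%N ->
  (1 - x) ^+ #|J1| * #|avoid J2|%:R <= (#|avoid (J1 :|: J2)|%:R : R).
Proof.
move=> H; move e: #|J1| => k; elim: k J1 e => [|k IH] J1 e dj le.
  by move/eqP: e; rewrite cards_eq0 => /eqP ->; rewrite set0U expr0 mul1r.
have /card_gt0P [j jJ] : (0 < #|J1|)%N by rewrite e.
have e' : #|J1 :\ j| = k by move: e; rewrite (cardsD1 j) jJ => - [].
have dj' : [disjoint J1 :\ j & J2].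
  by apply: disjointWl dj; apply: subsetDl.
have jn : j \notin J1 :\ j :|: J2.
  by rewrite !inE eqxx /= (disjointFr dj).
have cU : #|J1 :\ j :|: J2| = (k + #|J2|)%N.
  by rewrite cardsU (eqP (_ : _ :&: _ == set0)) ?cards0 ?subn0 ?e' // setI_eq0.
have := IH _ e' dj' (ltnW le); set A := J1 :\ j :|: J2 => h.
have -> : J1 :|: J2 = j |: A by rewrite /A setUA setD1K.
rewrite avoidU1; have := H A j; rewrite cU => /(_ le jn) h2.
have : (#|avoid A|%:R : R) = #|B j :&: avoid A|%:R + #|avoid A :\: B j|%:R.
  by rewrite -natrD setIC cardsID.
rewrite exprS => h3.
have := ler_wpM2l (_ : 0 <= 1 - x) h; rewrite subr_ge0 mulrA => /(_ _) h4.
by apply: le_trans (h4 _) _; move: x1; lra.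
Qed.

(** Conditioning on [J :\: G i] alone gives at most [x / 2]. Passing to all of [J] divides by the
    chance of also avoiding [J :&: G i], which peeling bounds below by 1/2. *)
Lemma LLL_claim (n : nat) J i : (#|J| < n)%N -> i \notin J ->
  (#|B i :&: avoid J|%:R : R) <= x * #|avoid J|%:R.
Proof.
elim: n J i => // n IH J i Jn iJ.
pose J1 := J :&: G i; pose J2 := J :\: G i.
have eJ : J = J1 :|: J2 by rewrite setID.
have dj : [disjoint J1 & J2]
  by rewrite -setI_eq0; apply/eqP/setP => y; rewrite !inE; case: (y \in G i); rewrite ?andbF.
have c : (#|J1| + #|J2| <= n)%N by rewrite cardsID.
have := LLL_peel IH dj c; rewrite -eJ => h.
have dj2 : [disjoint J2 & G i]
  by rewrite -setI_eq0; apply/eqP/setP => y; rewrite !inE; case: (y \in G i); rewrite ?andbF.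
have := Gindep dj2 => h2.
have h3 : (#|B i :&: avoid J|%:R : R) <= #|B i :&: avoid J2|%:R.
  by rewrite ler_nat subset_leq_card // setIS // avoidS // subsetDl.
have h4 : 1 / 2 <= (1 - x) ^+ #|J1|.
  by apply: half_le_pow; apply: leq_trans (Gd i); rewrite subset_leq_card // subsetIr.
have h5 := ler_wpM2r (ler0n R #|avoid J2|) h4.
by have := ler_wpM2l x0 (le_trans h5 h); lra.
Qed.

Lemma LLL_gt0 : (0 < #|O|)%N -> (0 < #|avoid setT|)%N.
Proof.
move=> O0; have := @LLL_peel #|I| setT set0 (@LLL_claim _).
rewrite -setI_eq0 setI0 setU0 eqxx cards0 cardsT addn0 leqnn => /(_ isT isT).
rewrite avoid0 cardsT; move=> h; rewrite -(ltr0n R); apply: lt_le_trans h.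
by rewrite mulr_gt0 ?ltr0n // exprn_gt0 //; move: x1; lra.
Qed.

(** Dropping the events of [G'], those that may interact with [E], costs a factor at most 2 for
    every [d] of them. When [t] counts prescribed pairs this is a factor 2 per pair, so spread
    survives the conditioning. *)
Lemma LLL_cond E (G' : {set I}) (t : nat) (pE : R) :
  0 <= pE -> (#|G'| <= d * t)%N ->
  (#|E :&: avoid (~: G')|%:R <= pE * #|avoid (~: G')|%:R) ->
  (#|E :&: avoid setT|%:R <= pE * 2 ^+ t * #|avoid setT|%:R).
Proof.
move=> p0 Gt h; have := @LLL_peel #|I| G' (~: G') (@LLL_claim _).
rewrite -setI_eq0 setICr eqxx setUCr cardsC leqnn => /(_ isT isT) h1.
have h2 : (#|E :&: avoid setT|%:R : R) <= #|E :&: avoid (~: G')|%:R.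
  by rewrite ler_nat subset_leq_card // setIS // avoidS.
apply: (le_trans h2); apply: (le_trans h); rewrite -mulrA ler_wpM2l //.
have x1' : 0 <= 1 - x by move: x1; lra.
have h3 : (1 / 2) ^+ t <= (1 - x) ^+ #|G'|.
  apply: (@le_trans _ _ ((1 - x) ^+ (d * t))).
    rewrite exprM; apply: lerXn2r; rewrite ?nnegrE ?exprn_ge0 ?half_le_pow //.
    by rewrite mul1r invr_ge0.
  by apply: (ler_wiXn2l x1' _ Gt); rewrite lerBlDr lerDl.
have := le_trans (ler_wpM2r (ler0n R _) h3) h1.
rewrite expr_div_n expr1n mulrAC mul1r ler_pdivrMr ?exprn_gt0 //.
by rewrite mulrC.
Qed.

End LLL.

(** * Random permutations avoiding forbidden pairs *)

(** The falling factorial of length [r] from [2 r] is at least [r ^ r] and equals [r!] times the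
    central binomial coefficient, itself at most [4 ^ r]. *)
Lemma expn_self_fact r : (r ^ r <= 4 ^ r * r`!)%N.
Proof.
have h1 : (r ^ r <= (r + r) ^_ r)%N.
  rewrite ffact_prod (_ : r ^ r = \prod_(i < r) r)%N; last first.
    by rewrite prod_nat_const card_ord.
  by apply: leq_prod => i _; have := ltn_ord i; lia.
have h2 : ('C(r + r, r) <= 4 ^ r)%N.
  have -> : (4 ^ r = (1 + 1) ^ (r + r))%N by rewrite -[(1 + 1)%N]/2%N addnn -mul2n expnM.
  have hr : (r < (r + r).+1)%N by lia.
  rewrite expnDn (bigD1 (Ordinal hr)) //=.
  by rewrite !exp1n !muln1 leq_addr.
by apply: (leq_trans h1); rewrite -bin_ffact leq_mul2r h2 orbT.
Qed.

(** Passing from [t = s] to [s + 1] multiplies the right side by [4 * (r - s)] and the left by [r].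
    This favours the right side up to about [3 * r / 4] and the left afterwards, so the worst cases
    are the two ends: 0, which is trivial, and [r], the previous lemma. *)
Lemma expn_ffact r t : (t <= r)%N -> (r ^ t <= 4 ^ t * r ^_ t)%N.
Proof.
have up s : (4 * s <= 3 * r)%N -> (r ^ s <= 4 ^ s * r ^_ s)%N.
  elim: s => [|s IH] h; first by rewrite expn0 ffactn0.
  rewrite !expnS ffactnSr; have := IH ltac:(lia).
  set a := (r ^ s)%N; set b := (4 ^ s)%N; set c := (r ^_ s)%N => h1.
  have : (r * a <= r * (b * c))%N by rewrite leq_mul2l h1 orbT.
  have : (r * (b * c) <= 4 * (r - s) * (b * c))%N by rewrite leq_mul2r; apply/orP; right; lia.
  by nia.
(* Descending induction from [t = r]; the first alternative means that the range of [up] has been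
   reached. *)
have down s : (s <= r)%N -> (4 * (r - s) <= 3 * r)%N \/ (r ^ (r - s) <= 4 ^ (r - s) * r ^_ (r - s))%N.
  elim: s => [|s IH] h; first by right; rewrite subn0 ffactnn expn_self_fact.
  have [h'|h'] := leqP (4 * (r - s.+1)) (3 * r); first by left.
  right; case: (IH ltac:(lia)) => [h2|]; first by exfalso; lia.
  have -> : (r - s = (r - s.+1).+1)%N by lia.
  set k := (r - s.+1)%N; rewrite !expnS ffactnSr.
  have kr : (4 * (r - k) <= r)%N by lia.
  set a := (r ^ k)%N; set b := (4 ^ k)%N; set c := (r ^_ k)%N => h1.
  have : (4 * (r - k) * (b * c) <= r * (b * c))%N by rewrite leq_mul2r kr orbT.
  have : (r * a <= 4 * (r - k) * (b * c))%N by nia.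
  move=> h3 h4; have := leq_trans h3 h4; rewrite leq_mul2l => /orP [/eqP r0|//].
  by move: h; rewrite r0.
move=> tr; have [h|h] := leqP (4 * t) (3 * r); first exact: up.
by case: (down (r - t)%N ltac:(lia)) => [h1|]; [lia | rewrite subKn].
Qed.

Section PermLLL.
Variables (r : nat) (bad : rel 'I_r).
Implicit Types (p : 'I_r * 'I_r) (s : {perm 'I_r}).

(** A pair that is not forbidden gets an impossible event, so that all of ['I_r * 'I_r] can serve as
    index type. *)
Definition permB p : {set {perm 'I_r}} :=
  if bad p.1 p.2 then [set s : {perm 'I_r} | s p.1 == p.2] else set0.
Definition permG p : {set 'I_r * 'I_r} :=
  [set p' | bad p'.1 p'.2 && ((p'.1 == p.1) || (p'.2 == p.2))].
Definition permA (T : {set 'I_r * 'I_r}) : {set {perm 'I_r}} :=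
  [set s : {perm 'I_r} | [forall (p | p \in T), s p.1 == p.2]].

(* Composing s with the transposition of c and an unused c' moves i to c' and creates no
   forbidden pair outside the row of i and the column of c. *)
Lemma permA_switch (T0 J : {set 'I_r * 'I_r}) i c :
  (forall p, p \in T0 -> (p.1 != i) && (p.2 != c)) -> [disjoint J & permG (i, c)] ->
  (#|permA ((i, c) |: T0) :&: avoid permB J| * (r - #|T0|) <=
     #|permA T0 :&: avoid permB J|)%N.
Proof.
move=> hT hJ; set X := _ :&: _; set Y := permA T0 :&: _.
pose cols := [set p.2 | p in T0].
have ccols : (r - #|T0| <= #|~: cols|)%N.
  by rewrite [leqRHS]cardsCs setCK card_ord leq_sub2l // leq_imset_card.
have key c' : c' \in ~: cols -> (#|X| <= #|[set s in Y | s i == c']|)%N.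
  rewrite inE => c'n.
  have inj : {in X &, injective (fun s => s * tperm c c')%g} by move=> s1 s2 _ _ /mulIg.
  rewrite -(card_in_imset inj); apply: subset_leq_card; apply/subsetP => _ /imsetP [s sX ->].
  move: sX; rewrite inE => /andP []; rewrite inE => /forallP sT sJ.
  have si : s i = c by have /implyP := sT (i, c); rewrite setU11 => /(_ isT) /eqP.
  have sT0 p : p \in T0 -> s p.1 = p.2.
    by move=> pT; have /implyP := sT p; rewrite inE pT orbT => /(_ isT) /eqP.
  rewrite !inE permM si tpermL eqxx andbT; apply/andP; split.
    apply/forallP => p; apply/implyP => pT; rewrite permM sT0 // tpermD //.
      by have /andP [_] := hT _ pT; rewrite eq_sym.
    by apply: contraNneq c'n => ->; apply: imset_f.
  apply/forallP => p; apply/implyP => pJ; rewrite /permB; case: ifP => bp; last by rewrite inE.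
  rewrite inE permM; have := disjointFr hJ pJ; rewrite inE bp /= => /norP [p1 p2].
  move: sJ; rewrite inE => /forallP /(_ p); rewrite pJ /permB bp inE => sp.
  have [e|n1] := eqVneq (s p.1) c; first by case/negP: p1; apply/eqP; apply: (@perm_inj _ s); rewrite e si.
  have [e|n2] := eqVneq (s p.1) c'; first by rewrite e tpermR eq_sym.
  by rewrite tpermD // eq_sym.
apply: (@leq_trans (\sum_(c' in ~: cols) #|[set s in Y | s i == c']|)%N).
  apply: (@leq_trans (\sum_(c' in ~: cols) #|X|)%N); last exact: leq_sum.
  by rewrite sum_nat_const mulnC leq_mul2r ccols orbT.
rewrite -[leqRHS](sum1_card) (partition_big (fun s : {perm 'I_r} => s i) xpredT) //=.
rewrite [leqRHS](bigID (fun c' => c' \in ~: cols)) /=.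
apply: (leq_trans _ (leq_addr _ _)); apply: leq_sum => c' _.
by rewrite sum1dep_card; apply: subset_leq_card; apply/subsetP => s; rewrite !inE.
Qed.

(** Switching removes the pairs of [T] one by one. With [s] pairs left, at least [r - s] images are
    free, hence the falling factorial. If two pairs share a row or a column, no permutation contains
    [T]. *)
Lemma permA_ffact (T J : {set 'I_r * 'I_r}) : (forall p, p \in T -> [disjoint J & permG p]) ->
  (#|permA T :&: avoid permB J| * r ^_ #|T| <= #|avoid permB J|)%N.
Proof.
move e : #|T| => t; elim: t T e => [|t IH] T e hJ.
  by rewrite ffactn0 muln1 subset_leq_card // subsetIr.
have /card_gt0P [[i c] pT] : (0 < #|T|)%N by rewrite e.
have e' : #|T :\ (i, c)| = t by move: e; rewrite (cardsD1 (i, c)) pT => - [].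
have [/forallP h|/forallPn [p]] := boolP [forall p in T :\ (i, c), (p.1 != i) && (p.2 != c)].
  have h1 := @permA_switch (T :\ (i, c)) J i c _ (hJ _ pT).
  have h2 := IH (T :\ (i, c)) e' _; rewrite setD1K // e' in h1.
  rewrite ffactnSr mulnA mulnAC.
  apply: leq_trans (h2 _); last by move=> p; rewrite !inE => /andP [_ /hJ].
  by rewrite leq_mul2r h1 ?orbT // => p ?; have /implyP := h p; apply.
rewrite negb_imply => /andP []; rewrite !inE => /andP [np p'T] hp.
rewrite (_ : permA T = set0) ?set0I ?cards0 //.
apply/setP => s; rewrite !inE; apply/negP => /forallP hs.
have /implyP /(_ pT) /eqP /= e1 := hs (i, c); have /implyP /(_ p'T) /eqP e2 := hs p.
case: p np p'T hp e2 => i' c' /= np _ hp e2; move/negP: np; apply; apply/eqP.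
move: hp; rewrite negb_and !negbK => /orP [/eqP ei|/eqP ec].
  by rewrite ei -e1 -e2 ei.
by congr pair; [apply: (@perm_inj _ s); rewrite e1 e2|].
Qed.

Variable (R : realFieldType).
Hypothesis r4 : (4 <= r)%N.
Hypothesis rows : forall i, (8 * #|[set c | bad i c]| <= r)%N.
Hypothesis cols : forall c, (8 * #|[set i | bad i c]| <= r)%N.

Lemma permG_card p : (#|permG p| <= r %/ 4)%N.
Proof.
have : (#|permG p| <= #|[set c | bad p.1 c]| + #|[set i | bad i p.2]|)%N.
  pose f (c : 'I_r) : 'I_r * 'I_r := (p.1, c); pose g i : 'I_r * 'I_r := (i, p.2).
  have h0 : (#|permG p| <= #|f @: [set c | bad p.1 c] :|: g @: [set i | bad i p.2]|)%N; last apply: (leq_trans h0).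
    clear; apply: subset_leq_card; apply/subsetP => - [i c]; rewrite !inE /= => /andP [b].
    by case/orP => /eqP e; rewrite -e; apply/orP; [left|right]; apply/imsetP;
      [exists c|exists i]; rewrite ?inE /f /g -?e.
  by apply: (leq_trans (leq_card_setU _ _)); apply: leq_add; apply: leq_imset_card.
move=> h; rewrite leq_divRL //; have := rows p.1; have := cols p.2; lia.
Qed.

(** [2 / r] is twice the probability bound [1 / r] given by one switch, and [r / 4] stands for two
    lines with at most [r / 8] forbidden pairs each. *)
Lemma permLLL_hyps : [/\ 0 <= 2 / r%:R :> R, 2 / r%:R <= 1 / 2 :> R,
  2 / r%:R * (r %/ 4)%:R <= 1 / 2 :> R &
  forall p (J : {set 'I_r * 'I_r}), [disjoint J & permG p] ->
  (#|permB p :&: avoid permB J|%:R : R) <= 2 / r%:R / 2 * #|avoid permB J|%:R].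
Proof.
have r0 : 0 < r%:R :> R by rewrite ltr0n; lia.
split.
- by rewrite divr_ge0.
- rewrite ler_pdivrMr //; have : 4 <= r%:R :> R by rewrite ler_nat.
  by lra.
- rewrite mulrAC ler_pdivrMr //.
  have : (r %/ 4)%:R * 4 <= r%:R :> R by rewrite -natrM ler_nat leq_trunc_div.
  by lra.
move=> p J hJ.
rewrite (_ : 2 / r%:R / 2 = r%:R^-1) ?ler_pdivlMl //; last by field; rewrite gt_eqF.
have h1 : (#|permA [set p] :&: avoid permB J| * r <= #|avoid permB J|)%N.
  have := @permA_ffact [set p] J; rewrite cards1 ffactn1; apply.
  by move=> p'; rewrite inE => /eqP ->.
rewrite -natrM ler_nat mulnC; apply: leq_trans h1; rewrite leq_mul2r; apply/orP; right.
apply: subset_leq_card; apply: setSI; rewrite /permB; case: ifP => _; last exact: sub0set.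
apply/subsetP => s; rewrite !inE => h; apply/forallP => p'.
by apply/implyP; rewrite inE => /eqP ->.
Qed.

Lemma permLLL_pos : (0 < #|avoid permB setT|)%N.
Proof.
have [h1 h2 h3 h4] := permLLL_hyps.
by apply: (LLL_gt0 h1 h2 h3 permG_card h4); rewrite card_Sn fact_gt0.
Qed.

Lemma permLLL_spread (T : {set 'I_r * 'I_r}) :
  (#|permA T :&: avoid permB setT|%:R : R) <= (8 / r%:R) ^+ #|T| * #|avoid permB setT|%:R.
Proof.
have [h1 h2 h3 h4] := permLLL_hyps.
have r0 : 0 < r%:R :> R by rewrite ltr0n; lia.
have [Tr|Tr] := leqP #|T| r; last first.
  have := @permA_ffact T set0; rewrite avoid0 setIT ffact_small // => _.
  have -> : permA T = set0.
    apply/setP => s; rewrite !inE; apply/negP => /forallP h.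
    move: Tr; rewrite ltnNge -[X in (_ <= X)%N]card_ord => /negP; apply.
    have inj : {in T &, injective fst}.
      move=> [i c] [i' c'] p p' /= e; have /implyP /(_ p) /eqP /= := h (i, c).
      by have /implyP /(_ p') /eqP /= := h (i', c'); rewrite -e => -> ->.
    by rewrite -(card_in_imset inj) max_card.
  by rewrite set0I cards0 mulr_ge0 // exprn_ge0 // divr_ge0.
(* Each pair costs 4 from the falling factorial and 2 from the conditioning, whence 8. *)
have := @LLL_cond _ _ _ permB (2 / r%:R) (r %/ 4) permG h1 h2 h3 permG_card h4
  (permA T) (\bigcup_(p in T) permG p) #|T| ((4 / r%:R) ^+ #|T|).
rewrite -exprMn (_ : 4 / r%:R * 2 = 8 / r%:R :> R); last by rewrite mulrAC -natrM.
apply.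
- by rewrite exprn_ge0 // divr_ge0.
- rewrite mulnC -sum_nat_const.
  apply: (@leq_trans (\sum_(p in T) #|permG p|)%N).
    elim/big_rec2: _ => [|p n A _ le]; first by rewrite cards0.
    by apply: leq_trans (leq_card_setU _ _) _; rewrite leq_add2l.
  by apply: leq_sum => p _; apply: permG_card.
set J := ~: _.
have h : (#|permA T :&: avoid permB J| * r ^_ #|T| <= #|avoid permB J|)%N.
  apply: permA_ffact => p pT; rewrite -setI_eq0; apply/eqP/setP => q; rewrite in_setI /J in_setC in_set0.
  apply/negP => /andP [/negP h q2]; apply: h; apply/bigcupP; by exists p.
have e := expn_ffact Tr.
rewrite expr_div_n mulrAC ler_pdivlMr ?exprn_gt0 // -!natrX -!natrM ler_nat.
set a := #|permA T :&: _| in h *.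
apply: (@leq_trans (4 ^ #|T| * (a * r ^_ #|T|))%N).
  by rewrite mulnCA leq_mul2l e orbT.
by rewrite leq_mul2l h orbT.
Qed.
End PermLLL.

(** * Random matchings *)

Section Matching.
Variables (R : realFieldType) (V C : finType).
Implicit Types (M A : {set V * C}) (v : V) (c : C).

Definition dom M : {set V} := [set p.1 | p in M].
Definition rng M : {set C} := [set p.2 | p in M].
Definition matching M : bool :=
  [forall p in M, forall q in M, (p.1 == q.1) || (p.2 == q.2) ==> (p == q)].

Lemma matchingP M : reflect (forall p q, p \in M -> q \in M ->
  (p.1 == q.1) || (p.2 == q.2) -> p = q) (matching M).
Proof.
apply: (iffP forall_inP) => [h p q pM qM pq|h p pM].
  by have /forall_inP /(_ q qM) /implyP /(_ pq) /eqP := h p pM.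
by apply/forall_inP => q qM; apply/implyP => pq; apply/eqP/h.
Qed.

Lemma dom0 : dom set0 = set0. Proof. exact: imset0. Qed.
Lemma domU1 p M : dom (p |: M) = p.1 |: dom M. Proof. exact: imsetU1. Qed.
Lemma domU M M' : dom (M :|: M') = dom M :|: dom M'. Proof. exact: imsetU. Qed.

Lemma mem_dom p M : p \in M -> p.1 \in dom M. Proof. exact: imset_f. Qed.
Lemma mem_rng p M : p \in M -> p.2 \in rng M. Proof. exact: imset_f. Qed.

Lemma domP M v : reflect (exists c, (v, c) \in M) (v \in dom M).
Proof.
apply: (iffP imsetP) => [[[w c] h ->]|[c h]]; first by exists c.
by exists (v, c).
Qed.

Lemma matching0 : matching set0.
Proof. by apply/matchingP => p q; rewrite inE. Qed.

Lemma matchingU1 p M : p.1 \notin dom M -> p.2 \notin rng M -> matching M ->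
  matching (p |: M).
Proof.
move=> p1 p2 /matchingP h; apply/matchingP => q q'.
have aux x : x \in M -> (p.1 == x.1) || (p.2 == x.2) -> p = x.
  move=> xM /orP [/eqP e|/eqP e]; first by rewrite e mem_dom in p1.
  by rewrite e mem_rng in p2.
rewrite !inE => /orP [/eqP ->|qM] /orP [/eqP ->//|qM'].
- exact: aux.
- by rewrite eq_sym [q.2 == _]eq_sym => /(aux _ qM) ->.
- exact: h.
Qed.

Lemma card_dom M : matching M -> #|dom M| = #|M|.
Proof.
by move=> /matchingP h; apply: card_in_imset => p q pM qM e; apply: h; rewrite ?e ?eqxx.
Qed.
Lemma card_rng M : matching M -> #|rng M| = #|M|.
Proof.
by move=> /matchingP h; apply: card_in_imset => p q pM qM e; apply: h; rewrite ?e ?eqxx ?orbT.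
Qed.

Lemma spr_pick (X : finType) (W : {set X}) B : (0 < B)%N -> (B <= #|W|)%N ->
  spr (1 / B%:R : R) (fun M : {set X} => exists2 p, p \in W & M = [set p]).
Proof.
move=> B0 BW; have b0 : 0 <= 1 / B%:R :> R by rewrite divr_ge0.
apply: (@spr_unif _ _ X (mem W) (fun p => [set p])).
- exact: leq_trans BW.
- by move=> p pW; exists p.
move=> S; case eS : #|S| => [|[|k]].
- rewrite expr0 mul1r ler_nat; apply: subset_leq_card.
  by apply/subsetP => p; rewrite !inE => /andP [].
- have /cards1P [x ->] : #|S| == 1%N by rewrite eS.
  apply: (@le_trans _ _ 1); last first.
    by rewrite expr1 mul1r ler_pdivlMl ?ltr0n // mulr1 ler_nat.
  rewrite (ler_nat _ _ 1) -(card1 x); apply: subset_leq_card.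
  by apply/subsetP => p; rewrite !inE sub1set inE eq_sym => /andP [].
- rewrite [X in X%:R <= _]eq_card0; first by apply: mulr_ge0 => //; apply: exprn_ge0.
  move=> p; rewrite !inE; apply/negP => /andP [_ /subset_leq_card].
  by rewrite cards1 eS.
Qed.

(** The new pair always sits on a fresh vertex, so separated binding applies and a long greedy run
    is as spread as a single choice. *)
Lemma spr_seq (U : {set V}) (B : nat) (Inv : pred {set V * C}) :
  (0 < B)%N -> Inv set0 ->
  (forall M v, Inv M -> v \in U -> v \notin dom M -> dom M \subset U ->
     (B <= #|[set c | Inv ((v, c) |: M)]|)%N) ->
  spr (1 / B%:R : R) (fun M => Inv M /\ dom M = U).
Proof.
move=> B0 I0 IS; have b0 : 0 <= 1 / B%:R :> R by rewrite divr_ge0.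
have : U \subset U by [].
move: {1 3}U => U' ; move e : #|U'| => n; elim: n U' e => [|n IH] U' e sU.
  move/eqP: e; rewrite cards_eq0 => /eqP ->; apply: spr0 => //.
  by rewrite dom0.
have /card_gt0P [v vU] : (0 < #|U'|)%N by rewrite e.
have e' : #|U' :\ v| = n by move: e; rewrite (cardsD1 v) vU => - [].
have sU' : U' :\ v \subset U by apply: subset_trans (subsetDl _ _) sU.
pose Q (M1 M2 : {set V * C}) := exists2 p,
  p \in [set p | (p.1 == v) && Inv (p |: M1)] & M2 = [set p].
apply: (@spr_sub _ _ (1 / B%:R) _ (unionP (fun M => Inv M /\ dom M = U' :\ v) Q)) => //.
- move=> _ [M1 [M2 [[I1 d1] [[w c] h ->] ->]]]; move: h; rewrite !inE /= => /andP [/eqP -> I2].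
  by rewrite setUC; split => //; rewrite domU1 d1 setD1K.
apply: (@spr_bind_sep _ _ _ (setX (U' :\ v) setT)) => //.
- exact: IH.
- move=> M1 [I1 d1]; apply: spr_pick => //.
  have := IS M1 v I1 (subsetP sU _ vU); rewrite d1 !inE eqxx => /(_ isT sU').
  move=> h; apply: (leq_trans h).
  have inj : injective (fun c : C => (v, c)) by move=> x y /= [->].
  rewrite -(card_imset _ inj); apply: subset_leq_card.
  by apply/subsetP => _ /imsetP [c h' ->]; move: h'; rewrite !inE eqxx.
- move=> M1 [_ d1]; apply/subsetP => p pM; rewrite !inE andbT.
  by have := mem_dom pM; rewrite d1 !inE.
- move=> M1 M2 [_ d1] [[w c] h ->]; move: h; rewrite !inE /= => /andP [/eqP -> _].
  by rewrite disjoints1 !inE eqxx.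
Qed.

Lemma spr_greedy (U : {set V}) (A : {set V * C}) (B : nat) :
  (0 < B)%N -> (forall v, v \in U -> (B + #|U| <= #|[set c | (v, c) \in A]|)%N) ->
  spr (1 / B%:R : R) (fun M => [/\ M \subset A, matching M & dom M = U]).
Proof.
move=> B0 hB.
apply: (@spr_sub _ _ (1 / B%:R) _ (fun M => ((M \subset A) && matching M) /\ dom M = U)).
- by rewrite divr_ge0.
- by [].
- by move=> M [/andP [? ?] ?].
apply: (@spr_seq U B (fun M => (M \subset A) && matching M)) => //.
  by rewrite sub0set matching0.
move=> M v /andP [sA mM] vU vM dU.
have h : (#|rng M| <= #|U|)%N by rewrite card_rng // -card_dom // subset_leq_card.
have : (#|[set c | (v, c) \in A]| <= #|[set c | (v, c) \in A] :\: rng M| + #|rng M|)%N.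
  by rewrite -[leqLHS](cardsID (rng M)) addnC leq_add2l subset_leq_card // subsetIr.
move=> h2; have h3 := hB v vU.
apply: (@leq_trans #|[set c | (v, c) \in A] :\: rng M|); first by lia.
apply: subset_leq_card; apply/subsetP => c; rewrite !inE => /andP [cM cA].
by rewrite subUset sub1set cA sA /= matchingU1.
Qed.

(** The picks may fall on any vertices, so nothing separates them and the spreads [1 / B] add up. An
    earlier pick rules out at most [d1] pairs through its vertex and [d2] through its colour. *)
Lemma spr_picks (A : {set V * C}) (B k d1 d2 : nat) :
  (0 < B)%N ->
  (forall v, (#|[set p in A | p.1 == v]| <= d1)%N) ->
  (forall c, (#|[set p in A | p.2 == c]| <= d2)%N) ->
  (forall j, (j < k)%N -> (B + j * (d1 + d2) <= #|A|)%N) ->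
  spr (k%:R / B%:R : R) (fun M => [/\ M \subset A, matching M & #|M| = k]).
Proof.
move=> B0 h1 h2; elim: k => [|k IH] hk.
  by apply: spr0; rewrite ?mul0r // sub0set matching0 cards0.
pose W M := [set p in A | (p.1 \notin dom M) && (p.2 \notin rng M)].
pose Q (M1 M2 : {set V * C}) := exists2 p, p \in W M1 & M2 = [set p].
have b0 : 0 <= B%:R :> R by [].
have IHk := IH (fun j jk => hk j (ltnW jk)).
apply: (@spr_sub _ _ (k%:R / B%:R + 1 / B%:R) _ (unionP (fun M => [/\ M \subset A, matching M & #|M| = k]) Q)).
- by rewrite addr_ge0 // divr_ge0.
- by rewrite -mulrDl natr1.
- move=> _ [M1 [_ [[s1 m1 c1] [p pW ->] ->]]]; move: pW; rewrite inE => /andP [pA /andP [pd pr]].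
  rewrite setUC; split; first by rewrite subUset sub1set pA.
    exact: matchingU1.
  by rewrite cardsU1 c1 (contraNN (@mem_dom p M1)).
apply: spr_bind => // [|M1 [s1 m1 c1]]; first by rewrite divr_ge0.
apply: spr_pick => //.
have := hk k (ltnSn k).
have hd : (#|[set p in A | p.1 \in dom M1]| <= k * d1)%N.
  rewrite -c1 -(card_dom m1) -sum1_card.
  rewrite (partition_big (fun p : V * C => p.1) (mem (dom M1))) /=; last first.
    by move=> p; rewrite inE => /andP [].
  rewrite -sum_nat_const; apply: leq_sum => v vM; rewrite sum1dep_card.
  apply: leq_trans (h1 v); apply: subset_leq_card; apply/subsetP => p.
  by rewrite !inE => /andP [/andP [-> _] ->].
have hr : (#|[set p in A | p.2 \in rng M1]| <= k * d2)%N.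
  rewrite -c1 -(card_rng m1) -sum1_card.
  rewrite (partition_big (fun p : V * C => p.2) (mem (rng M1))) /=; last first.
    by move=> p; rewrite inE => /andP [].
  rewrite -sum_nat_const; apply: leq_sum => v vM; rewrite sum1dep_card.
  apply: leq_trans (h2 v); apply: subset_leq_card; apply/subsetP => p.
  by rewrite !inE => /andP [/andP [-> _] ->].
have : (#|A| <= #|W M1| + (#|[set p in A | p.1 \in dom M1]| + #|[set p in A | p.2 \in rng M1]|))%N.
  apply: (@leq_trans #|W M1 :|: ([set p in A | p.1 \in dom M1] :|: [set p in A | p.2 \in rng M1])|).
    apply: subset_leq_card; apply/subsetP => p pA; rewrite !inE pA /=.
    by case: (p.1 \in _) => //; case: (p.2 \in _).
  apply: (leq_trans (leq_card_setU _ _)); rewrite leq_add2l; exact: leq_card_setU.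
lia.
Qed.

(** Enumerating [U] and [F] turns perfect matchings into permutations, the pairs outside [A] being
    the forbidden ones. *)
Lemma spr_perfect (U : {set V}) (F : {set C}) (A : {set V * C}) (r : nat) :
  (4 <= r)%N -> #|U| = r -> #|F| = r ->
  (forall v, v \in U -> (8 * #|[set c in F | (v, c) \notin A]| <= r)%N) ->
  (forall c, c \in F -> (8 * #|[set v in U | (v, c) \notin A]| <= r)%N) ->
  spr (8 / r%:R : R) (fun M => [/\ M \subset A :&: setX U F, matching M & dom M = U]).
Proof.
move=> r4 eU eF hU hF.
pose u (i : 'I_r) : V := enum_val (cast_ord (esym eU) i).
pose w (i : 'I_r) : C := enum_val (cast_ord (esym eF) i).
have u_inj : injective u by move=> i j /enum_val_inj /cast_ord_inj.
have w_inj : injective w by move=> i j /enum_val_inj /cast_ord_inj.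
have uU i : u i \in U by apply: enum_valP.
have wF i : w i \in F by apply: enum_valP.
have u_surj v : v \in U -> exists i, v = u i.
  move=> vU; exists (cast_ord eU (enum_rank_in vU v)).
  by rewrite /u cast_ordK enum_rankK_in.
have w_surj (v : C) : v \in F -> exists i, v = w i.
  move=> vU; exists (cast_ord eF (enum_rank_in vU v)).
  by rewrite /w cast_ordK enum_rankK_in.
pose bad (i c : 'I_r) := (u i, w c) \notin A.
have rows i : (8 * #|[set c : 'I_r | bad i c]| <= r)%N.
  apply: leq_trans (hU _ (uU i)); rewrite leq_mul2l /= -(card_imset _ w_inj).
  apply: subset_leq_card; apply/subsetP => _ /imsetP [c cb ->].
  by rewrite inE wF; move: cb; rewrite inE.
have cols (c : 'I_r) : (8 * #|[set i | bad i c]| <= r)%N.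
  apply: leq_trans (hF _ (wF c)); rewrite leq_mul2l /= -(card_imset _ u_inj).
  apply: subset_leq_card; apply/subsetP => _ /imsetP [i ib ->].
  by rewrite inE uU; move: ib; rewrite inE.
pose f (s : {perm 'I_r}) : {set V * C} := [set (u i, w (s i)) | i : 'I_r].
pose g (p : 'I_r * 'I_r) := (u p.1, w p.2).
have g_inj : injective g by move=> [i c] [i' c'] [/u_inj -> /w_inj ->].
have pos := permLLL_pos R r4 rows cols.
have spread := permLLL_spread R r4 rows cols.
set Gd := avoid (permB bad) setT in pos spread.
apply: (@spr_unif _ _ _ (mem Gd) f) => //.
- move=> s; rewrite /= inE => /forallP hs; split.
  + apply/subsetP => _ /imsetP [i _ ->]; rewrite !inE /= uU wF !andbT.
    apply/negPn/negP => b; have := hs (i, s i); rewrite /permB /= (_ : bad i (s i)) //.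
    by rewrite !inE eqxx.
  + apply/matchingP => _ _ /imsetP [i _ ->] /imsetP [j _ ->] /=.
    by case/orP => /eqP; [move/u_inj -> | move/w_inj/perm_inj ->].
  + apply/setP => v; apply/domP/idP => [[c /imsetP [i _ [-> _]]] //|/u_surj [i ->]].
    by exists (w (s i)); apply: imset_f.
move=> S; pose T := g @^-1: S.
have hs s : S \subset f s -> s \in permA T.
  move=> /subsetP sS; rewrite inE; apply/forallP => p; apply/implyP; rewrite inE => /sS.
  by move=> /imsetP [i _ [/u_inj -> /w_inj ->]].
set SU := setX U F; have [SUF|SUF] := boolP (S \subset SU).
  have cT : #|T| = #|S|.
    rewrite -(card_imset _ g_inj); congr #|pred_of_set _|; apply/setP => - [v c].
    apply/imsetP/idP => [[p]|vS]; first by rewrite inE => h ->.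
    have := subsetP SUF _ vS; rewrite inE => /andP [/u_surj [i ei] /w_surj [j ej]].
    by simpl in ei, ej; exists (i, j); rewrite ?inE /g /= -?ei -?ej.
  rewrite -cT; apply: le_trans (spread T); rewrite ler_nat.
  apply: subset_leq_card; apply/subsetP => s; rewrite !unfold_in /= => /andP [h1 /hs h2].
  by apply/setIP; split.
rewrite [X in X%:R <= _]eq_card0; first by apply: mulr_ge0 => //; apply: exprn_ge0; apply: divr_ge0.
move=> s; rewrite !inE; apply/negP => /andP [_ h]; move/negP: SUF; apply; apply: subset_trans h _.
by apply/subsetP => _ /imsetP [i _ ->]; rewrite inE uU wF.
Qed.

End Matching.

Local Close Scope ring_scope.

(** Cardinals become variables and the rest of the context is dropped before [lia] runs. *)
Ltac clia :=
  repeat match goal with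
  | H : is_true (leq _ _) |- _ => revert H
  | H : @eq nat _ _ |- _ => revert H
  end;
  repeat match goal with
  | |- context [@card ?T ?A] =>
      let n := fresh "n" in set n := @card T A; move: n => n
  end; clear; intros; lia.

Lemma card_fibers (S T : finType) (P : {set S * T}) :
  #|P| = \sum_v #|[set y | (v, y) \in P]|.
Proof.
rewrite -sum1_card (partition_big (fun p : S * T => p.1) xpredT) //=.
apply: eq_bigr => v _; rewrite sum1dep_card.
have inj : injective (fun y : T => (v, y)) by move=> x y [].
rewrite -(card_imset _ inj); congr #|pred_of_set _|; apply/setP => - [w y].
rewrite !inE /=; apply/andP/imsetP => [[h /eqP e]|[z]].
  by exists y; rewrite ?inE -?e.
by rewrite inE => h [-> ->]; rewrite eqxx.
Qed.

Lemma card_fibersV (S T : finType) (P : {set S * T}) :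
  #|P| = \sum_y #|[set v | (v, y) \in P]|.
Proof.
pose f (p : S * T) := (p.2, p.1).
have inj : injective f by move=> [a b] [c d] [-> ->].
rewrite -(card_imset _ inj) card_fibers; apply: eq_bigr => y _.
congr #|pred_of_set _|; apply/setP => v; rewrite !inE.
apply/imsetP/idP => [[[a b] h [-> ->]] //|h]; by exists (v, y).
Qed.

Lemma exists_subset (T : finType) (B : {set T}) k : (k <= #|B|)%N ->
  exists2 A : {set T}, A \subset B & #|A| = k.
Proof.
case/card_geqP => s [us <- sB]; exists [set x in s].
  by apply/subsetP => x; rewrite inE => /sB.
by rewrite cardsE; apply/card_uniqP.
Qed.

(** * Proper partial colourings as sets of pairs *)

Section Graph.
Variables (V C : finType) (e : rel V).
Implicit Types (M : {set V * C}) (v x y : V) (c : C).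
Hypotheses (e_sym : symmetric e) (e_irr : irreflexive e).

Definition nbrs v : {set V} := [set u | e v u].

Definition pcol M : bool := [forall p in M, forall q in M,
  ((p.1 == q.1) ==> (p == q)) && (e p.1 q.1 ==> (p.2 != q.2))].

Lemma pcolP M : reflect (forall p q, p \in M -> q \in M ->
  (p.1 = q.1 -> p = q) /\ (e p.1 q.1 -> p.2 <> q.2)) (pcol M).
Proof.
apply: (iffP forall_inP) => [h p q pM qM|h p pM].
  have /forall_inP /(_ q qM) /andP [/implyP h1 /implyP h2] := h p pM.
  split; first by move=> /eqP /h1 /eqP.
  by move=> /h2 /eqP.
apply/forall_inP => q qM; have [h1 h2] := h p q pM qM.
by apply/andP; split; apply/implyP; [move/eqP/h1 -> | move/h2/eqP].
Qed.

Lemma pcol0 : pcol set0.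
Proof. by apply/pcolP => p q; rewrite inE. Qed.

Definition usedc M v : {set C} := [set q.2 | q in [set q in M | e v q.1]].

Lemma usedcP M v c : reflect (exists2 u, e v u & (u, c) \in M) (c \in usedc M v).
Proof.
apply: (iffP imsetP) => [[[u c']]|[u eu uM]].
  by rewrite inE => /andP [h1 h2] /= ->; exists u.
by exists (u, c); rewrite // inE uM eu.
Qed.

Lemma usedc_card M v : pcol M -> (#|usedc M v| <= #|nbrs v :&: dom M|)%N.
Proof.
move=> /pcolP h; apply: (leq_trans (leq_imset_card _ _)).
rewrite -(card_in_imset (f := fst)); last first.
  move=> p q; rewrite !inE => /andP [pM _] /andP [qM _] /(proj1 (h _ _ pM qM)) //.
apply: subset_leq_card; apply/subsetP => z /imsetP [p]; rewrite inE => /andP [pM ep] ->.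
by rewrite !inE ep mem_dom.
Qed.

Lemma pcolU1 M v c : pcol M -> v \notin dom M -> c \notin usedc M v ->
  pcol ((v, c) |: M).
Proof.
move=> /pcolP h vM cM; apply/pcolP => p q; rewrite !inE.
have aux (q0 : V * C) : q0 \in M ->
   (v = q0.1 -> (v, c) = q0) /\ (e v q0.1 -> c <> q0.2).
  move=> qM; split; first by move=> e1; rewrite e1 mem_dom in vM.
  move=> ev ec; move/negP: cM; apply; apply/usedcP; exists q0.1 => //.
  by rewrite ec -surjective_pairing.
move=> /orP [/eqP ->|pM] /orP [/eqP ->|qM] /=; try exact: aux; try exact: h.
- by rewrite e_irr.
- have [h1 h2] := aux _ pM; split => [/esym /h1 //|]; rewrite e_sym => /h2 + /esym //.
Qed.

Lemma pcolU M M' : pcol M -> pcol M' -> [disjoint dom M & dom M'] ->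
  (forall p q, p \in M -> q \in M' -> e p.1 q.1 -> p.2 <> q.2) -> pcol (M :|: M').
Proof.
move=> /pcolP h /pcolP h' dj H; apply/pcolP => p q.
have aux p0 q0 : p0 \in M -> q0 \in M' -> p0.1 <> q0.1.
  by move=> /mem_dom pM /mem_dom qM eq; rewrite eq in pM; rewrite (disjointFr dj pM) in qM.
rewrite !inE => /orP [pM|pM] /orP [qM|qM]; try exact: h; try exact: h'.
- by split; [move=> /(aux _ _ pM qM) | exact: H].
- split; first by move=> /esym /(aux _ _ qM pM).
  by rewrite e_sym => /(H _ _ qM pM) ne /esym.
Qed.

Lemma matching_pcol M : matching M -> pcol M.
Proof.
move=> /matchingP h; apply/pcolP => p q pM qM; split.
  by move=> eq; apply: h; rewrite ?eq ?eqxx.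
move=> epq eq; have e' := h p q pM qM; rewrite eq eqxx orbT in e'.
by rewrite e' ?e_irr in epq.
Qed.

End Graph.

(** * Random bipartitions *)

Section Cut.
Variables (V : finType) (P : {set V * V}).
Hypothesis Pirr : forall p, p \in P -> p.1 != p.2.

(** Averaging over all [A]: an ordered pair of distinct points is split in the given direction by a
    quarter of the sets. *)
Lemma exists_cut : exists A : {set V},
  (#|P| <= 4 * #|[set p in P | (p.1 \in A) && (p.2 \notin A)]|)%N.
Proof.
case: (pickP (fun A : {set V} =>
  #|P| <= 4 * #|[set p in P | (p.1 \in A) && (p.2 \notin A)]|)%N) => [A hA|h'].
  by exists A.
have h (A : {set V}) : ~~ (#|P| <= 4 * #|[set p in P | (p.1 \in A) && (p.2 \notin A)]|)%N.
  by apply/negP => hA; have := h' A; rewrite hA.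
pose cut (A : {set V}) := #|[set p in P | (p.1 \in A) && (p.2 \notin A)]|.
pose N := #|{: {set V}}|.
have N0 : (0 < N)%N by apply/card_gt0P; exists set0.
have h1 : (4 * \sum_(A : {set V}) cut A < N * #|P|)%N.
  rewrite big_distrr /= /N -sum_nat_const.
  apply: (@leq_ltn_trans (\sum_(A : {set V}) (#|P|.-1))).
    apply: leq_sum => A _; have := h A; rewrite -ltnNge -/(cut A) => hA.
    by rewrite -ltnS (leq_trans hA) // leqSpred.
  rewrite !sum_nat_const ltn_pmul2l // prednK //.
  by have := h set0; rewrite -ltnNge => hA; apply: leq_ltn_trans hA.
exfalso; move: h1; rewrite ltnNge => /negP; apply.
rewrite mulnC -sum_nat_const.
have -> : \sum_(A : {set V}) cut A =
   \sum_(p in P) #|[set A : {set V} | (p.1 \in A) && (p.2 \notin A)]|.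
  rewrite (eq_bigr (fun A : {set V} => \sum_(p in P) nat_of_bool ((p.1 \in A) && (p.2 \notin A)))).
    rewrite exchange_big /=; apply: eq_bigr => p _.
    by rewrite -sum1dep_card [RHS]big_mkcond; apply: eq_bigr => A _; case: ifP.
  move=> A _; rewrite /cut -sum1dep_card big_mkcondr.
  by apply: eq_bigr => p _; case: ifP.
rewrite big_distrr /=; apply: leq_sum => p pP; set T := [set A | _].
(* [f] records how [A] meets the pair and then forces the pattern in, out. The four patterns give
   [N <= 4 * #|T|]. *)
pose f (A : {set V}) := ((p.1 \in A, p.2 \in A), (p.1 |: A) :\ p.2).
have inj : injective f.
  move=> A A' [e1 e2 /setP e3]; apply/setP => z; have := e3 z; rewrite !inE.
  have [->|/= _] := eqVneq z p.2; first by rewrite e2.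
  by have [->|/= _] := eqVneq z p.1; first by rewrite e1.
rewrite /N -[X in (X <= _)%N]cardsT -(card_imset _ inj).
apply: (@leq_trans #|setX [set: bool * bool] T|).
  apply: subset_leq_card; apply/subsetP => _ /imsetP [A _ ->]; rewrite !inE /=.
  by rewrite (Pirr pP) !eqxx.
by rewrite cardsX cardsT card_prod card_bool.
Qed.
End Cut.

(** * Colouring an almost complete cluster *)

Section Cluster.
Variables (R : realFieldType) (V C : finType) (e : rel V).
Variables (M0 : {set V * C}) (Q : {set V}) (K : nat).
Implicit Types (M : {set V * C}) (v x y : V) (c : C).
Hypotheses (e_sym : symmetric e) (e_irr : irreflexive e).
Hypotheses (M0col : pcol e M0) (M0Q : [disjoint dom M0 & Q]).
Hypotheses (cardC : #|C| = K) (degK : forall v, (#|nbrs e v| < K)%N).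
Hypothesis Q1 : (20 * 1000 * #|Q| <= (20 * 1000 + 1) * K)%N.
Hypothesis Q2 : forall v, v \in Q ->
  (20 * 1000 * K <= 20 * 1000 * #|nbrs e v :&: Q| + K)%N.
Hypothesis K1 : (20 * 1000 <= K)%N.
Hypothesis Q0 : (0 < #|Q|)%N.

Let us v := usedc e M0 v.
Definition nonadj : {set V * V} :=
  [set p | [&& p.1 \in Q, p.2 \in Q, p.1 != p.2 & ~~ e p.1 p.2]].
Let nb v := #|[set y | (v, y) \in nonadj]|.

Lemma nonadj_sym x y : ((x, y) \in nonadj) = ((y, x) \in nonadj).
Proof. by rewrite !inE /= e_sym eq_sym andbCA. Qed.

Lemma deg_split v : v \in Q -> (#|nbrs e v :&: Q| + nb v + 1 = #|Q|)%N.
Proof.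
move=> vQ; rewrite addn1 [RHS](cardsD1 v) vQ add1n; congr _.+1.
rewrite -[RHS](cardsID (nbrs e v)); congr addn.
  congr #|pred_of_set _|; apply/setP => y; rewrite !inE.
  by case: (eqVneq y v) => [->|]; rewrite ?e_irr ?andbF //= andbC.
congr #|pred_of_set _|; apply/setP => y; rewrite !inE vQ /=.
by rewrite eq_sym; case: (y == v); rewrite ?andbF //= andbC.
Qed.

Lemma nb_out v : v \notin Q -> nb v = 0%N.
Proof.
move=> vQ; apply/eqP; rewrite cards_eq0; apply/eqP/setP => y.
by rewrite !inE (negbTE vQ).
Qed.

Lemma nb_le v : (10 * 1000 * nb v <= K)%N.
Proof.
have [vQ|/nb_out ->] := boolP (v \in Q); last by rewrite muln0.
by have := deg_split vQ; have := Q2 vQ; move: Q1; clia.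
Qed.

Lemma us_le v : v \in Q -> (#|us v| + #|nbrs e v :&: Q| < K)%N.
Proof.
move=> vQ; apply: leq_ltn_trans (degK v).
rewrite -[leqRHS](cardsID Q) addnC leq_add2l.
apply: leq_trans (usedc_card v M0col) _; apply: subset_leq_card.
apply/subsetP => y; rewrite !inE => /andP [-> yM]; rewrite andbT.
by rewrite (disjointFr M0Q).
Qed.

(** The budget of the cluster. A vertex has fewer than [K] neighbours, so forbidden colours and
    surplus vertices are paid for by non-neighbours inside [Q], which phase 2 converts into repeated
    colours. *)
Lemma us_le1 v : v \in Q -> (#|us v| + #|Q| <= K + nb v)%N.
Proof. by move=> vQ; have := us_le vQ; have := deg_split vQ; clia. Qed.

Lemma us_le2 v : v \in Q -> (20 * 1000 * #|us v| <= K)%N.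
Proof. by move=> vQ; have := us_le vQ; have := Q2 vQ; clia. Qed.

Lemma Q_ge : (19 * 1000 * K <= 20 * 1000 * #|Q|)%N.
Proof.
case/card_gt0P: Q0 => v vQ; have := Q2 vQ.
by have := subset_leq_card (subsetIr (nbrs e v) Q); clia.
Qed.

Definition crossing (X : {set V}) := [set p in nonadj | (p.1 \in X) && (p.2 \notin X)].

(** Non-adjacency is symmetric, so both sides of a cut have the same number of crossing pairs and
    the smaller may serve as [X]. Smallness matters because phase 1 gives distinct colours to all of
    [X] and must keep spare ones. *)
Lemma cross_cut : exists X : {set V}, [/\ X \subset Q, (2 * #|X| <= #|Q|)%N &
  (#|nonadj| <= 4 * #|crossing X|)%N].
Proof.
have [|A hA] := @exists_cut V nonadj; first by move=> p; rewrite inE => /and4P [].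
have h1 : [set p in nonadj | (p.1 \in A) && (p.2 \notin A)] = crossing (A :&: Q).
  apply/setP => - [x y]; rewrite !inE /=.
  by case: (x \in Q) => //; case: (y \in Q); rewrite ?andbT ?andbF.
have h2 : #|crossing (A :&: Q)| = #|crossing (Q :\: A)|.
  pose f (p : V * V) := (p.2, p.1).
  have inj : injective f by move=> [a b] [c d] [-> ->].
  rewrite -(card_imset _ inj); congr #|pred_of_set _|; apply/setP => - [x y].
  apply/imsetP/idP => [[[a b] h [-> ->]]|h].
    move: h; rewrite !inE /= e_sym eq_sym.
    by case: (a \in Q); case: (b \in Q); case: (a \in A); case: (b \in A); rewrite ?andbT ?andbF.
  exists (y, x) => //; move: h; rewrite !inE /= e_sym eq_sym.
  by case: (x \in Q); case: (y \in Q); case: (x \in A); case: (y \in A); rewrite ?andbT ?andbF.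
rewrite h1 in hA.
have [h|h] := leqP (2 * #|A :&: Q|) #|Q|.
  by exists (A :&: Q); split => //; apply: subsetIr.
exists (Q :\: A); split; [exact: subsetDl| |by rewrite -h2].
by have := cardsID A Q; rewrite setIC; clia.
Qed.

(** * Phase 1: distinct colours on one side of the cut *)

Section Phase1.
Variable X : {set V}.
Hypotheses (XQ : X \subset Q) (X2 : (2 * #|X| <= #|Q|)%N).
Let xn x := [set y | (x, y) \in crossing X].

(** The last clause prepares phase 2: each colour stays usable at half of the non-neighbours across
    the cut. *)
Definition phase1 M := [/\ matching M, dom M = X,
  forall p, p \in M -> p.2 \notin us p.1 &
  forall p, p \in M -> (#|xn p.1| <= 2 * #|[set y in xn p.1 | p.2 \notin us y]|)%N].

(** [X] takes up at most about half of the colours and few others are excluded, so [K / 4] choices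
    always remain; 8 instead of 4 absorbs the rounding. *)
Lemma phase1_spr : spr (8 / K%:R : R)%R phase1.
Proof.
have K0 : (0 < K%:R :> R)%R by rewrite ltr0n; move: K1; clia.
pose A : {set V * C} := [set p | (p.2 \notin us p.1) &&
  (#|xn p.1| <= 2 * #|[set y in xn p.1 | p.2 \notin us y]|)%N].
have h4 : (0 < K %/ 4)%N by rewrite divn_gt0 //; move: K1; clia.
apply: (@spr_sub _ _ (1 / (K %/ 4)%:R)%R _ (fun M => [/\ M \subset A, matching M & dom M = X])).
- by rewrite divr_ge0.
- rewrite ler_pdivrMr ?ltr0n // mulrAC ler_pdivlMr // mul1r -natrM ler_nat.
  by move: K1; clia.
- by move=> M [/subsetP sA mM dM]; split => // p /sA; rewrite inE => /andP [].
apply: spr_greedy => // x xX; have xQ := subsetP XQ _ xX.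
pose bad := [set c | (2 * #|[set y in xn x | c \notin us y]| < #|xn x|)%N].
have hA : (K <= #|[set c | (x, c) \in A]| + (#|us x| + #|bad|))%N.
  rewrite -cardC -cardsT.
  apply: (@leq_trans #|[set c | (x, c) \in A] :|: (us x :|: bad)|).
    apply: subset_leq_card; apply/subsetP => c _; rewrite !inE /=.
    by case: (c \in us x) => //=; rewrite leqNgt; case: (_ < _)%N.
  apply: (leq_trans (leq_card_setU _ _)); rewrite leq_add2l; exact: leq_card_setU.
(* Double counting: each [y] forbids at most [K / 20000] colours, while a bad colour is forbidden at
   over half of [xn x]. *)
have hbad : (10 * 1000 * #|bad| <= K)%N.
  pose W : {set V * C} := [set p | (p.1 \in xn x) && (p.2 \in us p.1)].
  have W1 : (20 * 1000 * #|W| <= #|xn x| * K)%N.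
    rewrite card_fibers big_distrr /= -sum_nat_const [leqRHS]big_mkcond /=.
    apply: leq_sum => y _; case: ifP => yx; last first.
      rewrite (_ : [set c | _] = set0) ?cards0 //; apply/setP => c.
      by rewrite in_set0 inE [_ \in W]inE /= yx.
    rewrite (_ : [set c | _] = us y).
      apply: us_le2; have : (x, y) \in crossing X by move: yx; rewrite inE.
      by rewrite !inE /= => /andP [/and4P []].
    by apply/setP => c; rewrite inE [_ \in W]inE /= yx.
  have W2 : (#|bad| * #|xn x| <= 2 * #|W|)%N.
    rewrite card_fibersV big_distrr /= -sum_nat_const big_mkcond /=.
    apply: leq_sum => c _; case: ifP => // cb.
    have := cardsID [set y | c \in us y] (xn x); move: cb; rewrite inE.
    have -> : xn x :\: [set y | c \in us y] = [set y in xn x | c \notin us y].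
      by apply/setP => y; rewrite !inE andbC.
    have -> : xn x :&: [set y | c \in us y] = [set v | (v, c) \in W].
      by apply/setP => y; rewrite !inE.
    by clia.
  have [x0|x0] := posnP #|xn x|.
    rewrite (_ : bad = set0) ?cards0 ?muln0 //; apply/setP => c.
    by rewrite !inE x0 ltn0.
  rewrite -(leq_pmul2l x0).
  move: W1 W2; set a := #|W|; set b := #|bad|; set d := #|xn x| => W1 W2.
  have : (20 * 1000 * (b * d) <= 20 * 1000 * (2 * a))%N by rewrite leq_mul2l W2 orbT.
  have -> : (d * (10 * 1000 * b) = 10 * 1000 * (b * d))%N by clia.
  by clia.
have h := us_le2 xQ.
have : (4 * (K %/ 4) <= K)%N by rewrite mulnC leq_trunc_div.
by move: K1 X2 Q1; clia.
Qed.
End Phase1.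

(* 99 = 3 + 6 * 16, where 1/16 is the proportion that makes a colour bad in phase 3. *)
Definition npicks := (99 * #|nonadj| %/ #|Q|)%N.

Lemma nonadj_le : (10 * 1000 * #|nonadj| <= #|Q| * K)%N.
Proof.
rewrite card_fibers big_distrr /= -sum_nat_const [leqRHS]big_mkcond /=.
apply: leq_sum => v _; case: ifP => vQ; first exact: nb_le.
by have := nb_out (negbT vQ); rewrite /nb => ->; rewrite muln0.
Qed.

Lemma npicks_le1 : (npicks * #|Q| <= 99 * #|nonadj|)%N.
Proof. exact: leq_trunc_div. Qed.

Lemma npicks_le : (100 * npicks <= K)%N.
Proof.
rewrite -(leq_pmul2r Q0); have := npicks_le1; have := nonadj_le.
have -> : (100 * npicks * #|Q| = 100 * (npicks * #|Q|))%N by rewrite mulnA.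
set a := (npicks * #|Q|)%N; rewrite [(K * _)%N]mulnC; set b := (#|Q| * K)%N.
by clia.
Qed.

(** * Phase 2: repeating colours across the cut *)

Section Phase2.
Variables (X : {set V}) (M1 : {set V * C}).
Hypotheses (XQ : X \subset Q) (X2 : (2 * #|X| <= #|Q|)%N).
Hypotheses (Xcut : (#|nonadj| <= 4 * #|crossing X|)%N) (hM1 : phase1 X M1).

(* Pairs (y, c) such that y may repeat the colour c that phase 1 gave to a non-neighbour. *)
Definition cand2 : {set V * C} := [set p | (p.2 \notin us p.1) &&
  [exists q in M1, (q.2 == p.2) && ((q.1, p.1) \in crossing X)]].

(** The cut keeps a quarter of the non-adjacent pairs, and the colours of phase 1 are allowed at
    half of those. *)
Lemma cand2_card : (#|nonadj| <= 8 * #|cand2|)%N.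
Proof.
have [/matchingP mM dM uM xM] := hM1.
pose T' : {set (V * C) * V} := [set t | (t.1 \in M1) && ((t.1.1, t.2) \in crossing X)].
pose T := [set t in T' | t.1.2 \notin us t.2].
have hT : (#|T| <= #|cand2|)%N.
  (* Forgetting [x] loses nothing: [c] determines it, because phase 1 uses each colour once. *)
  pose f (t : (V * C) * V) := (t.2, t.1.2).
  rewrite -(card_in_imset (f := f)).
    apply: subset_leq_card; apply/subsetP => z /imsetP [[[x c] y]].
    rewrite inE [_ \in T']inE /= => /andP [/andP [h1 h2] h3] ->.
    rewrite inE h3 /=; apply/existsP; exists (x, c).
    by rewrite h1 eqxx h2.
  have T1 t : t \in T -> t.1 \in M1 by rewrite inE => /andP []; rewrite inE => /andP [].
  move=> [[x c] y] [[x' c'] y'] /T1 /= h1 /T1 /= h2 [-> ec].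
  by have := mM _ _ h1 h2; rewrite /= ec eqxx orbT => /(_ isT) ->.
have h1 : (#|T'| <= 2 * #|T|)%N.
  rewrite !card_fibers big_distrr /=; apply: leq_sum => p _.
  have [pM|pM] := boolP (p \in M1); last first.
    rewrite (_ : [set y | _] = set0) ?cards0 //; apply/setP => y.
    by rewrite in_set0 inE [_ \in T']inE /= (negbTE pM).
  have := xM p pM; congr (is_true (leq _ (2 * _)%N)).
    by congr #|pred_of_set _|; apply/setP => y; rewrite !inE /= pM.
  by congr #|pred_of_set _|; apply/setP => y; rewrite !inE /= pM.
have h2 : (#|crossing X| <= #|T'|)%N.
  apply: leq_trans (leq_imset_card (fun t : (V * C) * V => (t.1.1, t.2)) T').
  apply: subset_leq_card; apply/subsetP => - [x y] xy.
  have : x \in dom M1 by rewrite dM; move: xy; rewrite inE => /and3P [].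
  case/domP => c cM; apply/imsetP; exists ((x, c), y) => //.
  by rewrite inE cM.
by move: Xcut; clia.
Qed.

Lemma cand2_row y : (#|[set p in cand2 | p.1 == y]| <= nb y)%N.
Proof.
have [/matchingP mM dM uM xM] := hM1.
pose S := [set q in M1 | (q.1, y) \in nonadj].
apply: (@leq_trans #|S|).
  apply: leq_trans (leq_imset_card (fun q : V * C => (y, q.2)) S).
  apply: subset_leq_card; apply/subsetP => - [y' c]; rewrite inE /= => /andP [h /eqP ey].
  move: h; rewrite ey inE /= => /andP [_ /existsP [q /andP [qM /andP [/eqP qc qy]]]].
  apply/imsetP; exists q; rewrite -?qc // [_ \in S]inE qM /=.
  by move: qy; rewrite inE => /andP [].
rewrite -(card_in_imset (f := fst)).
  apply: subset_leq_card; apply/subsetP => z /imsetP [q qS ->].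
  by move: qS; rewrite [_ \in S]inE => /andP [_ h]; rewrite inE nonadj_sym.
move=> p q; rewrite [p \in S]inE [q \in S]inE => /andP [pM _] /andP [qM _] ee.
by apply: mM; rewrite ?ee ?eqxx.
Qed.

Lemma cand2_col c : (10 * 1000 * #|[set p in cand2 | p.2 == c]| <= K)%N.
Proof.
have [/matchingP mM dM uM xM] := hM1.
have [|h0] := boolP [exists q in M1, q.2 == c]; last first.
  rewrite (_ : [set p in cand2 | _] = set0) ?cards0 ?muln0 //; apply/setP => p.
  rewrite in_set0; apply/negP; rewrite inE => /andP [h /eqP pc]; move/negP: h0; apply.
  move: h; rewrite inE => /andP [_ /existsP [q /andP [qM /andP [qp _]]]].
  by apply/existsP; exists q; rewrite qM -pc.
case/existsP => q /andP [qM /eqP qc].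
apply: leq_trans (nb_le q.1); rewrite leq_mul2l /=.
apply: leq_trans (leq_imset_card (fun y => (y, c)) _).
apply: subset_leq_card; apply/subsetP => - [y c']; rewrite inE /= => /andP [h /eqP ec].
move: h; rewrite ec inE /= => /andP [_ /existsP [q' /andP [qM' /andP [/eqP qc' h]]]].
apply/imsetP; exists y => //; rewrite inE.
have -> : q = q' by apply: mM; rewrite // qc qc' eqxx orbT.
by move: h; rewrite inE => /andP [].
Qed.

Definition phase2 M := [/\ M \subset cand2, matching M & #|M| = npicks].

(** At least an eighth of [#|nonadj|] is available and all picks together block well under half of
    that. So [B] is about [#|nonadj| / 16], and [npicks / B] is about [99 * 16 / #|Q|]. *)
Lemma phase2_spr : spr (3200 / K%:R : R)%R phase2.
Proof.
have K0 : (0 < K%:R :> R)%R by rewrite ltr0n; move: K1; clia.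
pose d := (K %/ (10 * 1000))%N.
(* The maximum with 1 keeps the denominator positive when [nonadj] is empty. *)
pose B := maxn 1 ((#|nonadj| + 15) %/ 16).
have B0 : (0 < B)%N by rewrite leq_max.
have hB : (#|nonadj| <= 16 * B)%N.
  have : ((#|nonadj| + 15) %/ 16 <= B)%N by rewrite leq_maxr.
  have := divn_eq (#|nonadj| + 15) 16; have := ltn_pmod (#|nonadj| + 15) (isT : 0 < 16)%N.
  by clia.
apply: (@spr_sub _ _ (npicks%:R / B%:R)%R _ phase2) => //.
- by rewrite divr_ge0.
- rewrite ler_pdivrMr ?ltr0n // mulrAC ler_pdivlMr // -!natrM ler_nat.
  rewrite -(leq_pmul2r Q0); have := npicks_le1; have := Q_ge; have := K1.
  have -> : (npicks * K * #|Q| = (npicks * #|Q|) * K)%N by rewrite mulnAC.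
  set a := (npicks * #|Q|)%N; set q := #|Q|; set E := #|nonadj| in hB * => k1 h1 h2.
  have : (a * K <= 99 * 16 * B * K)%N by rewrite leq_mul2r; apply/orP; right; clia.
  have : (19 * 1000 * (B * K) <= 20 * 1000 * (B * q))%N.
    by have := leq_mul (leqnn B) h1; rewrite !mulnA; clia.
  have -> : (3200 * B * q = 3200 * (B * q))%N by rewrite mulnA.
  have -> : (99 * 16 * B * K = 99 * 16 * (B * K))%N by rewrite mulnA.
  by clia.
apply: (@spr_picks _ _ _ cand2 B npicks d d B0).
- move=> v; apply: leq_trans (cand2_row v) _.
  by rewrite /d leq_divRL // mulnC nb_le.
- by move=> c; rewrite /d leq_divRL // mulnC cand2_col.
move=> j jm.
have hd : (10 * 1000 * d <= K)%N by rewrite mulnC leq_trunc_div.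
have hc := cand2_card; have h1 := npicks_le1; have h2 := Q_ge; move: Q1 K1 => q1 k1.
set E := #|nonadj| in hB hc h1 *; set q := #|Q| in h1 h2 q1.
(* A pick is being made, so [npicks] is positive. This forces [nonadj] to be large and makes the
   rounding in [B] harmless. *)
have hE : (q <= 99 * E)%N by apply: leq_trans h1; rewrite leq_pmull //; clia.
have hE2 : (190 <= E)%N by clia.
have hB2 : (16 * B <= E + 15)%N.
  rewrite /B -/E; have := leq_trunc_div (E + 15) 16; rewrite /maxn; case: ifP; clia.
have h3 : (10 * 1000 * (npicks * d) <= 100 * 2 * E)%N.
  rewrite -(leq_pmul2r Q0) -/q.
  have e1 : (10 * 1000 * (npicks * d) * q = (npicks * q) * (10 * 1000 * d))%N by clia.
  rewrite e1; apply: (@leq_trans (99 * E * K)); first exact: leq_mul.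
  have -> : (100 * 2 * E * q = 100 * E * (2 * q))%N by clia.
  by apply: leq_mul; clia.
have : (j * d <= npicks * d)%N by rewrite leq_mul2r ltnW ?orbT.
move: hc hB2 h3 hE2; clearbody d B E q; rewrite mulnDr.
by set a := (j * d)%N; set b := (npicks * d)%N; clia.
Qed.

End Phase2.

(** * Phase 3: using up the widely forbidden colours *)

Section Phase3.
Variables (X : {set V}) (M1 M2 : {set V * C}).
Hypotheses (XQ : X \subset Q) (X2 : (2 * #|X| <= #|Q|)%N).
Hypotheses (hM1 : phase1 X M1) (hM2 : phase2 X M1 M2).

Definition rest3 := (Q :\: X) :\: dom M2.
(* Unused colours forbidden at many of the remaining vertices: they cannot enter the final
   perfect matching, and phase 3 uses just enough of them for the good ones to suffice. *)
Definition badc : {set C} :=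
  [set c in ~: rng M1 | (#|rest3| < 16 * #|[set v in rest3 | c \in us v]|)%N].
Definition goodc : {set C} := ~: rng M1 :\: badc.
Definition cand3 : {set V * C} :=
  [set p | [&& p.1 \in rest3, p.2 \in badc & p.2 \notin us p.1]].
(** The subtraction truncates: the value is 0 when the good colours already suffice. *)
Definition nbad := (#|rest3| - #|goodc|)%N.

Lemma dom2 : dom M2 \subset Q :\: X.
Proof.
have [/subsetP s _ _] := hM2; apply/subsetP => v /domP [c /s].
rewrite inE /= => /andP [_ /existsP [q /andP [_ /andP [_]]]].
by rewrite !inE /= => /andP [/and4P [_ -> _ _] /andP [_ ->]].
Qed.

Lemma rest3_card : (#|rest3| + #|X| + npicks = #|Q|)%N.
Proof.
have [_ mM cM] := hM2.
rewrite -[RHS](cardsID X) (setIidPr XQ) -(cardsID (dom M2) (Q :\: X)).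
by rewrite (setIidPr dom2) card_dom // cM -/rest3; clia.
Qed.

Lemma rest3_ge : (K <= 3 * #|rest3|)%N.
Proof.
by have := rest3_card; have := npicks_le; have := Q_ge; move: X2 K1; clia.
Qed.

Lemma rest3Q v : v \in rest3 -> v \in Q.
Proof. by rewrite !inE => /and3P []. Qed.

(** Phase 2 introduces no new colour, so only the [#|X|] colours of phase 1 are gone. *)
Lemma colors_card : (#|goodc| + #|badc| + #|X| = K)%N.
Proof.
have [mM dM _ _] := hM1; rewrite -cardC -(cardsC (rng M1)) card_rng //.
rewrite -(cardsID badc (~: rng M1)) -/goodc -dM card_dom //.
have -> : ~: rng M1 :&: badc = badc.
  by apply/setIidPr; apply/subsetP => c; rewrite [_ \in badc]inE => /andP [].
by clia.
Qed.

Definition usedW : {set V * C} := [set p | (p.1 \in rest3) && (p.2 \in us p.1)].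

Lemma usedW_fib v : v \in rest3 -> [set c | (v, c) \in usedW] = us v.
Proof. by move=> vU; apply/setP => c; rewrite inE [_ \in usedW]inE vU. Qed.

Lemma usedW_fib0 v : v \notin rest3 -> [set c | (v, c) \in usedW] = set0.
Proof.
by move=> vU; apply/setP => c; rewrite inE [_ \in usedW]inE /= (negbTE vU) in_set0.
Qed.

Lemma usedW_le : (20 * 1000 * #|usedW| <= #|rest3| * K)%N.
Proof.
rewrite card_fibers big_distrr /= -sum_nat_const [leqRHS]big_mkcond /=.
apply: leq_sum => v _; case: ifP => vU; last by rewrite usedW_fib0 ?vU // cards0.
by rewrite usedW_fib //; apply: us_le2; apply: rest3Q.
Qed.

(** This is [us_le1] summed over the remaining vertices; their non-neighbours add up to at most
    [#|nonadj|]. *)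
Lemma usedW_le2 : (#|usedW| + #|rest3| * #|Q| <= #|rest3| * K + #|nonadj|)%N.
Proof.
rewrite [#|usedW|]card_fibers [#|nonadj|]card_fibers -!sum_nat_const.
rewrite (big_mkcond (mem rest3)) [X in (_ <= X + _)%N]big_mkcond -!big_split /=.
apply: leq_sum => v _; case: ifP => vU; last by rewrite usedW_fib0 ?vU // cards0.
by rewrite usedW_fib //; apply: us_le1; apply: rest3Q.
Qed.

(** Double counting in [usedW]; 1250 is 20000 / 16. *)
Lemma badc_le : (1250 * #|badc| <= K)%N.
Proof.
have h : (#|badc| * #|rest3| <= 16 * #|usedW|)%N.
  rewrite card_fibersV big_distrr /= -sum_nat_const big_mkcond /=.
  apply: leq_sum => c _; case: ifP => //; rewrite [_ \in badc]inE => /andP [_ /ltnW].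
  move=> hc; apply: (leq_trans hc); rewrite leq_mul2l /=; apply: subset_leq_card.
  by apply/subsetP => v; rewrite inE => /andP [h1 h2]; rewrite inE [_ \in usedW]inE h1.
have u0 : (0 < #|rest3|)%N by have := rest3_ge; move: K1; clia.
rewrite -(leq_pmul2r u0); have := usedW_le; move: h.
have -> : (1250 * #|badc| * #|rest3| = 1250 * (#|badc| * #|rest3|))%N by rewrite mulnA.
rewrite [(K * _)%N]mulnC; set a := (#|badc| * _)%N; set b := (#|rest3| * _)%N.
by clia.
Qed.

Lemma cand3_card : (#|rest3| * #|badc| <= #|cand3| + #|usedW|)%N.
Proof.
rewrite -cardsX; apply: leq_trans (leq_card_setU _ _); apply: subset_leq_card.
apply/subsetP => - [v c] /setXP [/= h1 h2]; rewrite inE [_ \in cand3]inE [_ \in usedW]inE /=.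
by rewrite h1 h2 /=; case: (c \in us v).
Qed.

Lemma nbad_eq : (0 < nbad)%N -> (#|badc| + #|Q| = K + nbad + npicks)%N.
Proof. by have := colors_card; have := rest3_card; rewrite /nbad; clia. Qed.

(** Counting [rest3] times [badc] against the summed budget leaves [(nbad + npicks) * #|rest3| <=
    #|cand3| + #|nonadj|]. Phase 2 made enough repetitions for [npicks * #|rest3|] to cancel
    [#|nonadj|], up to 1/32 of [nbad * #|rest3|]. *)
Lemma nbad_cand : (31 * (nbad * #|rest3|) <= 32 * #|cand3|)%N.
Proof.
have [->//|h0] := posnP nbad.
have h1 : (nbad * #|rest3| + npicks * #|rest3| <= #|cand3| + #|nonadj|)%N.
  have := cand3_card; have := usedW_le2; have e0 := nbad_eq h0.
  have : (#|rest3| * (#|badc| + #|Q|) = #|rest3| * (K + nbad + npicks))%N by rewrite e0.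
  rewrite !mulnDr; set a := (_ * K)%N; rewrite ![(#|rest3| * nbad)%N]mulnC ![(#|rest3| * npicks)%N]mulnC.
  set b := (_ * #|badc|)%N; set d := (_ * #|Q|)%N; set f := (nbad * _)%N; set g := (npicks * _)%N.
  by clia.
have h2 : (32 * #|nonadj| <= 32 * (npicks * #|rest3|) + nbad * #|rest3|)%N.
  have hq : (#|Q| <= 3 * #|rest3|)%N.
    by have := rest3_card; have := npicks_le; have := Q_ge; move: X2 K1; clia.
  have := divn_eq (99 * #|nonadj|) #|Q|; rewrite -/npicks.
  have := ltn_pmod (99 * #|nonadj|) Q0; set z := (_ %% _)%N.
  (* If the quotient rounds down to no picks, then [nonadj] is tiny and [nbad >= 1] pays for it. *)
  have [->|m0] := posnP npicks.
    have : (#|rest3| <= nbad * #|rest3|)%N by rewrite leq_pmull.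
    move: hq; set b := (nbad * _)%N; rewrite !mul0n; clia.
  have : (#|Q| <= npicks * #|Q|)%N by rewrite leq_pmull.
  have : (npicks * #|Q| <= 3 * (npicks * #|rest3|))%N.
    by rewrite [leqRHS]mulnCA leq_mul2l hq orbT.
  set a := (npicks * _)%N; set b := (npicks * _)%N; set d := (nbad * _)%N; clia.
move: h1 h2; set a := (nbad * _)%N; set b := (npicks * _)%N; clia.
Qed.

Definition phase3 M := [/\ M \subset cand3, matching M & #|M| = nbad].

(** Badness helps here: a bad colour is forbidden at over 1/16 of [rest3], so a pick blocks at most
    15/16 of a column plus a short row. Of the 31/32 of [nbad * #|rest3|] candidates, at least 1/64
    is always left. *)
Lemma phase3_spr : spr (200 / K%:R : R)%R phase3.
Proof.
have K0 : (0 < K%:R :> R)%R by rewrite ltr0n; move: K1; clia.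
pose B := maxn 1 ((nbad * #|rest3| + 63) %/ 64).
have B0 : (0 < B)%N by rewrite leq_max.
have hB : (nbad * #|rest3| <= 64 * B)%N.
  have : ((nbad * #|rest3| + 63) %/ 64 <= B)%N by rewrite leq_maxr.
  set a := (nbad * _)%N.
  have := divn_eq (a + 63) 64; have := ltn_pmod (a + 63) (isT : 0 < 64)%N.
  by clia.
apply: (@spr_sub _ _ (nbad%:R / B%:R)%R _ phase3) => //.
- by rewrite divr_ge0.
- rewrite ler_pdivrMr ?ltr0n // mulrAC ler_pdivlMr // -!natrM ler_nat.
  have : (nbad * K <= nbad * (3 * #|rest3|))%N by rewrite leq_mul2l rest3_ge orbT.
  by move: hB; rewrite mulnCA; set a := (nbad * #|rest3|)%N; clia.
apply: (@spr_picks _ _ _ cand3 B nbad #|badc| (15 * #|rest3| %/ 16) B0).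
- move=> v; apply: leq_trans (leq_imset_card (fun c => (v, c)) badc).
  apply: subset_leq_card; apply/subsetP => - [v' c]; rewrite inE /= => /andP [h /eqP ev].
  by move: h; rewrite inE ev /= => /and3P [_ h _]; apply/imsetP; exists c.
- move=> c; have [cb|cb] := boolP (c \in badc); last first.
    rewrite (_ : [set p in cand3 | _] = set0) ?cards0 //; apply/setP => p.
    rewrite in_set0 inE [_ \in cand3]inE; apply/negP => /andP [/and3P [_ h _] /eqP pc].
    by move: cb; rewrite -pc h.
  have h1 : (#|[set p in cand3 | p.2 == c]| <= #|rest3 :\: [set v | c \in us v]|)%N.
    apply: leq_trans (leq_imset_card (fun v => (v, c)) _).
    apply: subset_leq_card; apply/subsetP => - [v c']; rewrite inE /= => /andP [h /eqP ec].
    move: h; rewrite inE ec /= => /and3P [h1 _ h2]; apply/imsetP; exists v => //.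
    by rewrite inE h1 inE h2.
  rewrite leq_divRL // mulnC; move: cb; rewrite [_ \in badc]inE => /andP [_].
  have := cardsID [set v | c \in us v] rest3.
  have -> : rest3 :&: [set v | c \in us v] = [set v in rest3 | c \in us v].
    by apply/setP => v; rewrite [LHS]inE [RHS]inE inE.
  by move: h1; clia.
move=> j jh; have h0 : (0 < nbad)%N by case: (nbad) jh.
have h1 := nbad_cand; have h2 := badc_le; have h3 := rest3_ge.
have hd := leq_trunc_div (15 * #|rest3|) 16; set d := (15 * _ %/ 16)%N in hd *.
have hB2 : (64 * B <= nbad * #|rest3| + 64)%N.
  have := leq_trunc_div (nbad * #|rest3| + 63) 64; set z := (nbad * _)%N.
  by rewrite /B -/z /maxn; case: ifP => _; clia.
clearbody B.
set u := #|rest3| in hB hB2 h1 h3 hd *; set b := #|badc| in h2 *.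
have h4 : (16 * (j * d) <= 15 * (nbad * u))%N.
  have -> : (16 * (j * d) = j * (d * 16))%N by clia.
  apply: (@leq_trans (j * (15 * u))); first by rewrite leq_mul2l hd orbT.
  by rewrite mulnCA leq_mul2l /= leq_mul2r ltnW ?orbT.
have h5 : (1250 * (j * b) <= 3 * (nbad * u))%N.
  have -> : (1250 * (j * b) = j * (1250 * b))%N by clia.
  apply: (@leq_trans (nbad * (3 * u))); last by clia.
  by apply: leq_mul; [exact: ltnW | exact: leq_trans h3].
have h6 : (u <= nbad * u)%N by rewrite leq_pmull.
move: h1 hB2 h4 h5 h6 h3 K1; rewrite mulnDr.
set jd := (j * d)%N; set jb := (j * b)%N; set hu := (nbad * u)%N.
by clia.
Qed.

(** * Phase 4: a random perfect matching *)

Section Phase4.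
Variable M3 : {set V * C}.
Hypothesis hM3 : phase3 M3.

Definition rest4 := rest3 :\: dom M3.
Definition cand4 : {set V * C} :=
  [set p | [&& p.1 \in rest4, p.2 \in goodc & p.2 \notin us p.1]].
Definition phase4 M := [/\ M \subset cand4, matching M & dom M = rest4].

Lemma dom3 : dom M3 \subset rest3.
Proof.
have [/subsetP s _ _] := hM3; apply/subsetP => v /domP [c /s].
by rewrite inE => /and3P [].
Qed.

Lemma rest4_card : (#|rest4| + nbad = #|rest3|)%N.
Proof.
have [_ mM cM] := hM3.
by rewrite -[RHS](cardsID (dom M3)) (setIidPr dom3) card_dom // cM addnC.
Qed.

Lemma rest4_ge : (K <= 3 * #|rest4|)%N.
Proof.
have := rest4_card; have := colors_card; have := rest3_ge; have := badc_le.
by have := Q_ge; rewrite /nbad; move: X2 K1 Q1; clia.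
Qed.

Lemma rest3_le : (#|rest3| <= 2 * #|rest4|)%N.
Proof.
have := rest4_card; have := rest4_ge; have := badc_le; move: Q1 K1.
have [->|/nbad_eq] := posnP nbad; clia.
Qed.

(** A good colour is forbidden at no more than 1/16 of [rest3], hence at no more than [#|rest4| / 8]
    vertices, which is what [spr_perfect] tolerates. *)
Lemma phase4_spr : spr (24 / K%:R : R)%R phase4.
Proof.
have K0 : (0 < K%:R :> R)%R by rewrite ltr0n; move: K1; clia.
have [F4 sF cF] : exists2 F : {set C}, F \subset goodc & #|F| = #|rest4|.
  by apply: exists_subset; have := rest4_card; rewrite /nbad; clia.
have rg := rest4_ge.
have r0 : (0 < #|rest4|%:R :> R)%R by rewrite ltr0n; move: rg K1; clia.
pose A : {set V * C} := [set p | p.2 \notin us p.1].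
apply: (@spr_sub _ _ (8 / #|rest4|%:R)%R _
  (fun M => [/\ M \subset A :&: setX rest4 F4, matching M & dom M = rest4])).
- by rewrite divr_ge0.
- rewrite ler_pdivrMr // mulrAC ler_pdivlMr // -!natrM ler_nat.
  by move: rg; clia.
- move=> M [/subsetP s m d]; split => //; apply/subsetP => - [v c] /s.
  by rewrite inE => /andP []; rewrite inE => h /setXP [h1 /(subsetP sF) h2]; rewrite inE h1 h2 h.
apply: spr_perfect => //.
- by move: rg K1; clia.
- move=> v vU; have vQ : v \in Q by apply: rest3Q; move: vU; rewrite inE => /andP [].
  have : (#|[set c in F4 | (v, c) \notin A]| <= #|us v|)%N.
    apply: subset_leq_card; apply/subsetP => c; rewrite inE => /andP [_].
    by rewrite inE negbK.
  by have := us_le2 vQ; move: rg; clia.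
- move=> c /(subsetP sF); rewrite /goodc in_setD [_ \in badc]inE negb_and -leqNgt => /andP [].
  case/orP => [/negP nB /nB //|h] _.
  have : (#|[set v in rest4 | (v, c) \notin A]| <= #|[set v in rest3 | c \in us v]|)%N.
    apply: subset_leq_card; apply/subsetP => v; rewrite inE => /andP [].
    by rewrite [_ \in rest4]inE => /andP [_ h1]; rewrite [_ \in A]inE negbK => h2; rewrite inE h1.
  by have := rest3_le; move: h; clia.
Qed.

End Phase4.
End Phase3.

(** Only phases 1 and 2 share colours, and there the vertices concerned are non-adjacent. Phases 3
    and 4 use disjoint sets of fresh colours, and [us] guards against [M0]. *)
Lemma phases_ok (X : {set V}) M1 M2 M3 M4 : X \subset Q -> phase1 X M1 -> phase2 X M1 M2 ->
  phase3 X M1 M2 M3 -> phase4 X M1 M2 M3 M4 ->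
  pcol e (M0 :|: (M1 :|: (M2 :|: (M3 :|: M4)))) /\
  dom (M1 :|: (M2 :|: (M3 :|: M4))) = Q.
Proof.
move=> XQ h1 h2 h3 h4.
have d2 := dom2 h2; have d3 := dom3 h3.
have [m1 D1 u1 _] := h1; have [/subsetP s2 m2 _] := h2.
have [/subsetP s3 m3 _] := h3; have [/subsetP s4 m4 D4] := h4.
have f2 p : p \in M2 -> p.2 \notin us p.1 /\ exists q, [/\ q \in M1, q.2 = p.2 & ~~ e q.1 p.1].
  move=> /s2; rewrite inE => /andP [? /existsP [q /and3P [qM /eqP qp qe]]]; split => //.
  by exists q; split => //; move: qe; rewrite inE => /andP []; rewrite inE => /and4P [].
have f3 p : p \in M3 -> [/\ p.1 \in rest3 X M2, p.2 \in badc X M1 M2 & p.2 \notin us p.1].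
  by move=> /s3; rewrite inE => /and3P.
have f4 p : p \in M4 -> [/\ p.1 \in rest4 X M2 M3, p.2 \in goodc X M1 M2 & p.2 \notin us p.1].
  by move=> /s4; rewrite inE => /and3P.
have badr c : c \in badc X M1 M2 -> c \notin rng M1 by rewrite inE => /andP []; rewrite inE.
have goodr c : c \in goodc X M1 M2 -> c \notin rng M1 by rewrite inE => /andP [_]; rewrite inE.
have dj v : [/\ v \in dom M2 -> v \in Q /\ v \notin X,
    v \in dom M3 -> [/\ v \in Q, v \notin X & v \notin dom M2] &
    v \in rest4 X M2 M3 = [&& v \in Q, v \notin X, v \notin dom M2 & v \notin dom M3]].
  split.
  - by move=> /(subsetP d2); rewrite inE => /andP [].
  - by move=> /(subsetP d3); rewrite !inE => /and3P [].
  - rewrite in_setD in_setD in_setD; case: (v \in dom M2); case: (v \in dom M3);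
    by case: (v \in X); case: (v \in Q).
have dQ : dom (M1 :|: (M2 :|: (M3 :|: M4))) = Q.
  rewrite !domU D1 D4; apply/setP => v; rewrite 3!in_setU.
  have [j2 j3 ->] := dj v.
  have jX : v \in X -> v \in Q by apply: (subsetP XQ).
  case: (boolP (v \in X)) jX j2 j3 => [_ /(_ isT) -> //|nX _].
  case: (boolP (v \in dom M2)) => [_ /(_ isT) [-> _] //|n2 _].
  case: (boolP (v \in dom M3)) => [_ /(_ isT) [-> _] //|n3 _].
  by rewrite andbT.
split=> //.
have p34 : pcol e (M3 :|: M4).
  apply: pcolU => //; try exact: matching_pcol.
    rewrite D4 -setI_eq0; apply/eqP/setP => v; rewrite !in_setI in_set0.
    by have [_ _ ->] := dj v; case: (v \in dom M3); rewrite ?andbF.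
  move=> p q /f3 [_ pb _] /f4 [_ + _] _ pq; rewrite -pq.
  by rewrite in_setD pb.
have n34 p : p \in M3 :|: M4 -> p.2 \notin rng M1.
  by rewrite in_setU => /orP [/f3 [_ /badr]|/f4 [_ /goodr]].
have p234 : pcol e (M2 :|: (M3 :|: M4)).
  apply: pcolU => //; first exact: matching_pcol.
    rewrite domU D4 -setI_eq0; apply/eqP/setP => v; rewrite in_setI in_setU in_set0.
    have [j2 j3 ->] := dj v; case: (boolP (v \in dom M2)) => // v2; rewrite !andbF orbF.
    by apply/negP => /j3 [_ _]; rewrite v2.
  move=> p q /f2 [_ [p' [pM e1 _]]] /n34 qn _ pq; move: qn.
  by rewrite -pq -e1 mem_rng.
have p1234 : pcol e (M1 :|: (M2 :|: (M3 :|: M4))).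
  apply: pcolU => //; first exact: matching_pcol.
    rewrite !domU D1 D4 -setI_eq0; apply/eqP/setP => v; rewrite in_setI 2!in_setU in_set0.
    have [j2 j3 ->] := dj v; case: (boolP (v \in X)) => // vX; rewrite andbF orbF /=.
    by apply/negP => /orP [/j2 [_]|/j3 [_]]; rewrite vX.
  move=> p q pM; rewrite in_setU => /orP [/f2 [_ [p' [pM' e1 e2]]]|/n34 qn] ep pq.
    have pp : p = p' by move/matchingP: m1; apply => //; rewrite e1 pq eqxx orbT.
    by rewrite pp (negbTE e2) in ep.
  by rewrite -pq mem_rng in qn.
apply: pcolU => //; first by rewrite dQ.
move=> p q pM qM ep pq.
have : q.2 \in us q.1.
  by apply/usedcP; exists p.1; rewrite 1?e_sym // -pq -surjective_pairing.
move: qM; rewrite !in_setU => /orP [/u1/negbTE ->//|/or3P [/f2 [/negbTE ->//]|/f3 [_ _ /negbTE ->//]|]].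
by move=> /f4 [_ _ /negbTE ->].
Qed.

(** Which vertices are left for a later phase depends on earlier random picks, so the spreads add: 8
    + 3200 + 200 + 24 is below 4000. *)
Lemma cluster_spr : spr (4000 / K%:R : R)%R (fun M => pcol e (M0 :|: M) /\ dom M = Q).
Proof.
have K0 : (0 < K%:R :> R)%R by rewrite ltr0n; move: K1; clia.
have [X [XQ X2 Xcut]] := cross_cut.
apply: (@spr_sub _ _ (8 / K%:R + (3200 / K%:R + (200 / K%:R + 24 / K%:R)))%R _
  (unionP (phase1 X) (fun M1 => unionP (phase2 X M1) (fun M2 =>
     unionP (phase3 X M1 M2) (phase4 X M1 M2))))).
- by rewrite !addr_ge0 // divr_ge0.
- by rewrite -!mulrDl ler_pM2r ?invr_gt0 // -!natrD ler_nat.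
- move=> _ [M1 [_ [h1 [M2 [_ [h2 [M3 [M4 [h3 h4 ->]]] ->]]] ->]]].
  exact: (phases_ok XQ h1 h2 h3 h4).
apply: spr_bind; [by rewrite !addr_ge0 // divr_ge0 | exact: phase1_spr |] => M1 h1.
apply: spr_bind; [by rewrite !addr_ge0 // divr_ge0 | exact: phase2_spr |] => M2 h2.
apply: spr_bind; [by rewrite divr_ge0 | exact: phase3_spr |] => M3 h3.
exact: phase4_spr.
Qed.
End Cluster.

Local Open Scope ring_scope.

(** * Independent random choices *)

Section Product.
Variables (V A : finType).
Implicit Types (t : {ffun V -> A}) (u w : V) (a : A).
Notation Om := {ffun V -> A}.

Definition upd t u a : Om := [ffun w => if w == u then a else t w].

Lemma upd_eq t u a : upd t u a u = a. Proof. by rewrite ffunE eqxx. Qed.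
Lemma upd_neq t u a w : w != u -> upd t u a w = t w.
Proof. by move=> /negbTE wu; rewrite ffunE wu. Qed.
Lemma upd_upd t u a b : upd (upd t u a) u b = upd t u b.
Proof. by apply/ffunP => w; rewrite !ffunE; case: eqP. Qed.
Lemma upd_id t u : upd t u (t u) = t.
Proof. by apply/ffunP => w; rewrite !ffunE; case: eqP => [->|]. Qed.
Lemma upd_comm t u w a b : u != w -> upd (upd t u a) w b = upd (upd t w b) u a.
Proof.
move=> uw; apply/ffunP => z; rewrite !ffunE.
by have [->|//] := eqVneq z w; rewrite eq_sym (negbTE uw).
Qed.

Definition depends_on (X : {set V}) (E : {set Om}) :=
  forall t t', (forall w, w \in X -> t w = t' w) -> (t \in E) = (t' \in E).

(** Independence through a bijection: exchanging the coordinates outside [X] between two samples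
    carries the pairs whose first entry lies in [E :&: F] to the pairs in [E] times [F]. *)
Lemma depends_indep (X : {set V}) (E F : {set Om}) : depends_on X E -> depends_on (~: X) F ->
  (#|E :&: F| * #|{: Om}| = #|E| * #|F|)%N.
Proof.
move=> hE hF; rewrite -cardsT -!cardsX.
pose mix t t' : Om := [ffun w => if w \in X then t w else t' w].
pose f (p : Om * Om) := (mix p.1 p.2, mix p.2 p.1).
have mixE t t' w : mix t t' w = if w \in X then t w else t' w by rewrite ffunE.
have ff : involutive f.
  by move=> [t t']; rewrite /f /=; congr pair; apply/ffunP => w; rewrite !mixE; case: (w \in X).
rewrite -(card_imset _ (inv_inj ff)); congr #|pred_of_set _|; apply/setP => - [t t'].
have e1 : (mix t t' \in E) = (t \in E) by apply: hE => w wX; rewrite mixE wX.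
have e2 : (mix t t' \in F) = (t' \in F).
  by apply: hF => w; rewrite inE mixE => /negbTE ->.
have -> : ((t, t') \in [set f x | x in setX (E :&: F) [set: Om]]) =
   (f (t, t') \in setX (E :&: F) [set: Om]).
  by rewrite -{1}[(t, t')]ff mem_imset //; apply: inv_inj.
by rewrite !inE /= !andbT e1 e2.
Qed.

Lemma card_prescribed (W : {set V}) (s : V -> A) :
  (#|[set t : Om | [forall (w | w \in W), t w == s w]]| * #|A| ^ #|W| = #|{: Om}|)%N.
Proof.
pose F w : pred A := if w \in W then pred1 (s w) else predT.
have -> : #|[set t : Om | [forall (w | w \in W), t w == s w]]| = #|family F|.
  apply: eq_card => t; rewrite inE.
  apply/forallP/familyP => h w; have := h w; rewrite /F.
    by case: (w \in W).
  by case: (w \in W).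
rewrite card_family card_ffun foldrE big_map -[LHS]mulnC.
have -> : (\prod_(j <- enum V) #|F j| = \prod_(j in ~: W) #|A|)%N.
  rewrite [LHS]big_enum [RHS]big_mkcond /=; apply: eq_bigr => j _.
  by rewrite /F inE; case: (j \in W); rewrite ?card1.
by rewrite prod_nat_const -expnD cardsC.
Qed.

Variable R : realType.
Implicit Types (f g : Om -> R).

Hypothesis A0 : (0 < #|A|)%N.
Let L : R := #|A|%:R.
Let L0 : 0 < L. Proof. by rewrite ltr0n. Qed.
Let Li0 : 0 <= L^-1. Proof. by rewrite invr_ge0 ler0n. Qed.

(** Conditional expectation given all coordinates except [u]. *)
Definition avg u f t : R := (\sum_a f (upd t u a)) / L.

Lemma sum_avg u f : \sum_t avg u f t = \sum_t f t.
Proof.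
rewrite -mulr_suml.
have -> : \sum_t \sum_a f (upd t u a) = \sum_(t : Om) \sum_(a : A) f t.
  rewrite !pair_big /=.
  pose h (p : Om * A) := (upd p.1 u p.2, p.1 u).
  have hh : involutive h by move=> [t a]; rewrite /h /= upd_upd upd_id upd_eq.
  rewrite [RHS](reindex_inj (inv_inj hh)) /=; exact: eq_bigr.
by rewrite (eq_bigr (fun t => f t * L)) -?mulr_suml ?mulfK ?gt_eqF // => t _;
  rewrite sumr_const -mulr_natr.
Qed.

Lemma sum_mul_le u f g h : (forall t, 0 <= f t) -> (forall t a, f (upd t u a) = f t) ->
  (forall t, avg u g t <= h t) -> \sum_t f t * g t <= \sum_t f t * h t.
Proof.
move=> f0 fu gh; rewrite -(sum_avg u); apply: ler_sum => t _.
apply: (@le_trans _ _ (f t * avg u g t)); last by rewrite ler_wpM2l.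
rewrite /avg mulrA ler_wpM2r // mulr_sumr le_eqVlt.
by apply/orP; left; apply/eqP/eq_bigr => a _; rewrite fu.
Qed.

Lemma avg_lip u f (c : V -> R) :
  (forall w t a, `|f (upd t w a) - f t| <= c w) ->
  (forall w t a, `|avg u f (upd t w a) - avg u f t| <= c w).
Proof.
move=> h w t b; rewrite /avg -mulrBl -sumrB normrM (gtr0_norm (_ : 0 < L^-1)) ?invr_gt0 //.
rewrite ler_pdivrMr //; apply: (le_trans (ler_norm_sum _ _ _)).
rewrite mulr_natr -sumr_const; apply: ler_sum => a _.
have [->|wu] := eqVneq w u; last by rewrite upd_comm.
rewrite upd_upd subrr normr0; exact: le_trans (h u t b).
Qed.

(** Through [expR x <= 1 / (1 - x)]. *)
Lemma expR_le_quad (x : R) : x <= 1 / 2 -> expR x <= 1 + x + 2 * x ^+ 2.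
Proof.
move=> hx; have h := expR_ge1Dx (- x); have x1 : 0 < 1 - x by move: hx; lra.
have hp : 0 < 1 + - x by [].
have -> : expR x = (expR (- x))^-1 by rewrite expRN invrK.
apply: (@le_trans _ _ (1 - x)^-1).
  by rewrite lef_pV2 // posrE ?expR_gt0.
rewrite -[X in X <= _]mul1r ler_pdivrMr //.
have : 0 <= x ^+ 2 * (1 - 2 * x).
  by rewrite mulr_ge0 ?sqr_ge0 //; move: hx; lra.
by rewrite (_ : (1 + x + 2 * x ^+ 2) * (1 - x) = 1 + x ^+ 2 * (1 - 2 * x)); [lra | ring].
Qed.

Lemma azuma_step u f (c lam : R) : 0 <= lam -> lam * c <= 1 / 2 ->
  (forall t a, `|f (upd t u a) - f t| <= c) ->
  forall t, avg u (fun t => expR (lam * f t)) t <= expR (lam * avg u f t) * expR (2 * lam ^+ 2 * c ^+ 2).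
Proof.
move=> l0 lc h t; set m := avg u f t.
pose y a := lam * (f (upd t u a) - m).
have ym a : `|f (upd t u a) - m| <= c.
  have -> : f (upd t u a) - m = (\sum_b (f (upd t u a) - f (upd t u b))) / L.
    rewrite sumrB sumr_const mulrBl -[X in X / L]mulr_natr mulfK ?gt_eqF //.
  rewrite normrM (gtr0_norm (_ : 0 < L^-1)) ?invr_gt0 // ler_pdivrMr //.
  apply: (le_trans (ler_norm_sum _ _ _)); rewrite mulr_natr -sumr_const.
  apply: ler_sum => b _; have := h (upd t u b) a; by rewrite upd_upd.
have y1 a : y a <= 1 / 2.
  by apply: le_trans lc; rewrite ler_wpM2l //; apply: le_trans (ler_norm _) (ym a).
have y2 a : (y a) ^+ 2 <= lam ^+ 2 * c ^+ 2.
  rewrite -exprMn -(real_normK (num_real (y a))) /y normrM (ger0_norm l0).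
  by apply: lerXn2r; rewrite ?nnegrE ?mulr_ge0 ?ler_wpM2l //; apply: le_trans (ym a).
have s0 : \sum_a y a = 0.
  rewrite -mulr_sumr sumrB sumr_const -mulr_natr /m /avg mulfVK ?gt_eqF //.
  by rewrite subrr mulr0.
rewrite {1}/avg ler_pdivrMr //.
have -> : \sum_a expR (lam * f (upd t u a)) = expR (lam * m) * \sum_a expR (y a).
  rewrite mulr_sumr; apply: eq_bigr => a _; rewrite -expRD; congr expR.
  by rewrite /y -mulrDr addrC subrK.
rewrite -[leRHS]mulrA ler_wpM2l ?expR_ge0 //.
apply: (@le_trans _ _ (\sum_a (1 + y a + 2 * (lam ^+ 2 * c ^+ 2)))).
  apply: ler_sum => a _; apply: (le_trans (expR_le_quad (y1 a))).
  by rewrite lerD2l ler_wpM2l.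
rewrite 2!big_split /= s0 addr0 !sumr_const -mulrnDl -[X in X <= _]mulr_natr ler_wpM2r //.
by rewrite -mulrA; apply: expR_ge1Dx.
Qed.

(** Bounded differences in exponential-moment form. Averaging out the coordinate [u] adds
    [2 * lam ^+ 2 * c u ^+ 2] to the exponent and preserves the Lipschitz constants. *)
Lemma azuma f (c : V -> R) (lam : R) : 0 <= lam ->
  (forall u, lam * c u <= 1 / 2) ->
  (forall u t a, `|f (upd t u a) - f t| <= c u) ->
  \sum_t expR (lam * f t) <= #|{: Om}|%:R *
    expR (lam * ((\sum_t f t) / #|{: Om}|%:R) + 2 * lam ^+ 2 * \sum_u (c u) ^+ 2).
Proof.
move=> l0 lc lip.
pose F s := foldr avg f s.
have Flip s u t a : `|F s (upd t u a) - F s t| <= c u.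
  by elim: s u t a => [|w s IH] //=; apply: avg_lip.
have Fsum s : \sum_t F s t = \sum_t f t.
  by elim: s => [|w s IH] //=; rewrite sum_avg.
have Fexp s : \sum_t expR (lam * f t) <=
    (\sum_t expR (lam * F s t)) * expR (2 * lam ^+ 2 * \sum_(u <- s) (c u) ^+ 2).
  elim: s => [|w s IH]; first by rewrite big_nil mulr0 expR0 mulr1.
  apply: (le_trans IH); rewrite big_cons mulrDr expRD mulrA ler_wpM2r ?expR_ge0 //.
  rewrite -(sum_avg w) mulr_suml; apply: ler_sum => t _.
  exact: azuma_step.
have Finv s u t a : u \in s -> F s (upd t u a) = F s t.
  elim: s t => [//|w s IH] t; rewrite inE /= => /orP [/eqP ->|us].
    by rewrite /avg; congr (_ / L); apply: eq_bigr => b _; rewrite upd_upd.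
  have [->|uw] := eqVneq u w.
    by rewrite /avg; congr (_ / L); apply: eq_bigr => b _; rewrite upd_upd.
  by rewrite /avg; congr (_ / L); apply: eq_bigr => b _; rewrite upd_comm // IH.
(* Once every coordinate is averaged out nothing depends on [t], so the value is the mean. *)
have Fconst t t' : F (enum V) t = F (enum V) t'.
  pose g s := foldr (fun u t0 => upd t0 u (t' u)) t s.
  have g1 s : F (enum V) (g s) = F (enum V) t.
    by elim: s => [//|w s IH] /=; rewrite Finv ?mem_enum.
  have g2 s w : w \in s -> g s w = t' w.
    elim: s => [//|z s IH] /=; rewrite inE ffunE => /orP [/eqP ->|ws]; first by rewrite eqxx.
    by case: eqP => [->//|_]; apply: IH.
  by rewrite -(g1 (enum V)); congr F; apply/ffunP => w; rewrite g2 ?mem_enum.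
have O0 : (0 < #|{: Om}|)%N by rewrite card_ffun expn_gt0 A0.
apply: (le_trans (Fexp (enum V))); rewrite expRD mulrA big_enum /= ler_wpM2r ?expR_ge0 //.
have /card_gt0P [t0 _] := O0.
have -> : (\sum_t f t) / #|{: Om}|%:R = F (enum V) t0.
  rewrite -(Fsum (enum V)) (eq_bigr (fun=> F (enum V) t0)) => [|t _]; last exact: Fconst.
  by rewrite sumr_const -[X in X / _]mulr_natr mulfK // pnatr_eq0 -lt0n.
rewrite (eq_bigr (fun=> expR (lam * F (enum V) t0))) => [|t _]; last by rewrite (Fconst t t0).
by rewrite sumr_const -[leLHS]mulr_natl.
Qed.

End Product.

(** * Repeated colours in a sparse neighbourhood *)

Section Concentration.
Variables (R : realType) (V C : finType) (e : rel V) (N : {set V}) (K : nat).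
Hypotheses (e_sym : symmetric e) (K0 : (0 < K)%N) (cC : #|C| = K).
Hypotheses (degK : forall x, (#|nbrs e x| <= K)%N) (NK : (#|N| <= K)%N).
(* Trial colours come from a palette enlarged eight times; only (c, ord0) counts as colour c. *)
Notation A := (C * 'I_8)%type.
Notation Om := {ffun V -> A}.
Implicit Types (t : Om) (c : C) (u w x y : V) (a : A).

Definition cls t c : {set V} := [set w in N | t w == (c, ord0)].
Definition nonadjp : {set V * V} :=
  [set p | [&& p.1 \in N, p.2 \in N, p.1 != p.2 & ~~ e p.1 p.2]].
(* Colours seen on exactly two vertices of N, which are non-adjacent; such a colour survives
   as a repetition unless a vertex outside N kills it. *)
Definition inner t : {set C} := [set c | [exists p in nonadjp, cls t c == [set p.1; p.2]]].
Definition killers t c : {set V} :=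
  [set u in ~: N | (t u == (c, ord0)) && [exists x in cls t c, e u x]].
Definition saved t : {set C} := [set c in inner t | killers t c == set0].
Definition killed t u := [exists c in inner t, u \in killers t c].
Definition nbr_inner u t : {set C} := [set c in inner t | [exists x in cls t c, e u x]].

Let L : R := #|{: A}|%:R.
Let LE : L = 8 * K%:R.
Proof. by rewrite /L card_prod card_ord cC natrM mulrC. Qed.
Let K0R : 0 < K%:R :> R. Proof. by rewrite ltr0n. Qed.
Let L0 : 0 < L. Proof. by rewrite LE mulr_gt0. Qed.
Let A0 : (0 < #|{: A}|)%N. Proof. by rewrite card_prod card_ord cC muln_gt0 K0. Qed.

Lemma cls_upd t w a c : w \notin N -> cls (upd t w a) c = cls t c.
Proof.
move=> wN; apply/setP => x; rewrite !inE; case: (boolP (x \in N)) => //= xN.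
by rewrite upd_neq //; apply: contraNneq wN => <-.
Qed.

Lemma inner_upd t w a : w \notin N -> inner (upd t w a) = inner t.
Proof.
by move=> wN; apply/setP => c; rewrite !inE; apply: eq_existsb => p; rewrite cls_upd.
Qed.

Lemma nbr_inner_upd u t w a : w \notin N -> nbr_inner u (upd t w a) = nbr_inner u t.
Proof.
move=> wN; apply/setP => c; rewrite inE [RHS]inE inner_upd //; congr andb.
by apply: eq_existsb => x; rewrite cls_upd.
Qed.

Lemma killed_upd u t w a : w \notin N -> u != w -> killed (upd t w a) u = killed t u.
Proof.
move=> wN uw; apply: eq_existsb => c; rewrite inner_upd //; congr andb.
rewrite /killers !inE upd_neq //; congr andb; congr andb.
by apply: eq_existsb => x; rewrite cls_upd.
Qed.

Let g u t : R := if killed t u then 2 else 1.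
Let h u t : R := expR (#|nbr_inner u t|%:R / L).

(** Each colour of [nbr_inner u t] is killed by a single one of the [L] trial values of [u]. *)
Lemma avg_killed u t : u \notin N -> avg u (g u) t <= h u t.
Proof.
move=> uN; apply: (@le_trans _ _ (1 + #|nbr_inner u t|%:R / L)); last exact: expR_ge1Dx.
rewrite /avg ler_pdivrMr // mulrDl mul1r mulfVK ?gt_eqF //.
have -> : \sum_a g u (upd t u a) = \sum_(a : A) (1 + (killed (upd t u a) u)%:R).
  by apply: eq_bigr => a _; rewrite /g; case: ifP; rewrite ?addr0.
rewrite big_split /= sumr_const lerD2l -natr_sum ler_nat.
rewrite (eq_bigr (fun a => if killed (upd t u a) u then 1%N else 0%N)); last first.
  by move=> a _; case: ifP.
rewrite -big_mkcond sum1dep_card -(card_in_imset (f := fst)).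
  apply: subset_leq_card; apply/subsetP => c /imsetP [a]; rewrite inE.
  move=> /existsP [c' /andP []]; rewrite inner_upd // => ci.
  rewrite [_ \in killers _ _]inE upd_eq => /and3P [_ /eqP -> /existsP [x hx]] -> /=.
  rewrite [_ \in nbr_inner _ _]inE ci; apply/existsP; exists x.
  by move: hx; rewrite cls_upd.
have ord a : a \in [set a : A | killed (upd t u a) u] -> a.2 = ord0.
  rewrite inE => /existsP [c' /andP [_]]; rewrite inE => /and3P [_ + _].
  by rewrite upd_eq => /eqP ->.
by move=> [c i] [c' j] /ord /= -> /ord /= -> /= ->.
Qed.

(** Given the trial colours on [N], whether [u] kills depends on its own value alone. The outside
    vertices can thus be averaged one at a time, the other factors ignoring the current one. *)
Lemma sum_killed_le (s : seq V) (F : Om -> R) : uniq s -> {subset s <= ~: N} ->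
  (forall t, 0 <= F t) -> (forall u t a, u \in s -> F (upd t u a) = F t) ->
  \sum_t F t * \prod_(u <- s) g u t <= \sum_t F t * \prod_(u <- s) h u t.
Proof.
elim: s F => [|w s IH] F /=.
  by move=> _ _ _ _; apply: ler_sum => t _; rewrite !big_nil.
move=> /andP [ws us] sN F0 Fi.
have wN : w \notin N by have := sN w (mem_head _ _); rewrite inE.
have sN' : {subset s <= ~: N} by move=> u uS; apply: sN; rewrite inE uS orbT.
have g0 u t : 0 <= g u t by rewrite /g; case: ifP.
have h0 u t : 0 <= h u t by apply: expR_ge0.
have -> : \sum_t F t * \prod_(u <- w :: s) g u t =
   \sum_t (F t * g w t) * \prod_(u <- s) g u t.
  by apply: eq_bigr => t _; rewrite big_cons mulrA.
apply: (le_trans (IH _ us sN' _ _)).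
- by move=> t; apply: mulr_ge0.
- move=> u t a uS; rewrite Fi ?inE ?uS ?orbT //; congr (_ * _); rewrite /g killed_upd //.
    by have := sN' u uS; rewrite inE.
  by apply: contraNneq ws => ->.
have -> : \sum_t F t * g w t * \prod_(u <- s) h u t =
   \sum_t (F t * \prod_(u <- s) h u t) * g w t.
  by apply: eq_bigr => t _; rewrite mulrAC.
apply: (le_trans (@sum_mul_le _ _ R A0 w _ _ (h w) _ _ _)).
- by move=> t; rewrite mulr_ge0 // prodr_ge0.
- move=> t a; rewrite Fi ?mem_head //; congr (_ * _); apply: eq_bigr => u _.
  by rewrite /h nbr_inner_upd.
- by move=> t; apply: avg_killed.
by apply: ler_sum => t _; rewrite big_cons mulrA mulrAC.
Qed.

(** An inner colour that is not saved has a killer, and the trial value of a killer determines the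
    colour killed. So at most as many colours are lost as there are killing vertices. *)
Lemma saved_le t :
  (1 / 2) ^+ #|saved t| <= (1 / 2) ^+ #|inner t| * \prod_(u in ~: N) g u t :> R.
Proof.
have -> : \prod_(u in ~: N) g u t = 2 ^+ #|[set u in ~: N | killed t u]|.
  rewrite -prodr_const [RHS]big_mkcond [LHS]big_mkcond /=; apply: eq_bigr => u _.
  by rewrite !inE /g; case: (u \in N) => //=; case: ifP.
set m := #|[set u in _ | _]|.
have h1 : (#|inner t| <= #|saved t| + m)%N.
  rewrite -(cardsID [set c | killers t c == set0] (inner t)).
  have -> : inner t :&: [set c | killers t c == set0] = saved t.
    by apply/setP => c; rewrite !inE.
  rewrite leq_add2l; apply: leq_trans (leq_imset_card (fun u => (t u).1) _).
  apply: subset_leq_card; apply/subsetP => c; rewrite !inE => /andP [/set0Pn [u uk] ci].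
  apply/imsetP; exists u; last by move: uk; rewrite inE => /and3P [_ /eqP -> _].
  rewrite inE; have := uk; rewrite inE => /andP [-> _] /=.
  by apply/existsP; exists c; rewrite inE ci.
have hh : (0 <= 1 / 2 :> R) by rewrite divr_ge0.
apply: (@le_trans _ _ ((1 / 2) ^+ (#|saved t| + m) * 2 ^+ m)).
  have e1 : 1 / 2 * 2 = 1 :> R by field.
  by rewrite exprD -mulrA -exprMn e1 expr1n mulr1.
rewrite ler_wpM2r ?exprn_ge0 //; apply: (ler_wiXn2l hh _ h1).
by rewrite ler_pdivrMr // mul1r ler1n.
Qed.

(** An inner colour sits on two vertices, so at most [2 * K] vertices can kill it; the palette size
    [8 * K] turns this into 1/4. *)
Lemma prod_nbr_inner t : \prod_(u in ~: N) h u t <= expR (#|inner t|%:R / 4).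
Proof.
rewrite /h -expR_sum ler_expR -mulr_suml -natr_sum.
rewrite ler_pdivrMr // LE mulrC mulrA [X in _ <= X * _ * _]mulrC.
have : (\sum_(u in ~: N) #|nbr_inner u t| <= 2 * K * #|inner t|)%N.
  apply: (@leq_trans (\sum_u #|nbr_inner u t|)).
    by rewrite [X in (X <= _)%N]big_mkcond; apply: leq_sum => u _; case: ifP.
  pose W : {set V * C} := [set p | p.2 \in nbr_inner p.1 t].
  have -> : (\sum_u #|nbr_inner u t| = #|W|)%N.
    rewrite card_fibers; apply: eq_bigr => u _; apply: eq_card => c.
    by rewrite [RHS]inE [RHS]inE.
  rewrite card_fibersV mulnC -sum_nat_const [X in (_ <= X)%N]big_mkcond /=.
  apply: leq_sum => c _; case: ifP => ci; last first.
    rewrite (_ : [set v | _] = set0) ?cards0 //; apply/setP => v.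
    by rewrite in_set0 inE [_ \in W]inE /= inE ci.
  have := ci; rewrite inE => /existsP [p /andP [_ /eqP ep]].
  apply: (@leq_trans #|nbrs e p.1 :|: nbrs e p.2|).
    apply: subset_leq_card; apply/subsetP => v; rewrite inE [_ \in W]inE /= inE ci /=.
    case/existsP => x; rewrite ep => /andP [xp ev]; move: xp; rewrite !inE.
    by case/orP => /eqP <-; rewrite [e x v]e_sym ev ?orbT.
  apply: (leq_trans (leq_card_setU _ _)); rewrite mul2n -addnn; exact: leq_add.
rewrite -(ler_nat R) !natrM => hh; apply: (le_trans hh).
by rewrite le_eqVlt; apply/orP; left; apply/eqP; field.
Qed.

(** An inner colour contributes 1/2, which is at most [expR (- (1 / 2))], and its potential killers
    give back at most [expR (1 / 4)]. *)
Lemma sum_saved : \sum_t (1 / 2) ^+ #|saved t| <= \sum_t expR (- (#|inner t|%:R / 4)) :> R.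
Proof.
have hh : (0 <= 1 / 2 :> R) by rewrite divr_ge0.
apply: (@le_trans _ _ (\sum_t (1 / 2) ^+ #|inner t| * \prod_(u in ~: N) g u t)).
  by apply: ler_sum => t _; apply: saved_le.
apply: (@le_trans _ _ (\sum_t (1 / 2) ^+ #|inner t| * \prod_(u in ~: N) h u t)).
  rewrite (eq_bigr (fun t => (1 / 2) ^+ #|inner t| * \prod_(u <- enum (~: N)) g u t));
    last by move=> t _; rewrite big_enum.
  rewrite [X in _ <= X](eq_bigr (fun t => (1 / 2) ^+ #|inner t| * \prod_(u <- enum (~: N)) h u t));
    last by move=> t _; rewrite big_enum.
  apply: sum_killed_le.
  - exact: enum_uniq.
  - by move=> u; rewrite mem_enum.
  - by move=> t; rewrite exprn_ge0.
  - by move=> u t a; rewrite mem_enum inE => uN; rewrite inner_upd.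
apply: ler_sum => t _.
apply: (@le_trans _ _ ((1 / 2) ^+ #|inner t| * expR (#|inner t|%:R / 4))).
  by rewrite ler_wpM2l ?exprn_ge0 // prod_nbr_inner.
have h1 : 1 / 2 <= expR (- (1 / 2)) :> R by have := expR_ge1Dx (- (1 / 2) : R); lra.
apply: (@le_trans _ _ (expR (- (1 / 2)) ^+ #|inner t| * expR (#|inner t|%:R / 4))).
  by rewrite ler_wpM2r ?expR_ge0 //; apply: lerXn2r; rewrite ?nnegrE ?expR_ge0.
rewrite -expRM_natl -expRD ler_expR -mulr_natl.
by have : 0 <= #|inner t|%:R :> R by []; lra.
Qed.

Lemma inner_lip u t a :
  `|#|inner (upd t u a)|%:R - #|inner t|%:R| <= (if u \in N then 2 else 0) :> R.
Proof.
case: ifP => uN; last by rewrite inner_upd ?uN // subrr normr0.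
pose D := [set (t u).1; a.1].
have DE c : c \notin D -> (c \in inner (upd t u a)) = (c \in inner t).
  rewrite !inE negb_or => /andP [c1 c2]; apply: eq_existsb => p; congr andb.
  congr (_ == _); apply/setP => x; rewrite !inE ffunE; congr andb.
  have [->|//] := eqVneq x u; apply/eqP/eqP => eh; [move: c2|move: c1]; by rewrite eh eqxx.
have cD : (#|D| <= 2)%N by rewrite cards2; case: (_ != _).
have h1 : (#|inner (upd t u a)| <= #|inner t| + 2)%N.
  apply: (@leq_trans #|inner t :|: D|).
    apply: subset_leq_card; apply/subsetP => c ci; rewrite inE.
    by case: (boolP (c \in D)) => cDn; rewrite ?orbT // -DE // ci.
  by apply: (leq_trans (leq_card_setU _ _)); rewrite leq_add2l.
have h2 : (#|inner t| <= #|inner (upd t u a)| + 2)%N.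
  apply: (@leq_trans #|inner (upd t u a) :|: D|).
    apply: subset_leq_card; apply/subsetP => c ci; rewrite inE.
    by case: (boolP (c \in D)) => cDn; rewrite ?orbT // DE // ci.
  by apply: (leq_trans (leq_card_setU _ _)); rewrite leq_add2l.
move: h1 h2; rewrite -!(ler_nat R) !natrD ler_norml; lra.
Qed.

(** 7/512 is 1/64 times 7/8: both vertices receive the colour with probability [1 / (8 * K) ^ 2],
    and then a third vertex of [N] does so too with probability at most 1/8. *)
Lemma pair_count c (p : V * V) : p \in nonadjp ->
  (7 * #|{: Om}| <= 512 * K ^ 2 * #|[set t : Om | cls t c == [set p.1; p.2]]|)%N.
Proof.
rewrite inE => /and4P [p1 p2 pn _].
pose S (W : {set V}) := [set t : Om | [forall (w | w \in W), t w == (c, ord0)]].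
set T := [set t | _].
have AE : (#|{: A}| = 8 * K)%N by rewrite card_prod card_ord cC mulnC.
have S2 : (#|S [set p.1; p.2]| * (8 * K) ^ 2 = #|{: Om}|)%N.
  by rewrite -(card_prescribed [set p.1; p.2] (fun=> (c, ord0))) AE cards2 pn.
have S3 w : w \notin [set p.1; p.2] ->
    (#|S (w |: [set p.1; p.2])| * (8 * K) = #|S [set p.1; p.2]|)%N.
  move=> wn; have hh := card_prescribed (w |: [set p.1; p.2]) (fun=> (c, ord0) : A).
  have K2 : (0 < (8 * K) ^ 2)%N by rewrite expn_gt0 muln_gt0 K0.
  apply/eqP; rewrite -(eqn_pmul2r K2) S2 -hh AE cardsU1 wn cards2 pn /=.
  by rewrite -mulnA -expnS.
have sub : S [set p.1; p.2] \subset
    T :|: \bigcup_(w in N :\: [set p.1; p.2]) S (w |: [set p.1; p.2]).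
  apply/subsetP => t; rewrite inE => /forallP ht; rewrite in_setU.
  have hh w : w \in [set p.1; p.2] -> t w = (c, ord0).
    by move=> wp; apply/eqP; have /implyP := ht w; apply.
  have [//|tT] := boolP (t \in T).
  have s1 : [set p.1; p.2] \subset cls t c.
    apply/subsetP => w wp; rewrite inE hh // eqxx andbT.
    by move: wp; rewrite !inE => /orP [/eqP ->|/eqP ->].
  have /subsetPn [w wc wp] : ~~ (cls t c \subset [set p.1; p.2]).
    by apply: contraNN tT => s2; rewrite inE eqEsubset s2 s1.
  move: wc; rewrite inE => /andP [wN /eqP tw].
  apply/bigcupP; exists w; first by rewrite in_setD wp wN.
  rewrite inE; apply/forallP => x; apply/implyP; rewrite in_setU1 => /orP [/eqP ->|/hh ->//].
  by rewrite tw.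
have h1 : (8 * K * #|S [set p.1; p.2]| <= 8 * K * #|T| + K * #|S [set p.1; p.2]|)%N.
  have : (#|S [set p.1; p.2]| <= #|T| + \sum_(w in N :\: [set p.1; p.2]) #|S (w |: [set p.1; p.2])|)%N.
    apply: (leq_trans (subset_leq_card sub)); apply: (leq_trans (leq_card_setU _ _)).
    rewrite leq_add2l; elim/big_rec2: _ => [|w m B _ le]; first by rewrite cards0.
    by apply: leq_trans (leq_card_setU _ _) _; rewrite leq_add2l.
  move=> hh; apply: (@leq_trans (8 * K * (#|T| + \sum_(w in N :\: [set p.1; p.2]) #|S (w |: [set p.1; p.2])|))).
    by rewrite leq_mul2l hh orbT.
  rewrite mulnDr leq_add2l big_distrr /=.
  rewrite (eq_bigr (fun=> #|S [set p.1; p.2]|)) => [|w]; last first.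
    by rewrite in_setD => /andP [wp _]; rewrite mulnC S3.
  rewrite sum_nat_const leq_mul2r; apply/orP; right; apply: leq_trans NK.
  by apply: subset_leq_card; apply: subsetDl.
have h2 : (7 * #|S [set p.1; p.2]| <= 8 * #|T|)%N.
  rewrite -(leq_pmul2l K0); move: h1.
  set a := #|S _|; set b := #|T|; rewrite ![(K * (_ * _))%N]mulnCA -!mulnA ; set x := (K * a)%N; set y := (K * b)%N.
  by clia.
rewrite -S2 expnMn -[(8 ^ 2)%N]/64%N; move: h2; set a := #|S _|; set b := #|T|.
move=> h2; apply: (@leq_trans (64 * K ^ 2 * (8 * b))).
  apply: (@leq_trans (64 * K ^ 2 * (7 * a))); last by rewrite leq_mul2l h2 orbT.
  by set q := (K ^ 2)%N; clear; clearbody a q; lia.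
by set q := (K ^ 2)%N; clear; clearbody b q; lia.
Qed.

(** The previous bound is summed over [K] colours and all pairs. An inner colour counts for both
    orders of its pair, which doubles 512. *)
Lemma inner_sum : (7 * #|nonadjp| * #|{: Om}| <= 1024 * K * \sum_(t : Om) #|inner t|)%N.
Proof.
pose X (t : Om) c := (\sum_(p in nonadjp) (cls t c == [set p.1; p.2]))%N.
have h1 (t : Om) : (\sum_c X t c <= 2 * #|inner t|)%N.
  rewrite mulnC -sum_nat_const [X in (_ <= X)%N]big_mkcond /=; apply: leq_sum => c _.
  rewrite /X -big_mkcondr sum1dep_card; case: ifP => ci; last first.
    rewrite leqn0 cards_eq0; apply/eqP/setP => p; rewrite in_set0; apply/negP.
    rewrite inE => hp; move/negP: ci; apply; rewrite inE; apply/existsP; by exists p.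
  have := ci; rewrite inE => /existsP [p0 /andP [_ /eqP e0]].
  apply: (@leq_trans #|[set p0; (p0.2, p0.1)]|); last by rewrite cards2; case: (_ != _).
  apply: subset_leq_card; apply/subsetP => - [x y]; rewrite inE /= => /andP [].
  rewrite inE /= => /and4P [_ _ xy _]; rewrite e0 => /eqP es.
  have hx : x \in [set p0.1; p0.2] by rewrite es !inE eqxx.
  have hy : y \in [set p0.1; p0.2] by rewrite es !inE eqxx orbT.
  case: p0 {e0 es} hx hy => a b /=; rewrite !inE !xpair_eqE => hx hy.
  by move: xy; case/orP: hx => /eqP ->; case/orP: hy => /eqP ->; rewrite !eqxx /= ?orbT.
have K2 : (0 < K)%N by [].
have h2 : (K * #|nonadjp| * (7 * #|{: Om}|) <= 512 * K ^ 2 * \sum_(t : Om) \sum_c X t c)%N.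
  rewrite exchange_big /= -cC -mulnA -sum_nat_const big_distrr /=.
  apply: leq_sum => c _; rewrite cC /X exchange_big /= -sum_nat_const big_distrr /=.
  apply: leq_sum => p pP; apply: (leq_trans (pair_count c pP)); rewrite leq_mul2l; apply/orP; right.
  by rewrite -sum1dep_card big_mkcond /=; apply: leq_sum => t _; case: ifP.
rewrite -(leq_pmul2l K2); apply: (@leq_trans (512 * K ^ 2 * \sum_(t : Om) 2 * #|inner t|)).
  apply: (@leq_trans (512 * K ^ 2 * \sum_(t : Om) \sum_c X t c)).
    by apply: leq_trans h2; rewrite -mulnA [(7 * (_ * _))%N]mulnCA mulnA.
  by rewrite leq_mul2l leq_sum ?orbT.
rewrite -big_distrr /= -[(K ^ 2)%N]/(K * K)%N; set z := (\sum_t _)%N.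
by clear; clearbody z; lia.
Qed.

(** Markov's inequality for [(1 / 2) ^+ #|saved t|]. The 150 works since 7/1024 exceeds 1/150;
    [lam = c1 / 16] is the optimal parameter and gives the exponent [c1 ^+ 2 / 32], half of which
    pays for [2 ^+ b]. *)
Lemma few_saved (kappa : R) (b : nat) :
  0 < kappa -> kappa * K%:R ^+ 2 <= #|nonadjp|%:R ->
  b%:R <= (kappa / 150) ^+ 2 / 64 * K%:R ->
  (#|[set t : Om | (#|saved t| < b)%N]|%:R) <=
    #|{: Om}|%:R * expR (- ((kappa / 150) ^+ 2 / 64 * K%:R)) :> R.
Proof.
move=> k0 hP hb; set c1 := kappa / 150 in hb *.
have c0 : 0 < c1 by rewrite divr_gt0.
have k1 : kappa <= 1.
  have : (#|nonadjp| <= K * K)%N.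
    apply: (@leq_trans #|setX N N|); last by rewrite cardsX leq_mul.
    by apply: subset_leq_card; apply/subsetP => - [x y]; rewrite !inE /= => /and4P [-> ->].
  rewrite -(ler_nat R) natrM -expr2 => h1.
  have h2 := le_trans hP h1.
  by rewrite -(ler_pM2r (_ : 0 < K%:R ^+ 2 :> R)) ?exprn_gt0 // mul1r.
have c1b : c1 <= 1 / 150 by rewrite /c1; move: k1; lra.
have O0 : 0 < #|{: Om}|%:R :> R by rewrite ltr0n card_ffun expn_gt0 A0.
set lam := c1 / 16.
have l0 : 0 <= lam by rewrite divr_ge0 // ltW.
have lE : c1 = 16 * lam by rewrite /lam; field.
have mean : c1 * K%:R <= (\sum_(t : Om) #|inner t|%:R) / #|{: Om}|%:R.
  rewrite ler_pdivlMr // -natr_sum.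
  have := inner_sum; rewrite -(ler_nat R) !natrM; set z := (\sum_t _)%N => h1.
  rewrite -(ler_pM2l (_ : 0 < 1024 * K%:R :> R)) ?mulr_gt0 //; apply: le_trans h1.
  have -> : 1024 * K%:R * (c1 * K%:R * #|{: Om}|%:R) = 1024 / 150 * (kappa * K%:R ^+ 2) * #|{: Om}|%:R.
    by rewrite /c1; field.
  rewrite ler_wpM2r // ?ler0n //.
  have : 0 <= #|nonadjp|%:R :> R by [].
  by move: hP; lra.
have s1 : \sum_(t : Om) expR (- (#|inner t|%:R / 4)) <= #|{: Om}|%:R * expR (- (c1 ^+ 2 / 32 * K%:R)) :> R.
  apply: (@le_trans _ _ (\sum_(t : Om) expR (lam * (- #|inner t|%:R)))).
    apply: ler_sum => t _; rewrite ler_expR mulrN lerN2 mulrC ler_wpM2l //.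
    by rewrite /lam; move: c1b; lra.
  apply: (le_trans (@azuma V A R A0 (fun t => - #|inner t|%:R) (fun u => if u \in N then 2 else 0) lam l0 _ _)).
  - move=> u; case: ifP => _; last by rewrite mulr0 divr_ge0.
    by rewrite /lam; move: c1b; lra.
  - move=> u t a; rewrite -opprD normrN; exact: inner_lip.
  rewrite ler_wpM2l ?ler0n // ler_expR sumrN mulNr mulrN.
  have hs : \sum_u (if u \in N then 2 else 0 : R) ^+ 2 <= 4 * K%:R.
    apply: (@le_trans _ _ (\sum_(u in N) 4)).
      rewrite [X in _ <= X]big_mkcond; apply: ler_sum => u _; case: ifP => _; last by rewrite expr0n.
      by rewrite expr2 -natrM.
    by rewrite sumr_const -[X in X <= _]mulr_natr ler_wpM2l ?ler0n // ler_nat.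
  have h1 := ler_wpM2l l0 mean.
  have l2 : 0 <= 2 * lam ^+ 2 by rewrite mulr_ge0 ?sqr_ge0.
  have h2 := ler_wpM2l l2 hs.
  have -> : c1 ^+ 2 / 32 * K%:R = lam * (c1 * K%:R) - 2 * lam ^+ 2 * (4 * K%:R).
    by rewrite lE; field.
  by move: h1 h2; lra.
have s2 := le_trans sum_saved s1.
set T := [set t : Om | _].
have hh : (0 <= 1 / 2 :> R) by rewrite divr_ge0.
have s3 : #|T|%:R * (1 / 2) ^+ b <= \sum_(t : Om) (1 / 2) ^+ #|saved t| :> R.
  rewrite mulr_natl -sumr_const big_mkcond; apply: ler_sum => t _; case: ifP => tT.
    move: tT; rewrite inE => /ltnW tb; apply: (ler_wiXn2l hh _ tb).
    by rewrite ler_pdivrMr // mul1r ler1n.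
  exact: exprn_ge0.
have s4 : expR (- b%:R) <= (1 / 2) ^+ b :> R.
  rewrite -[X in - X]mulr1 -mulrN expRM_natl; apply: lerXn2r; rewrite ?nnegrE ?expR_ge0 //.
  rewrite expRN mul1r lef_pV2 ?posrE ?expR_gt0 //.
  by have := expR_ge1Dx (1 : R); lra.
have s5 : #|T|%:R * expR (- b%:R) <= #|{: Om}|%:R * expR (- (c1 ^+ 2 / 32 * K%:R)) :> R.
  by apply: le_trans s2; apply: le_trans s3; rewrite ler_wpM2l.
rewrite -(ler_pM2r (expR_gt0 (- b%:R))); apply: (le_trans s5).
rewrite -[X in _ <= X]mulrA ler_wpM2l ?ler0n // -expRD ler_expR.
by move: hb; lra.
Qed.

End Concentration.

(** * Colouring the sparse vertices *)

Section Sparse.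
Variables (R : realType) (V C : finType) (e : rel V) (S : {set V}) (K b : nat) (kappa : R).
Hypotheses (e_sym : symmetric e) (e_irr : irreflexive e).
Hypothesis eS : forall x y, e x y -> x \in S.
Hypotheses (K0 : (0 < K)%N) (cC : #|C| = K) (degK : forall x, (#|nbrs e x| <= K)%N).
Notation A := (C * 'I_8)%type.
Notation Om := {ffun V -> A}.
Implicit Types (t : Om) (c : C) (u v w x y z : V) (M T : {set V * C}).

Let N v := nbrs e v.
Definition rich v := kappa * K%:R ^+ 2 <= #|nonadjp e (N v)|%:R.
Hypothesis slack : forall v, v \in S -> (#|N v| + b <= K)%N \/ rich v.
Hypotheses (k0 : 0 < kappa) (b0 : (0 < b)%N).
Hypothesis bK : b%:R <= (kappa / 150) ^+ 2 / 64 * K%:R.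
Hypothesis pK : expR (- ((kappa / 150) ^+ 2 / 64 * K%:R)) <= 1 / (16 * K%:R ^+ 4).

(** A vertex that is not rich gets an impossible event; its slack in degree takes care of it. *)
Definition poor v : {set Om} :=
  if rich v then [set t : Om | (#|saved e (N v) t| < b)%N] else set0.
Definition ball2 v : {set V} := N v :|: \bigcup_(x in N v) N x.
Definition clash v : {set V} := [set w | ball2 v :&: ball2 w != set0].

Lemma ball2_sym v w : w \in ball2 v -> v \in ball2 w.
Proof.
rewrite !inE => /orP [h|/bigcupP [x]]; first by rewrite e_sym h.
rewrite !inE => vx xw; apply/orP; right; apply/bigcupP; exists x; rewrite inE e_sym //.
Qed.

Lemma card_bigcup_le (I J : finType) (X : {set I}) (F : I -> {set J}) k :
  (forall i, (#|F i| <= k)%N) -> (#|\bigcup_(i in X) F i| <= #|X| * k)%N.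
Proof.
move=> Fk; apply: (@leq_trans (\sum_(i in X) #|F i|)%N).
  elim/big_rec2: _ => [|i m B _ le]; first by rewrite cards0.
  by apply: leq_trans (leq_card_setU _ _) _; rewrite leq_add2l.
by rewrite -sum_nat_const; apply: leq_sum.
Qed.

Lemma ball2_card v : (#|ball2 v| <= 2 * K ^ 2)%N.
Proof.
apply: (leq_trans (leq_card_setU _ _)).
have h := card_bigcup_le (N v) degK; have hv := degK v.
have : (#|N v| * K <= K * K)%N by rewrite leq_mul.
have : (K * 1 <= K * K)%N by rewrite leq_mul.
by rewrite -[(K ^ 2)%N]/(K * K)%N; move: h hv; rewrite -/(N v); clia.
Qed.

Lemma clash_sub X : (#|[set w | X :&: ball2 w != set0]| <= #|X| * (2 * K ^ 2))%N.
Proof.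
apply: leq_trans (card_bigcup_le X ball2_card); apply: subset_leq_card.
apply/subsetP => w; rewrite inE => /set0Pn [z]; rewrite inE => /andP [zX zw].
by apply/bigcupP; exists z => //; apply: ball2_sym.
Qed.

Let d := (4 * K ^ 4)%N.
Let x0 : R := 1 / (8 * K%:R ^+ 4).

Lemma clash_card v : (#|clash v| <= d)%N.
Proof.
apply: (leq_trans (clash_sub _)); have := ball2_card v => h.
apply: (@leq_trans (2 * K ^ 2 * (2 * K ^ 2))); first by rewrite leq_mul2r h orbT.
by rewrite /d (expnM K 2 2) -[((K ^ 2) ^ 2)%N]/((K ^ 2) * (K ^ 2))%N; set q := (K ^ 2)%N; clia.
Qed.

(** A killer is adjacent to the class of its colour, hence within distance two of [v]. *)
Lemma poor_depends v : depends_on (ball2 v) (poor v).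
Proof.
move=> t t' tt; rewrite /poor; case: ifP => _; last by rewrite !in_set0.
rewrite !inE; congr (_ < _)%N; congr #|pred_of_set _|.
have ecls c : cls (N v) t c = cls (N v) t' c.
  apply/setP => w; rewrite !inE; case: (boolP (e v w)) => //= ew.
  by rewrite tt // inE inE ew.
have einn : inner e (N v) t = inner e (N v) t'.
  by apply/setP => c; rewrite !inE; apply: eq_existsb => p; rewrite ecls.
apply/setP => c; rewrite [LHS]inE [RHS]inE einn; congr andb.
congr (_ == _); apply/setP => u; rewrite [LHS]inE [RHS]inE; congr andb; rewrite ecls.
case: existsP => [[z /andP [zc euz]]|_]; rewrite ?andbF // !andbT.
rewrite tt // inE; apply/orP; right; apply/bigcupP; exists z; rewrite inE.
  by move: zc; rewrite !inE => /andP [].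
by rewrite e_sym.
Qed.

Lemma avoid_depends (J : {set V}) (X : {set V}) :
  (forall j, j \in J -> [disjoint ball2 j & X]) -> depends_on (~: X) (avoid poor J).
Proof.
move=> h t t' tt; rewrite !inE; apply: eq_forallb => j; case: (boolP (j \in J)) => //= jJ.
congr negb; apply: (poor_depends (v := j)) => w wj; apply: tt.
by rewrite inE (disjointFr (h j jJ) wj).
Qed.

Let OR : (0 < #|{: Om}|)%N.
Proof. by rewrite card_ffun expn_gt0 card_prod card_ord cC muln_gt0 K0. Qed.
Let KR : 0 < K%:R :> R. Proof. by rewrite ltr0n. Qed.

Lemma indepR (X : {set V}) (E F : {set Om}) (p : R) : depends_on X E -> depends_on (~: X) F ->
  #|E|%:R <= p * #|{: Om}|%:R -> #|E :&: F|%:R <= p * #|F|%:R.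
Proof.
move=> hE hF hp; have := depends_indep hE hF => /(congr1 (fun n => n%:R : R)).
have O0 : 0 < #|{: Om}|%:R :> R by rewrite ltr0n.
rewrite !natrM => h; rewrite -(ler_pM2r O0) h mulrAC ler_wpM2r ?ler0n //.
Qed.

(** With [d = 4 * K ^ 4] bounding [clash], the value [x0 = 1 / (8 * K ^ 4)] makes [x0 * d] equal to
    1/2, and [pK] is the probability bound [x0 / 2]. *)
Lemma x0_hyps : [/\ 0 <= x0, x0 <= 1 / 2, x0 * d%:R <= 1 / 2 &
  forall v (J : {set V}), [disjoint J & clash v] ->
  (#|poor v :&: avoid poor J|%:R : R) <= x0 / 2 * #|avoid poor J|%:R].
Proof.
have K4 : 1 <= K%:R ^+ 4 :> R by rewrite exprn_ege1 // ler1n.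
split.
- by rewrite divr_ge0 // mulr_ge0 // exprn_ge0.
- by rewrite ler_pdivrMr; [move: K4; lra | move: K4; lra].
- rewrite /x0 /d natrM natrX le_eqVlt; apply/orP; left; apply/eqP; field.
  by rewrite gt_eqF.
move=> v J dj; apply: (indepR (poor_depends (v := v))).
  apply: avoid_depends => j jJ; have := disjointFr dj jJ; rewrite inE => /negbT.
  by rewrite negbK setIC setI_eq0.
rewrite /poor; case: ifP => rv; last by rewrite cards0 mulr_ge0 // divr_ge0 // divr_ge0 // mulr_ge0 // exprn_ge0.
apply: (le_trans (few_saved e_sym K0 cC degK (degK v) k0 rv bK)).
rewrite mulrC ler_wpM2r ?ler0n //; apply: (le_trans pK).
by rewrite /x0 le_eqVlt; apply/orP; left; apply/eqP; field; rewrite gt_eqF.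
Qed.

Lemma good_pos : (0 < #|avoid poor setT|)%N.
Proof. have [h1 h2 h3 h4] := x0_hyps; exact: (LLL_gt0 h1 h2 h3 clash_card h4 OR). Qed.

(** In a conflict both ends stay uncoloured, so the result is proper by construction. *)
Definition trial t : {set V * C} := [set p | [&& p.1 \in S, t p.1 == (p.2, ord0)
   & ~~ [exists u, e p.1 u && (t u == (p.2, ord0))]]].

Definition event T : {set Om} := [set t : Om | [forall (p | p \in T), t p.1 == (p.2, ord0)]].

Lemma event_card T : (#|event T| * (8 * K) ^ #|T| <= #|{: Om}|)%N.
Proof.
have [/imset_injP inj|ninj] := boolP (#|dom T| == #|T|); last first.
  rewrite (_ : event T = set0) ?cards0 //; apply/setP => t; rewrite in_set0.
  apply: contraNF ninj; rewrite inE => /forallP h; apply/imset_injP => - [x c] [y c'] p q /= exy.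
  move: q; rewrite -exy => q; have /implyP /(_ p) /eqP /= e1 := h (x, c).
  by have /implyP /(_ q) /eqP /= := h (x, c'); rewrite e1 => - [->].
have [->|[p0 p0T]] := set_0Vmem T.
  by rewrite cards0 expn0 muln1 max_card.
(* On [dom T] the pick succeeds; [p0] only fills the other places. *)
pose s v : A := ((odflt p0 [pick p in T | p.1 == v]).2, ord0).
rewrite -(card_prescribed (dom T) s) card_prod card_ord cC [(K * 8)%N]mulnC.
rewrite (card_in_imset inj) leq_mul2r; apply/orP; right; apply: subset_leq_card.
apply/subsetP => t; rewrite !inE => /forallP h; apply/forallP => v; apply/implyP => /domP [c vc].
have /implyP /(_ vc) /eqP /= -> := h (v, c); rewrite /s.
case: pickP => [p /andP [pT /eqP pv]|/(_ (v, c))]; last by rewrite vc eqxx.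
by rewrite -[X in _ == (X.2, _)](_ : (v, c) = p) //; apply: inj.
Qed.

Lemma event_depends T : depends_on (dom T) (event T).
Proof.
move=> t t' tt; rewrite !inE; apply: eq_forallb => p; case: (boolP (p \in T)) => //= pT.
by rewrite tt // mem_dom.
Qed.

Definition repeats M v := (#|N v| + b <= K)%N \/
  exists Z : {set C}, (b <= #|Z|)%N /\
   (forall c, c \in Z -> exists x y, [/\ x \in N v, y \in N v, x != y, (x, c) \in M & (y, c) \in M]).

(** A prescribed pair has probability [1 / (8 * K)] in an unconditioned trial, and the local lemma
    doubles it: a vertex of [dom T] interacts with at most [2 * K ^ 2] events, which is below
    [d]. *)
Lemma trial_spr : spr (1 / (4 * K%:R) : R)
  (fun M => [/\ pcol e M, dom M \subset S & forall v, v \in S -> repeats M v]).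
Proof.
apply: (@spr_unif _ _ _ (mem (avoid poor setT)) trial); first exact: good_pos.
  move=> t; rewrite /= inE => /forallP ht; split.
  - apply/pcolP => - [x c] [y c']; rewrite !inE /= => /and3P [_ /eqP tx /existsPn nx].
    move=> /and3P [_ /eqP ty _]; split => [exy|exy ec].
      by move: ty; rewrite -exy tx => - [->].
    by have := nx y; rewrite exy ty -ec eqxx.
  - by apply/subsetP => v /domP [c]; rewrite inE => /andP [].
  move=> v /slack [|rv]; first by left.
  right; exists (saved e (N v) t); split.
    by have := ht v; rewrite inE /poor rv inE -leqNgt.
  move=> c; rewrite inE => /andP []; rewrite inE => /existsP [[x y] /andP []].
  rewrite inE /= => /and4P [xN yN xy nxy] /eqP ecls /eqP kil.
  have tr z z' : [set z; z'] = [set x; y] -> ~~ e z z' -> (z, c) \in trial t.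
    move=> zz' nzz'; have zc : z \in cls (N v) t c by rewrite ecls -zz' !inE eqxx.
    have := zc; rewrite inE => /andP [zN /eqP tz].
    rewrite inE /= tz eqxx (@eS z v) /=; last by move: zN; rewrite inE e_sym.
    apply/existsPn => u; apply/negP => /andP [ezu tu].
    have [uN|uN] := boolP (u \in N v).
      have : u \in cls (N v) t c by rewrite inE uN tu.
      rewrite ecls -zz' !inE => /orP [/eqP uz|/eqP uz]; first by rewrite uz e_irr in ezu.
      by rewrite uz (negbTE nzz') in ezu.
    have : u \in killers e (N v) t c.
      rewrite inE inE uN tu /=; apply/existsP; exists z; by rewrite zc e_sym ezu.
    by rewrite kil inE.
  exists x, y; split => //; first exact: (tr x y).
  by apply: (tr y x); rewrite 1?setUC // e_sym.
move=> T; have [h1 h2 h3 h4] := x0_hyps.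
apply: (@le_trans _ _ #|event T :&: avoid poor setT|%:R).
  rewrite ler_nat; apply: subset_leq_card; apply/subsetP => t; rewrite !unfold_in /=.
  move=> /andP [tg /subsetP sT]; apply/setIP; split=> //.
  rewrite inE; apply/forallP => p; apply/implyP => /sT; rewrite inE => /and3P [] //.
pose G' := [set w | dom T :&: ball2 w != set0].
have LR : 0 < 8 * K%:R :> R by rewrite mulr_gt0.
have p0 : 0 <= (8 * K%:R)^-1 ^+ #|T| :> R by rewrite exprn_ge0 // invr_ge0 ltW.
have := LLL_cond h1 h2 h3 clash_card h4 (E := event T) (G' := G') (t := #|T|) p0.
have -> : (8 * K%:R)^-1 ^+ #|T| * 2 ^+ #|T| = (1 / (4 * K%:R)) ^+ #|T| :> R.
  by rewrite -exprMn; congr (_ ^+ _); field; rewrite gt_eqF.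
apply.
  apply: (leq_trans (clash_sub _)); rewrite mulnC; apply: leq_mul; last exact: leq_imset_card.
  have -> : d = (2 * K ^ 2 * (2 * K ^ 2))%N.
    by rewrite /d (expnM K 2 2) -[((K ^ 2) ^ 2)%N]/((K ^ 2) * (K ^ 2))%N; set q := (K ^ 2)%N; clia.
  by rewrite leq_pmulr // muln_gt0 expn_gt0 K0.
apply: (indepR (@event_depends T)).
  apply: avoid_depends => j; rewrite inE inE negbK => /eqP h.
  by rewrite -setI_eq0 setIC h.
rewrite exprVn ler_pdivlMl ?exprn_gt0 // -natrM -natrX -natrM ler_nat mulnC.
exact: event_card.
Qed.

(** A repeated colour occupies at least two neighbours, so [b] repetitions save [b] colours however
    the colouring is extended. *)
Lemma usedc_repeats M M' v : v \in S -> repeats M v -> M \subset M' -> pcol e M' ->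
  (#|usedc e M' v| + b <= K)%N.
Proof.
move=> vS [h|[Z [bZ hZ]]] /subsetP sM pM.
  apply: leq_trans h; rewrite leq_add2r; apply: leq_trans (usedc_card v pM) _.
  by rewrite subset_leq_card // subsetIl.
have /pcolP hM := pM.
pose B := [set q in M' | e v q.1].
have cB : (#|B| <= K)%N.
  apply: leq_trans (degK v); rewrite -(card_in_imset (f := fst)).
    by apply: subset_leq_card; apply/subsetP => z /imsetP [q]; rewrite !inE => /andP [_ h] ->.
  by move=> p q; rewrite !inE => /andP [p1 _] /andP [q1 _]; apply: (proj1 (hM _ _ p1 q1)).
apply: (leq_trans _ cB); apply: (@leq_trans (#|usedc e M' v| + #|Z|)); first by rewrite leq_add2l.
rewrite card_fibersV -!sum1_card big_mkcond [X in (_ + X <= _)%N]big_mkcond -big_split /=.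
apply: leq_sum => c _.
case: ifP => cu; case: ifP => cZ; rewrite ?addn0 ?add0n //.
- have [x [y [xN yN xy xM yM]]] := hZ c cZ.
  apply: (@leq_trans #|[set x; y]|); first by rewrite cards2 xy.
  apply: subset_leq_card; apply/subsetP => z; rewrite !inE.
  by case/orP => /eqP ->; rewrite sM //=; [move: xN|move: yN]; rewrite inE.
- have /usedcP [u eu uM] := cu; rewrite card_gt0; apply/set0Pn; exists u.
  by rewrite !inE uM eu.
- have [x [y [xN yN xy xM yM]]] := hZ c cZ.
  have : c \in usedc e M' v by apply/usedcP; exists x; [move: xN; rewrite inE|exact: sM].
  by rewrite cu.
Qed.

Lemma sparse_spr : spr (1 / (4 * K%:R) + 1 / b%:R : R) (fun M => pcol e M /\ dom M = S).
Proof.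
apply: (@spr_sub _ _ (1 / (4 * K%:R) + 1 / b%:R) _ (unionP
  (fun M => [/\ pcol e M, dom M \subset S & forall v, v \in S -> repeats M v])
  (fun M1 M2 => (pcol e (M1 :|: M2) && (dom M2 \subset S :\: dom M1)) /\ dom M2 = S :\: dom M1))).
- by rewrite addr_ge0 // divr_ge0 // mulr_ge0.
- by [].
- move=> _ [M1 [M2 [[_ dS _] [/andP [pM _] dM] ->]]]; split => //.
  by rewrite domU dM; apply/setP => v; rewrite !inE; case: (boolP (v \in dom M1)) => //= /(subsetP dS).
apply: spr_bind; [by rewrite divr_ge0 | exact: trial_spr |] => M1 [p1 d1 r1].
apply: (spr_seq R (B := b) (Inv := fun M2 => pcol e (M1 :|: M2) && (dom M2 \subset S :\: dom M1))) => //.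
  by rewrite setU0 p1 dom0 sub0set.
move=> M v /andP [pM dM] vS vM _.
have := usedc_repeats (subsetP (subsetDl _ _) _ vS) (r1 v (subsetP (subsetDl _ _) _ vS)) (subsetUl M1 M) pM.
set U := usedc _ _ _ => hU; apply: (@leq_trans #|~: U|).
  by have := cardsC U; rewrite cC; clia.
apply: subset_leq_card; apply/subsetP => c; rewrite !inE => cU.
have nM : v \notin dom (M1 :|: M).
  by rewrite domU inE negb_or vM andbT; move: vS; rewrite inE => /andP [].
by rewrite setUCA pcolU1 // domU1 subUset sub1set vS dM.
Qed.
End Sparse.

Local Close Scope ring_scope.

(** * Dense vertices and clusters *)

(** Locked, so that the numeral is not unfolded in unary. Clusters tolerate 1/20000, that is, five
    parts in 100000: three are lost in [cluster_deg], the others cover the passage from [D] to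
    [D + 1]. *)
Definition eta_inv : nat := locked (100 * 1000)%N.
Lemma eta_invE : eta_inv = (100 * 1000)%N. Proof. by rewrite /eta_inv -lock. Qed.

Ltac hlia :=
  repeat match goal with
  | X : is_true (leq _ _) |- _ => revert X
  | X : @eq nat _ _ |- _ => revert X
  end; rewrite ?eta_invE; clia.

Section Decomposition.
Notation H := eta_inv.
Variables (V : finType) (e : rel V) (D : nat).
Hypotheses (e_sym : symmetric e) (e_irr : irreflexive e).
Hypotheses (D0 : (0 < D)%N) (degD : forall v, (#|nbrs e v| <= D)%N).
Implicit Types (u v w x y : V).

Let N v := nbrs e v.
Definition codeg u v := #|N u :&: N v|.
Definition friend u v := (H * D <= H * codeg u v + D)%N.
Definition friends v := [set u in N v | friend u v].
Definition dense v := (H * D <= H * #|friends v| + D)%N.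
(** Twice the tolerance of [friend], since membership is obtained through a common friend. *)
Definition cluster v := [set u | (H * D <= H * codeg u v + 2 * D)%N].

Lemma codegC u v : codeg u v = codeg v u.
Proof. by rewrite /codeg setIC. Qed.

(** Two subsets of [N u], which has size at most [D]. Equivalently, [D - codeg] obeys the triangle
    inequality. *)
Lemma codeg_tri u v w : (codeg u v + codeg u w <= D + codeg v w)%N.
Proof.
have := degD u; have h : (#|(N u :&: N v) :|: (N u :&: N w)| <= #|N u|)%N.
  by apply: subset_leq_card; rewrite subUset !subsetIl.
have h2 : (#|(N u :&: N v) :&: (N u :&: N w)| <= codeg v w)%N.
  apply: subset_leq_card; apply/subsetP => z; rewrite !inE.
  by move=> /andP [/andP [_ ->] /andP [_ ->]].
have := cardsUI (N u :&: N v) (N u :&: N w); move: h h2; rewrite /codeg /N.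
by hlia.
Qed.

Lemma friends_sub v : friends v \subset N v.
Proof. by apply/subsetP => u; rewrite inE => /andP []. Qed.

Lemma notfriends_card v : dense v -> (H * #|N v :\: friends v| <= D)%N.
Proof.
rewrite /dense; have := cardsID (friends v) (N v); rewrite (setIidPr (friends_sub v)).
by have := degD v; rewrite -/(N v); hlia.
Qed.

(** Dense vertices have few neighbours that are not friends, so sharing [D / 2] neighbours forces a
    common friend; [codeg_tri] through that friend gives almost full codegree. *)
Lemma dense_dichotomy v w : dense v -> dense w -> (D <= 2 * codeg v w)%N ->
  v \in cluster w.
Proof.
move=> dv dw vw; have hv := notfriends_card dv; have hw := notfriends_card dw.
have [E|[u]] := set_0Vmem (friends v :&: friends w).
  have : (#|N v :&: N w| <= #|N v :\: friends v| + #|N w :\: friends w|)%N.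
    apply: leq_trans (leq_card_setU _ _); apply: subset_leq_card; apply/subsetP => u.
    rewrite in_setI in_setU !in_setD => /andP [-> ->]; rewrite !andbT -negb_and -in_setI E.
    by rewrite inE.
  by move: hv hw vw D0; rewrite /codeg; hlia.
rewrite inE => /andP []; rewrite !inE => /andP [_ f1] /andP [_ f2].
by have := codeg_tri u v w; move: f1 f2; rewrite /friend; hlia.
Qed.

(** A common member would have codegree nearly [D] with both centres, and then so would the centres
    with each other. *)
Lemma cluster_disj v w : (2 * codeg v w < D)%N -> [disjoint cluster v & cluster w].
Proof.
move=> vw; rewrite -setI_eq0; apply/eqP/setP => u; rewrite in_set0 in_setI; apply/negP.
by rewrite !inE => /andP []; have := codeg_tri u v w; move: vw D0; hlia.
Qed.

(** Double counting of edges into [N v]: each of its at most [D] vertices has degree at most [D],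
    and each cluster member meets nearly [D] of them. *)
Lemma cluster_card v : (H * #|cluster v| <= H * D + 2 * #|cluster v|)%N.
Proof.
have h : (\sum_(u in cluster v) codeg u v <= D * D)%N.
  pose W : {set V * V} := [set p | [&& p.1 \in cluster v, p.2 \in N v & e p.1 p.2]].
  have -> : (\sum_(u in cluster v) codeg u v = #|W|)%N.
    rewrite card_fibers [LHS]big_mkcond /=; apply: eq_bigr => u _.
    case: ifP => uQ; last first.
      apply/esym/eqP; rewrite cards_eq0; apply/eqP/setP => y.
      by rewrite in_set0 inE [_ \in W]inE /= uQ.
    apply: eq_card => y; rewrite [in RHS]inE [in RHS]inE /= uQ /=.
    by rewrite in_setI !inE andbC.
  rewrite card_fibersV; apply: (@leq_trans (\sum_(y in N v) D)); last first.
    by rewrite sum_nat_const leq_mul2r degD orbT.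
  rewrite [X in (_ <= X)%N]big_mkcond /=; apply: leq_sum => y _; case: ifP => yN; last first.
    rewrite leqn0 cards_eq0; apply/eqP/setP => u.
    by rewrite in_set0 inE [_ \in W]inE /= yN andbF.
  apply: leq_trans (degD y); apply: subset_leq_card; apply/subsetP => u.
  by rewrite inE [_ \in W]inE /= => /and3P [_ _ uy]; rewrite inE e_sym.
have h2 : (#|cluster v| * (H * D) <= \sum_(u in cluster v) (H * codeg u v + 2 * D))%N.
  by rewrite -sum_nat_const; apply: leq_sum => u; rewrite inE.
rewrite big_split /= sum_nat_const -big_distrr /= in h2.
rewrite -(leq_pmul2r D0); move: h h2; set s := (\sum_(u in _) _)%N; set q := #|cluster v|.
have -> : (H * q * D = q * (H * D))%N by rewrite mulnAC mulnC.
have -> : ((H * D + 2 * q) * D = H * (D * D) + q * (2 * D))%N by rewrite mulnDl; congr addn; [rewrite mulnA | rewrite mulnAC mulnC].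
move=> h h2; apply: (leq_trans h2); by rewrite leq_add2r leq_mul2l h orbT.
Qed.

Lemma friends_cluster v : friends v \subset cluster v.
Proof. by apply/subsetP => u; rewrite !inE /friend => /andP [_]; hlia. Qed.

(** Two parts are lost by membership, a third by the neighbours of [v] that are not its friends. *)
Lemma cluster_deg v u : dense v -> u \in cluster v ->
  (H * D <= H * #|N u :&: cluster v| + 3 * D)%N.
Proof.
move=> dv; rewrite inE; have := notfriends_card dv.
have : (#|N v :\: cluster v| <= #|N v :\: friends v|)%N.
  by apply: subset_leq_card; apply: setDS; apply: friends_cluster.
have : (codeg u v <= #|N u :&: cluster v| + #|N v :\: cluster v|)%N.
  apply: leq_trans (leq_card_setU _ _); apply: subset_leq_card; apply/subsetP => z.
  rewrite in_setI in_setU in_setI in_setD => /andP [-> ->] /=.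
  by case: (z \in cluster v).
by hlia.
Qed.

Lemma cluster_neq0 v : dense v -> (0 < #|cluster v|)%N.
Proof.
move=> dv; have := subset_leq_card (friends_cluster v); move: dv; rewrite /dense.
by move: D0; hlia.
Qed.

Definition spaced (A : {set V}) := [forall v in A, dense v] &&
  [forall v in A, forall w in A, (v != w) ==> (2 * codeg v w < D)%N].

(** The centres are a maximal set of dense vertices with pairwise codegree below [D / 2]. A dense
    vertex that cannot be added has large codegree with some centre, hence lies in its cluster. *)
Lemma exists_centers : exists A : {set V},
  [/\ forall v, v \in A -> dense v,
      {in A &, forall v w, v != w -> [disjoint cluster v & cluster w]} &
      forall v, dense v -> exists2 w, w \in A & v \in cluster w].
Proof.
have sp0 : spaced set0.
  by apply/andP; split; apply/forallP => v; rewrite inE.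
have [A /maxsetP [/andP [/forall_inP dA sA] mA] _] := maxset_exists sp0.
have sA' v w : v \in A -> w \in A -> v != w -> (2 * codeg v w < D)%N.
  by move=> vA wA; move/forall_inP/(_ v vA)/forall_inP/(_ w wA)/implyP: sA.
exists A; split => //.
  by move=> v w vA wA vw; apply: cluster_disj; apply: sA'.
move=> v dv; have [vA|vA] := boolP (v \in A).
  exists v => //; rewrite inE /codeg setIid; have := subset_leq_card (friends_sub v).
  by move: dv; rewrite /dense; hlia.
have [/existsP [w /andP [wA vw]]|/existsPn h] := boolP [exists w in A, (D <= 2 * codeg v w)%N].
  by exists w => //; apply: dense_dichotomy => //; apply: dA.
have h' w : w \in A -> (2 * codeg v w < D)%N.
  by move=> wA; have := h w; rewrite wA /= -ltnNge.
have : v |: A = A.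
  apply: mA; last exact: subsetUr.
  apply/andP; split; first by apply/forall_inP => w; rewrite inE => /orP [/set1P ->|/dA].
  apply/forall_inP => x; rewrite !inE => xA; apply/forall_inP => y; rewrite !inE => yA.
  apply/implyP; case/orP: xA => [/eqP ->|xA]; case/orP: yA => [/eqP ->|yA].
  - by rewrite eqxx.
  - by move=> _; apply: h'.
  - by move=> _; rewrite codegC; apply: h'.
  - exact: sA'.
by move/setP/(_ v); rewrite !inE eqxx (negbTE vA).
Qed.

(** At least [D / (2 * H)] neighbours in [S] are not friends of [v], and each of them misses at
    least [D / (4 * H)] of the neighbourhood; the product explains the 8. The bound [4 * H <= D]
    absorbs the vertex itself. *)
Lemma sparse_nonadj (S : {set V}) v : v \in S -> ~~ dense v -> (4 * H <= D)%N ->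
  (2 * H * D < 2 * H * #|N v :&: S| + D)%N ->
  (D * D <= 8 * (H * H) * #|[set p in setX (N v :&: S) (N v :&: S) | (p.1 != p.2) && ~~ e p.1 p.2]|)%N.
Proof.
move=> vS; rewrite /dense -ltnNge => nd D4 hN.
set NS := N v :&: S in hN *; set P := [set p in _ | _].
pose U := NS :\: friends v.
have hU : (D <= 2 * H * #|U|)%N.
  have : (#|NS| <= #|U| + #|friends v|)%N.
    rewrite -(cardsID (friends v) NS) addnC leq_add2l; apply: subset_leq_card.
    exact: subsetIr.
  by move: hN nd; hlia.
have hu u : u \in U -> (D <= 4 * H * #|[set y | (u, y) \in P]|)%N.
  rewrite in_setD => /andP [uf uN].
  have nf : (H * codeg u v + D < H * D)%N.
    move: uf; rewrite inE; have -> : u \in N v by move: uN; rewrite inE => /andP [].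
    by rewrite /= /friend -ltnNge.
  have : (#|NS| <= #|[set y | (u, y) \in P]| + (#|N u :&: N v| + 1))%N.
    rewrite -(cards1 u); apply: (@leq_trans #|[set y | (u, y) \in P] :|: ((N u :&: N v) :|: [set u])|).
      apply: subset_leq_card; apply/subsetP => y yN.
      rewrite in_setU inE [_ \in P]inE in_setX /= uN yN /= !inE eq_sym.
      have -> : e v y by move: yN; rewrite !inE => /andP [].
      by case: (y == u); rewrite ?orbT //=; case: (e u y).
    by apply: (leq_trans (leq_card_setU _ _)); rewrite leq_add2l leq_card_setU.
  by move: nf hN D4; rewrite /codeg; hlia.
have : (#|U| * D <= 4 * H * #|P|)%N.
  rewrite -sum_nat_const card_fibers big_distrr /= [X in (X <= _)%N]big_mkcond.
  by apply: leq_sum => u _; case: ifP => // /hu.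
move: hU; set a := #|U|; set z := #|P| => hU h.
apply: (@leq_trans (2 * H * a * D)); first by rewrite leq_mul2r hU orbT.
rewrite -mulnA; apply: (@leq_trans (2 * H * (4 * H * z))); first by rewrite leq_mul2l h orbT.
by clear; clearbody z; lia.
Qed.

End Decomposition.

Local Open Scope ring_scope.

(** * A spread colouring *)

(** From [expR y >= (y / 5) ^+ 5]: the fifth power leaves one spare factor [K] to beat the
    constants. *)
Lemma expRN_le_pow4 (R : realType) (c : R) (K : nat) : 0 < c ->
  16 * 5 ^+ 5 / c ^+ 5 <= K%:R -> expR (- (c * K%:R)) <= 1 / (16 * K%:R ^+ 4).
Proof.
move=> c0 hK; have c5 : 0 < c ^+ 5 by rewrite exprn_gt0.
have K0 : 0 < K%:R :> R by apply: lt_le_trans hK; rewrite divr_gt0 // mulr_gt0 // exprn_gt0.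
rewrite expRN mul1r lef_pV2 ?posrE ?expR_gt0 ?mulr_gt0 ?exprn_gt0 //.
apply: (@le_trans _ _ ((c * K%:R / 5) ^+ 5)).
  move: hK; rewrite ler_pdivrMr // => hK.
  have -> : (c * K%:R / 5) ^+ 5 = (K%:R * c ^+ 5) * K%:R ^+ 4 / 5 ^+ 5 by field.
  rewrite ler_pdivlMr ?exprn_gt0 // mulrAC.
  by apply: ler_wpM2r => //; apply: exprn_ge0.
have -> : expR (c * K%:R) = expR (c * K%:R / 5) ^+ 5.
  rewrite -expRM_natl; congr expR; by field.
apply: lerXn2r; rewrite ?nnegrE ?expR_ge0 ?divr_ge0 ?mulr_ge0 ?(ltW c0) ?ler0n //.
by apply: le_trans (expR_ge1Dx _); rewrite lerDr.
Qed.

Lemma trunc_exists (R : realType) (x : R) : 0 <= x ->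
  exists b : nat, b%:R <= x /\ x < b.+1%:R.
Proof.
move=> x0; exists (Num.truncn x); split; first by rewrite truncn_le.
by rewrite truncnS_gt.
Qed.

Section Assembly.
Variables (R : realType).
(** 32 is 8 from [sparse_nonadj] times 4 from [D + 1 <= 2 * D], squared. *)
Let kappa : R := 1 / (32 * eta_inv%:R ^+ 2).
Let c : R := (kappa / 150) ^+ 2 / 64.
Let H1 : 1 <= eta_inv%:R :> R.
Proof. by rewrite ler1n eta_invE. Qed.

Let kappa0 : 0 < kappa.
Proof. by rewrite divr_gt0 // mulr_gt0 // exprn_gt0 // (lt_le_trans _ H1). Qed.
Let c0 : 0 < c.
Proof. by rewrite divr_gt0 // exprn_gt0 // divr_gt0. Qed.

(** Ensures [b <= K / (2 * eta_inv)], so that a vertex missing that share of its degree has slack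
    [b]. *)
Let cH : c * (2 * eta_inv%:R) <= 1.
Proof.
have h0 : 0 < eta_inv%:R :> R by apply: lt_le_trans H1.
have k1 : kappa * (2 * eta_inv%:R) <= 1.
  rewrite /kappa mulrAC mul1r ler_pdivrMr ?mulr_gt0 ?exprn_gt0 // mul1r.
  have : eta_inv%:R * 1 <= eta_inv%:R * eta_inv%:R :> R by rewrite ler_wpM2l // ltW.
  by rewrite expr2; move: H1; lra.
have k2 : kappa <= 1.
  have := ler_wpM2l (ltW kappa0) H1; move: k1 kappa0; lra.
have ck : c <= kappa.
  have := ler_wpM2l (ltW kappa0) k2; rewrite /c; move: kappa0.
  rewrite (_ : (kappa / 150) ^+ 2 / 64 = kappa * kappa / (150 ^+ 2 * 64)); last by field.
  rewrite -natrX -natrM => hk; rewrite ler_pdivrMr ?ltr0n // mulr1 => h.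
  apply: (le_trans h); rewrite -[X in X <= _]mulr1 ler_wpM2l ?(ltW hk) //.
  by rewrite ler1n.
apply: le_trans k1; rewrite ler_wpM2r // mulr_ge0 // ltW //.
Qed.

(** The numerator is a sum merely to dominate both kinds of stage. The cluster step extends a given
    colouring while the sparse step starts from nothing, so the sparse vertices come first, in the
    induced graph [eS]. *)
Lemma cover_spr (V : finType) (e : rel V) (D : nat) :
  symmetric e -> irreflexive e -> (forall v, (#|nbrs e v| <= D)%N) ->
  (4 * eta_inv <= D)%N -> 2 <= c * D.+1%:R -> 16 * 5 ^+ 5 / c ^+ 5 <= D.+1%:R ->
  spr ((4000 + (1 / 4 + 2 / c)) / D.+1%:R : R)
    (fun M : {set V * 'I_D.+1} => pcol e M /\ dom M = setT).
Proof.
move=> e_sym e_irr degD hD hc hexp.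
have D0 : (0 < D)%N by move: hD; rewrite eta_invE; lia.
have K0R : 0 < D.+1%:R :> R by rewrite ltr0n.
set a := _ / D.+1%:R.
have c2 : 0 < 2 / c by rewrite divr_gt0.
have s0 : 0 <= 1 / 4 + 2 / c by apply: addr_ge0; [exact: divr_ge0 | exact: ltW].
have t0 : 0 <= 4000 :> R by exact: ler0n.
have a0 : 0 <= a by apply: divr_ge0; [exact: addr_ge0 | exact: ltW].
have [A [dA disjA covA]] := exists_centers D0 degD.
pose S := ~: \bigcup_(v in A) cluster e D v.
pose eS x y := [&& e x y, x \in S & y \in S].
(* [b] is the integer part of [c * K], positive by [hc]. *)
have [b [b1 b2]] := trunc_exists (ltW (mulr_gt0 c0 K0R)).
have b0 : (0 < b)%N.
  rewrite -ltnS -(ltr_nat R); apply: le_lt_trans b2.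
  by apply: le_trans hc; rewrite ler_nat.
have hS : spr a (fun M : {set V * 'I_D.+1} => pcol e M /\ dom M = S).
  have eSsym : symmetric eS by move=> x y; rewrite /eS e_sym [(x \in S) && _]andbC.
  have eSirr : irreflexive eS by move=> x; rewrite /eS e_irr.
  have eSS x y : eS x y -> x \in S by case/and3P.
  have nS v : v \in S -> nbrs eS v = nbrs e v :&: S.
    by move=> vS; apply/setP => y; rewrite !in_setI inE [in RHS]inE /eS vS.
  have degS v : (#|nbrs eS v| <= D.+1)%N.
    apply: leqW; apply: leq_trans (degD v); apply: subset_leq_card; apply/subsetP => y.
    by rewrite !inE => /and3P [].
  have bH : (2 * eta_inv * b <= D.+1)%N.
    rewrite -(ler_nat R) !natrM mulrC.
    apply: (@le_trans _ _ (c * D.+1%:R * (2 * eta_inv%:R))).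
      by rewrite ler_wpM2r // mulr_ge0.
    by rewrite mulrAC -[leRHS]mul1r ler_wpM2r ?ler0n.
  have slack v : v \in S -> (#|nbrs eS v| + b <= D.+1)%N \/ rich eS D.+1 kappa v.
    move=> vS; rewrite nS //.
    have nd : ~~ dense e D v.
      apply/negP => /covA [w wA vw]; move: vS; rewrite inE => /negP; apply.
      by apply/bigcupP; exists w.
    have [h|h] := leqP (2 * eta_inv * #|nbrs e v :&: S| + D)%N (2 * eta_inv * D)%N.
      left; rewrite -(leq_pmul2l (_ : 0 < 2 * eta_inv)%N); last by rewrite eta_invE.
      have H0 : (0 < eta_inv)%N by rewrite eta_invE.
      by move: h bH hD H0; rewrite mulnDr mulnS; clia.
    right; rewrite /rich nS //.
    have h2 := sparse_nonadj D0 vS nd hD h.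
    have e2 : nonadjp eS (nbrs e v :&: S) =
        [set p in setX (nbrs e v :&: S) (nbrs e v :&: S) | (p.1 != p.2) && ~~ e p.1 p.2].
      apply/setP => - [x y]; rewrite [LHS]inE [RHS]inE in_setX /= -andbA.
      have [xS|] := boolP (x \in nbrs e v :&: S); rewrite //=.
      have [yS|] := boolP (y \in nbrs e v :&: S); rewrite //=.
      move: xS yS; rewrite /eS !in_setI => /andP [_ ->] /andP [_ ->].
      by rewrite !andbT.
    rewrite e2; move: h2; set z := #|_|; rewrite -(ler_nat R) !natrM => h2.
    have hDR : D.+1%:R <= 2 * D%:R :> R.
      by rewrite -natrM ler_nat; move: D0; clear; lia.
    have hh : 0 < eta_inv%:R :> R by apply: lt_le_trans H1.
    rewrite /kappa mulrAC mul1r ler_pdivrMr ?mulr_gt0 ?exprn_gt0 //.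
    apply: (@le_trans _ _ (4 * (D%:R * D%:R))).
      have -> : 4 * (D%:R * D%:R) = (2 * D%:R) ^+ 2 :> R by rewrite exprMn expr2; ring.
      by apply: lerXn2r; rewrite ?nnegrE ?mulr_ge0 ?ler0n.
    have := ler_wpM2l (ler0n R 4) h2; rewrite expr2.
    have -> : 4 * (8 * (eta_inv%:R * eta_inv%:R) * z%:R) = z%:R * (32 * (eta_inv%:R * eta_inv%:R)) :> R by ring.
    by [].
  apply: (@spr_sub _ _ (1 / (4 * D.+1%:R) + 1 / b%:R) _
    (fun M : {set V * 'I_D.+1} => pcol eS M /\ dom M = S)).
  - by apply: addr_ge0; apply: divr_ge0; rewrite ?mulr_ge0 ?ler0n.
  - have hb : c * D.+1%:R <= 2 * b%:R.
      have : b.+1%:R <= 2 * b%:R :> R by rewrite -natrM ler_nat; move: b0; clear; lia.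
      by apply: le_trans; apply: ltW.
    have b0R : 0 < b%:R :> R by rewrite ltr0n.
    have h1 : 1 / b%:R <= (2 / c) / D.+1%:R.
      rewrite ler_pdivrMr // mulrAC ler_pdivlMr // mul1r mulrAC ler_pdivlMr //.
      by rewrite mulrC.
    apply: (@le_trans _ _ ((1 / 4 + 2 / c) / D.+1%:R)).
      rewrite [X in _ <= X]mulrDl; apply: lerD => //.
      rewrite le_eqVlt; apply/orP; left; apply/eqP.
      by move: K0R; set k := D.+1%:R => k0; clearbody k; field; rewrite gt_eqF.
    rewrite /a; apply: ler_wpM2r; first by rewrite invr_ge0 ltW.
    by rewrite lerDr.
  - move=> M [/pcolP p1 p2]; split => //; apply/pcolP => p q pM qM.
    have [h1 h2] := p1 p q pM qM; split => // epq; apply: h2.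
    by rewrite /eS epq -!p2 !mem_dom.
  by apply: (@sparse_spr R V 'I_D.+1 eS S D.+1 b kappa) => //;
    [rewrite card_ord | exact: expRN_le_pow4].
have hcl s : uniq s -> {subset s <= A} ->
  spr a (fun M : {set V * 'I_D.+1} => pcol e M /\ dom M = S :|: \bigcup_(v <- s) cluster e D v).
  elim: s => [|v s IH] /=.
    by move=> _ _; apply: (spr_sub a0 (lexx a) _ hS) => M; rewrite big_nil setU0.
  move=> /andP [vs us] sA.
  have sA' : {subset s <= A} by move=> w ws; apply: sA; rewrite inE ws orbT.
  have vA : v \in A by apply: sA; rewrite mem_head.
  pose Q := cluster e D v.
  have dQ : [disjoint S :|: \bigcup_(w <- s) cluster e D w & Q].
    rewrite -setI_eq0; apply/eqP/setP => y; rewrite in_set0; apply/negP.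
    rewrite in_setI in_setU => /andP [/orP [yS|yB] yQ].
      by move: yS; rewrite inE => /negP; apply; apply/bigcupP; exists v.
    move: yB; rewrite bigcup_seq => /bigcupP [w ws yw].
    have wv : w != v by apply: contraNneq vs => <-.
    by have := disjointFr (disjA w v (sA' w ws) vA wv) yw; rewrite yQ.
  apply: (@spr_sub _ _ a _ (unionP (fun M : {set V * 'I_D.+1} => pcol e M /\
     dom M = S :|: \bigcup_(w <- s) cluster e D w) (fun M1 M2 => pcol e (M1 :|: M2) /\ dom M2 = Q))) => //.
    move=> _ [M1 [M2 [[_ d1] [p2 d2] ->]]]; split => //.
    by rewrite domU d1 d2 big_cons -setUA [X in _ :|: X]setUC.
  apply: (@spr_bind_sep _ _ a (setX (S :|: \bigcup_(w <- s) cluster e D w) setT)) => //.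
  - exact: IH.
  - move=> M1 [p1 d1].
    apply: (@spr_sub _ _ (4000 / D.+1%:R) _ (fun M2 => pcol e (M1 :|: M2) /\ dom M2 = Q)) => //.
    + by apply: divr_ge0.
    + rewrite /a; apply: ler_wpM2r; first by rewrite invr_ge0 ltW.
      by rewrite lerDl.
    apply: cluster_spr => //.
    + by rewrite d1.
    + by rewrite card_ord.
    + by have := cluster_card e_sym D0 degD v; rewrite -/Q eta_invE; move: D0; clia.
    + move=> u uQ; have := cluster_deg D0 degD (dA v vA) uQ; rewrite -/Q; move: hD; rewrite eta_invE.
      by clia.
    + by move: hD; rewrite eta_invE; clia.
    + exact: (cluster_neq0 D0 (dA v vA)).
  - move=> M1 [_ d1]; apply/subsetP => - [y k] pM; rewrite in_setX in_setT andbT -d1.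
    exact: (mem_dom pM).
  - move=> M1 M2 _ [_ d2]; rewrite -setI_eq0; apply/eqP/setP => - [y k]; rewrite in_set0.
    apply/negP; rewrite in_setI in_setX in_setT andbT => /andP [/mem_dom].
    by rewrite d2 => h1 h2; rewrite (disjointFr dQ h2) in h1.
apply: (spr_sub a0 (lexx a) _ (hcl (enum A) (enum_uniq _) _)).
  move=> M [p1 ->]; split => //; apply/setP => y; rewrite in_setT in_setU /S inE big_enum /=.
  by case: (y \in _).
by move=> w; rewrite mem_enum.
Qed.

Lemma greedy_spr (V : finType) (e : rel V) (D : nat) :
  symmetric e -> irreflexive e -> (forall v, (#|nbrs e v| <= D)%N) ->
  spr (1 : R) (fun M : {set V * 'I_D.+1} => pcol e M /\ dom M = setT).
Proof.
move=> e_sym e_irr degD; rewrite -[1](divr1 1).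
apply: (@spr_seq R V 'I_D.+1 setT 1 (fun M => pcol e M)) => //; first exact: pcol0.
move=> M v pM _ vM _; have := usedc_card v pM; set U := usedc _ _ _ => hU.
have hN : (#|nbrs e v :&: dom M| <= D)%N.
  by apply: leq_trans (degD v); apply: subset_leq_card; apply: subsetIl.
apply: (@leq_trans #|~: U|).
  by have := cardsC U; rewrite card_ord; clia.
apply: subset_leq_card; apply/subsetP => k; rewrite in_setC inE => kU.
exact: pcolU1.
Qed.

Lemma spr_col_spread (V : finType) (e : rel V) (K : nat) (a : R) :
  spr a (fun M : {set V * 'I_K} => pcol e M /\ dom M = setT) ->
  exists mu : {ffun {ffun V -> 'I_K} -> R},
    [/\ is_distr mu, forall s, mu s != 0 -> proper_col e s & col_spread mu a].
Proof.
move=> [nu [n0 n1 nP nS]].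
have cg_inj : injective (@col_graph V K).
  move=> s s' /setP h; apply/ffunP => v; have := h (v, s v).
  rewrite imset_f // => /esym /imsetP [w _ [-> ->]] //.
have cg_surj M : nu M != 0 -> exists s, M = @col_graph V K s.
  move=> /nP [/pcolP pM dM].
  have hM v : exists k, (v, k) \in M by apply/domP; rewrite dM inE.
  have /choice [f hf] := hM.
  exists [ffun v => f v]; apply/setP => - [v k]; apply/idP/imsetP => [vk|[w _ [-> ->]]].
    exists v => //; rewrite ffunE; have [h _] := pM _ _ vk (hf v).
    by case: (h erefl) => ->.
  by rewrite ffunE.
have sumE (p : pred {set V * 'I_K}) :
    \sum_(M | p M) nu M = \sum_(s | p (@col_graph V K s)) nu (col_graph s).
  rewrite big_mkcond [RHS]big_mkcond /=.
  rewrite (bigID (mem ((@col_graph V K) @: setT))) /= addrC big1 ?add0r; last first.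
    move=> M nM; case: ifP => // _; apply/eqP/negPn/negP => /cg_surj [s eM].
    by move/negP: nM; apply; rewrite eM imset_f.
  rewrite big_imset /=; last by move=> s s' _ _ /cg_inj.
  by apply: eq_bigl => s; rewrite in_setT.
exists [ffun s => nu (col_graph s)]; split.
- split=> [s|]; first by rewrite ffunE.
  rewrite -n1 sumE; apply: eq_bigr => s _; by rewrite ffunE.
- move=> s; rewrite ffunE => /nP [/pcolP pM _].
  apply/forallP => u; apply/forallP => v; apply/implyP => euv; apply/eqP.
  have [_ h] := pM (u, s u) (v, s v) (imset_f _ isT) (imset_f _ isT).
  exact: h.
- move=> S; apply: le_trans (nS S); rewrite sumE le_eqVlt; apply/orP; left; apply/eqP.
  by apply: eq_bigr => s _; rewrite ffunE.
Qed.

Lemma maxdeg_nbrs (V : finType) (e : rel V) v : (#|nbrs e v| <= maxdeg e)%N.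
Proof. exact: (@leq_bigmax V (fun v => #|[set u | e v u]|)). Qed.

(** Degrees below the threshold [D0] are absorbed by the summand [D0 + 2] of the constant: there
    [C / D >= 1], and the greedy colouring will do. *)
Theorem spread_coloring : exists C : R, 1 < C /\
  forall (V : finType) (e : rel V) (D : nat),
    simple_graph e -> maxdeg e = D -> (0 < D)%N ->
    exists mu : {ffun {ffun V -> 'I_D.+1} -> R},
      [/\ is_distr mu, forall s, mu s != 0 -> proper_col e s & col_spread mu (C / D%:R)].
Proof.
pose C0 := 4000 + (1 / 4 + 2 / c).
pose D0 := (4 * eta_inv + Num.bound (2 / c) + Num.bound (16 * 5 ^+ 5 / c ^+ 5))%N.
have c2 : 0 <= 2 / c by apply: divr_ge0 => //; apply: ltW.
have c5 : 0 <= 16 * 5 ^+ 5 / c ^+ 5.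
  by apply: divr_ge0; [apply: mulr_ge0; rewrite ?exprn_ge0 | apply: exprn_ge0; apply: ltW].
have C00 : 0 <= C0.
  by apply: addr_ge0; [exact: ler0n | apply: addr_ge0 => //; exact: divr_ge0].
exists (C0 + D0.+2%:R); split.
  apply: (@lt_le_trans _ _ D0.+2%:R); first by rewrite ltr1n.
  by rewrite lerDr.
move=> V e D [e_sym e_irr] eD Dpos; apply: spr_col_spread.
have degD v : (#|nbrs e v| <= D)%N by rewrite -eD maxdeg_nbrs.
have DR : 0 < D%:R :> R by rewrite ltr0n.
have [hD|hD] := ltnP D D0.
  apply: (spr_sub _ _ _ (greedy_spr e_sym e_irr degD)) => //.
  rewrite ler_pdivlMr // mul1r; apply: (@le_trans _ _ D0.+2%:R).
    by rewrite ler_nat; move: hD; clear; lia.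
  by rewrite lerDr.
have DSR : 0 < D.+1%:R :> R by rewrite ltr0n.
have hh (x : R) : 0 <= x -> (Num.bound x <= D)%N -> x <= D.+1%:R.
  move=> x0 hx; apply: ltW; apply: (lt_le_trans (archi_boundP x0)).
  by rewrite ler_nat leqW.
apply: (spr_sub _ _ _ (cover_spr e_sym e_irr degD _ _ _)) => //.
- by apply: divr_ge0 => //; apply: ltW.
- rewrite -/C0 ler_pdivrMr // mulrAC ler_pdivlMr //.
  by apply: ler_pM => //; [rewrite lerDl | rewrite ler_nat].
- by apply: leq_trans hD; rewrite /D0 -addnA leq_addr.
- rewrite -ler_pdivrMl // mulrC; apply: hh => //; apply: leq_trans hD.
  by rewrite /D0 addnAC leq_addl.
- by apply: hh => //; apply: leq_trans hD; rewrite /D0 leq_addl.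
Qed.
End Assembly.

(** * Fragments of spread families *)

Section Binomial.
Variables (R : realFieldType) (X : finType).
Implicit Types (W S T A Z : {set X}) (q : R) (qs : seq R).

Definition binw q W : R := \prod_x (if x \in W then q else 1 - q).

Definition prob_seq qs := {in qs, forall q, 0 <= q <= 1}.

Lemma binw_ge0 q W : 0 <= q <= 1 -> 0 <= binw q W.
Proof. by move=> /andP [q0 q1]; apply: prodr_ge0 => x _; case: ifP => // _; rewrite subr_ge0. Qed.

Lemma sum_binw q : \sum_(W : {set X}) binw q W = 1.
Proof.
have := @bigA_distr R 0 1 *%R +%R X (fun=> q) (fun=> 1 - q) => /esym h.
rewrite [LHS](_ : _ = \prod_(x : X) (q + (1 - q))); last by rewrite -h; apply: eq_bigl => W.
by rewrite big1 // => x _; rewrite addrC subrK.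
Qed.

Lemma sum_binw_exp2 q A : \sum_(W : {set X}) binw q W * 2 ^+ #|W :&: A| = (1 + q) ^+ #|A|.
Proof.
have := @bigA_distr R 0 1 *%R +%R X (fun x => if x \in A then 2 * q else q) (fun=> 1 - q) => /esym h.
transitivity (\prod_(x : X) ((if x \in A then 2 * q else q) + (1 - q))).
  rewrite -h; apply: eq_big => [W|W _] //.
  rewrite /binw -prodr_const [X in _ * X]big_mkcond /= -big_split /=; apply: eq_bigr => x _.
  by rewrite inE; case: (x \in W); case: (x \in A); rewrite /= ?mulr1 // mulrC.
rewrite -prodr_const [RHS]big_mkcond /=; apply: eq_bigr => x _.
by case: ifP => _; ring.
Qed.

(** At an element of [T] the weight factor becomes [q], and the factor it replaces is at most 1. *)
Lemma binw_setU q W T : 0 <= q <= 1 -> binw q W * q ^+ #|T| <= binw q (W :|: T).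
Proof.
move=> /andP [q0 q1]; rewrite -prodr_const [X in _ * X]big_mkcond /= -big_split /=.
have q2 : 0 <= 1 - q by rewrite subr_ge0.
apply: ler_prod => x _; rewrite inE; case: (x \in W); case: (x \in T); rewrite /= ?mulr1 ?q0 ?q2 ?lexx //.
  by rewrite mulr_ge0 //= -[X in _ <= X]mul1r ler_wpM2r.
by rewrite mulr_ge0 //= -[X in _ <= X]mul1r ler_wpM2r // lerBlDr lerDl.
Qed.

(** Expectation of [F] at the union of independent binomial sets, one for each density in [qs]. *)
Fixpoint EU qs (F : {set X} -> R) : R :=
  if qs is q :: qs' then \sum_(W : {set X}) binw q W * EU qs' (fun W' => F (W :|: W'))
  else F set0.

Lemma EU_le qs F G : prob_seq qs -> (forall W, F W <= G W) -> EU qs F <= EU qs G.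
Proof.
elim: qs F G => [|q qs IH] F G pq FG //=; apply: ler_sum => W _.
apply: ler_wpM2l; first by apply: binw_ge0; apply: pq; rewrite mem_head.
by apply: IH => // r rq; apply: pq; rewrite inE rq orbT.
Qed.

Lemma EU_ext qs F G : F =1 G -> EU qs F = EU qs G.
Proof. by elim: qs F G => [|q qs IH] F G FG //=; apply: eq_bigr => W _; rewrite (IH _ (fun W' => G (W :|: W'))). Qed.

Lemma EU_const qs k : EU qs (fun=> k) = k.
Proof.
elim: qs => [|q qs IH] //=; rewrite (eq_bigr (fun W => binw q W * k)).
  by rewrite -mulr_suml sum_binw mul1r.
by move=> W _; rewrite IH.
Qed.

Lemma EU_add qs F G : EU qs (fun W => F W + G W) = EU qs F + EU qs G.
Proof.
elim: qs F G => [|q qs IH] F G //=; rewrite -big_split /=; apply: eq_bigr => W _.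
by rewrite IH mulrDr.
Qed.

Lemma EU_scale qs k F : EU qs (fun W => k * F W) = k * EU qs F.
Proof.
elim: qs F => [|q qs IH] F //=; rewrite mulr_sumr; apply: eq_bigr => W _.
by rewrite IH mulrCA.
Qed.

Lemma EU_sum (I : finType) qs (F : I -> {set X} -> R) :
  EU qs (fun W => \sum_i F i W) = \sum_i EU qs (F i).
Proof.
elim: qs F => [|q qs IH] F //=; rewrite exchange_big /=; apply: eq_bigr => W _.
by rewrite IH mulr_sumr.
Qed.

Lemma EU_perm qs F (g : X -> X) : injective g -> EU qs (fun W => F (g @: W)) = EU qs F.
Proof.
move=> gi; elim: qs F => [|q qs IH] F /=; first by rewrite imset0.
rewrite [RHS](reindex_inj (imset_inj gi)) /=; apply: eq_bigr => W _.
have -> : binw q (g @: W) = binw q W.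
  rewrite /binw [LHS](reindex_inj gi) /=; apply: eq_bigr => x _.
  by rewrite mem_imset.
congr (_ * _); rewrite -(IH (fun W' => F (g @: W :|: W'))); apply: EU_ext => W'; by rewrite imsetU.
Qed.

Lemma EU_exp2 qs A : prob_seq qs ->
  EU qs (fun W => 2 ^+ #|W :&: A|) <= \prod_(q <- qs) (1 + q) ^+ #|A|.
Proof.
elim: qs => [|q qs IH] pq /=; first by rewrite set0I cards0 expr0 big_nil.
have pq' : prob_seq qs by move=> r rq; apply: pq; rewrite inE rq orbT.
have q01 : 0 <= q <= 1 by apply: pq; rewrite mem_head.
rewrite big_cons -sum_binw_exp2 mulr_suml; apply: ler_sum => W _.
rewrite -mulrA; apply: ler_wpM2l; first exact: binw_ge0.
apply: (@le_trans _ _ (2 ^+ #|W :&: A| * EU qs (fun W => 2 ^+ #|W :&: A|))).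
  rewrite -EU_scale; apply: EU_le => // W'; rewrite -exprD; apply: ler_weXn2l; first by rewrite ler1n.
  by rewrite setIUl leq_card_setU.
by apply: ler_wpM2l; [rewrite exprn_ge0 | exact: IH].
Qed.

End Binomial.

(** * Minimum fragments and one round of sampling *)

Section Fragments.
Variables (R : realFieldType) (X : finType).
Implicit Types (W S T A Z : {set X}) (H : {set {set X}}) (nu : {set X} -> R).

Definition best H W S : {set X} :=
  [arg min_(S' < S | (S' \in H) && (S' \subset W :|: S)) #|S' :\: W|].
Definition frag H W S : {set X} := best H W S :\: W.

Lemma bestP H W S : S \in H ->
  [/\ best H W S \in H, best H W S \subset W :|: S &
    forall S', S' \in H -> S' \subset W :|: S -> (#|frag H W S| <= #|S' :\: W|)%N].
Proof.
move=> SH; rewrite /frag /best; case: arg_minnP => [|S' /andP [h1 h2] h3].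
  by rewrite SH subsetUr.
by split => // S'' k1 k2; apply: h3; rewrite k1.
Qed.

Lemma frag_sub H W S : S \in H -> frag H W S \subset S.
Proof. by move=> /(bestP W) [_ h _]; rewrite /frag subDset. Qed.

Lemma best_frag H W S : best H W S \subset W :|: frag H W S.
Proof. by rewrite -subDset. Qed.

(** [S' :\: W] lies inside the fragment, and by minimality it cannot be smaller. *)
Lemma frag_canon H W S S' : S \in H -> S' \in H -> S' \subset W :|: frag H W S ->
  frag H W S \subset S'.
Proof.
move=> SH SH' sub; have [_ _ mn] := bestP W SH.
have s1 : S' :\: W \subset frag H W S by rewrite subDset.
have c1 : (#|frag H W S| <= #|S' :\: W|)%N.
  by apply: mn => //; apply: subset_trans sub _; apply: setUS; apply: frag_sub.
have /eqP <- : S' :\: W == frag H W S by rewrite eqEcard s1 c1.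
exact: subsetDl.
Qed.

(** The total mass is left free: what a round fails to shrink is dropped without renormalising,
    which keeps [p] unchanged. *)
Definition spread_on H nu (p : R) :=
  [/\ forall S, 0 <= nu S, forall S, nu S != 0 -> S \in H &
      forall A, \sum_(S : {set X} | A \subset S) nu S <= p ^+ #|A|].

Definition mass nu : R := \sum_(S : {set X}) nu S.

Definition next_fam H (m : nat) W : {set {set X}} :=
  [set T : {set X} | (#|T| <= m)%N && [exists S in H, frag H W S == T]].
Definition next_nu H nu (m : nat) W T : R :=
  if (#|T| <= m)%N then \sum_(S in H | frag H W S == T) nu S else 0.
Definition lost H nu m W : R := \sum_(S in H | (m < #|frag H W S|)%N) nu S.

Lemma next_nu_sum H nu m W (P : pred {set X}) :
  \sum_(T : {set X} | P T) next_nu H nu m W T =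
  \sum_(S in H | P (frag H W S) && (#|frag H W S| <= m)%N) nu S.
Proof.
rewrite [RHS](partition_big (frag H W) (fun T : {set X} => P T && (#|T| <= m)%N)) /=; last first.
  by move=> S /and3P [_ -> ->].
rewrite /next_nu -big_mkcondr /=; apply: eq_bigr => T /andP [PT Tm].
apply: eq_bigl => S; case: eqP => [->|]; rewrite ?andbF // PT Tm !andbT //.
Qed.

(** A fragment is contained in its set, so passing to fragments only lowers the mass of sets
    containing [A]. *)
Lemma next_spread H nu m W p : spread_on H nu p ->
  spread_on (next_fam H m W) (next_nu H nu m W) p.
Proof.
move=> [n0 nH nS]; split.
- by move=> T; rewrite /next_nu; case: ifP => // _; apply: sumr_ge0.
- move=> T; rewrite /next_nu inE; case: ifP => // _; last by rewrite eqxx.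
  apply: contraR => /existsPn h; rewrite big1 // => S /andP [SH fS].
  by have := h S; rewrite SH fS.
- move=> A; rewrite next_nu_sum; apply: le_trans (nS A).
  rewrite big_mkcond [leRHS]big_mkcond; apply: ler_sum => S _.
  case: ifP => [/and3P [SH AS _]|_]; last by case: ifP.
  by rewrite (subset_trans AS (frag_sub W SH)).
Qed.

Lemma mass_next H nu m W p : spread_on H nu p ->
  mass nu = mass (next_nu H nu m W) + lost H nu m W.
Proof.
move=> [n0 nH _]; rewrite /mass next_nu_sum /lost.
rewrite (bigID (mem H)) /= addrC big1 ?add0r; last first.
  by move=> S SH; apply/eqP; apply: contraNT SH => /nH.
rewrite (bigID (fun S => (#|frag H W S| <= m)%N)) /=; congr (_ + _).
by apply: eq_bigl => S; rewrite ltnNge.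
Qed.

(* Union bound over Z = W :|: T, where T is a fragment: by minimality T lies in every
   member of H contained in Z, so that Z leaves few choices for T. *)
Lemma lost_le H nu m p q L err : 0 < L -> 0 <= p -> p * L <= q -> 0 <= q <= 1 -> 0 <= err ->
  spread_on H nu p ->
  (forall S, S \in H -> \sum_(T : {set X} | (T \subset S) && (m < #|T|)%N) L^-1 ^+ #|T| <= err) ->
  \sum_(W : {set X}) binw q W * lost H nu m W <= err.
Proof.
move=> L0 p0 pq q01 e0 [n0 nH nS] herr.
pose U W : {set {set X}} := [set T : {set X} | (m < #|T|)%N && [exists S in H, frag H W S == T]].
have l1 W : lost H nu m W <= \sum_(T in U W) p ^+ #|T|.
  rewrite /lost (partition_big (frag H W) (mem (U W))) /=; last first.
    move=> S /andP [SH mS]; rewrite inE mS; apply/existsP; exists S; by rewrite SH eqxx.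
  apply: ler_sum => T _; apply: le_trans (nS T).
  rewrite big_mkcond [leRHS]big_mkcond; apply: ler_sum => S _.
  case: ifP => [/andP [/andP [SH _] /eqP fS]|_]; last by case: ifP.
  by rewrite -fS frag_sub.
have Li : 0 <= L^-1 by rewrite invr_ge0 ltW.
(* As [p <= q / L], the factor [q ^+ #|T|] pays for adding [T] to [W], and [L^-1 ^+ #|T|] is left
   over. *)
apply: (@le_trans _ _ (\sum_(W : {set X}) \sum_(T in U W) binw q (W :|: T) * L^-1 ^+ #|T|)).
  apply: ler_sum => W _; apply: (@le_trans _ _ (binw q W * \sum_(T in U W) p ^+ #|T|)).
    by apply: ler_wpM2l; rewrite ?binw_ge0.
  rewrite mulr_sumr; apply: ler_sum => T _.
  apply: (@le_trans _ _ (binw q W * q ^+ #|T| * L^-1 ^+ #|T|)); last first.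
    by apply: ler_wpM2r; [apply: exprn_ge0 | apply: binw_setU].
  rewrite -mulrA -exprMn; apply: ler_wpM2l; first exact: binw_ge0.
  apply: lerXn2r; rewrite ?nnegrE //; first by rewrite mulr_ge0 //; case/andP: q01.
  by rewrite ler_pdivlMr.
pose ok (Z T : {set X}) := [&& (m < #|T|)%N, T \subset Z & [exists W : {set X}, (Z == W :|: T) && (T \in U W)]].
apply: (@le_trans _ _ (\sum_(Z : {set X}) \sum_(T : {set X} | ok Z T) binw q Z * L^-1 ^+ #|T|)).
  rewrite !pair_big_dep /=.
  pose P1 (WT : {set X} * {set X}) := WT.2 \in U WT.1.
  pose g (WT : {set X} * {set X}) := (WT.1 :|: WT.2, WT.2).
  have ginj : {in P1 &, injective g}.
    move=> [W T] [W' T']; rewrite /P1 !unfold_in /= => hT hT' [eZ eT].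
    have dj A B : B \in U A -> A = (A :|: B) :\: B.
      rewrite inE => /andP [_ /existsP [S /andP [_ /eqP <-]]].
      rewrite setDUl setDv setU0; apply/setP => x; rewrite !inE.
      by case: (x \in A); rewrite ?andbF.
    by rewrite (dj _ _ hT) eZ eT -(dj _ _ hT').
  rewrite (eq_bigr (fun WT => binw q (g WT).1 * L^-1 ^+ #|(g WT).2|)) //.
  rewrite -(big_imset (h := g) (fun ZT => binw q ZT.1 * L^-1 ^+ #|ZT.2|) ginj) /=.
  rewrite big_mkcond [leRHS]big_mkcond; apply: ler_sum => - [Z T] _ /=.
  case: ifP => [/imsetP [[W T'] hT [-> ->]]|_]; last first.
    by case: ifP => // _; rewrite mulr_ge0 ?binw_ge0 ?exprn_ge0.
  rewrite (_ : ok _ _ = true) //; have hT' : T' \in U W := hT.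
  rewrite /ok subsetUr /=; apply/andP; split; first by move: hT'; rewrite inE => /andP [].
  by apply/existsP; exists W; rewrite eqxx.
apply: (@le_trans _ _ (\sum_(Z : {set X}) binw q Z * err)); last first.
  by rewrite -mulr_suml sum_binw mul1r.
apply: ler_sum => Z _; rewrite -mulr_sumr; apply: ler_wpM2l; first exact: binw_ge0.
(* If [Z] contains a member [S] of [H], every admissible [T] is a subset of [S]. Otherwise no [T] is
   admissible, since [Z] would contain [best H W S']. *)
have [/existsP [S /andP [SH SZ]]|/existsPn hZ] := boolP [exists S in H, S \subset Z].
  apply: le_trans (herr S SH); rewrite big_mkcond [leRHS]big_mkcond; apply: ler_sum => T _.
  case: ifP => [/and3P [mT _ /existsP [W /andP [/eqP eZ]]]|_]; last first.
    by case: ifP => // _; apply: exprn_ge0.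
  rewrite inE => /andP [_ /existsP [S' /andP [SH' /eqP fT]]].
  rewrite mT andbT -fT (frag_canon SH') //.
  by rewrite fT -eZ.
rewrite big1 // => T /and3P [_ _ /existsP [W /andP [/eqP eZ]]].
rewrite inE => /andP [_ /existsP [S' /andP [SH' /eqP fT]]].
have [bH _ _] := bestP W SH'; have := hZ (best H W S'); rewrite bH /=.
by rewrite eZ -fT best_frag.
Qed.

Definition fail H W : R := if [exists S in H, S \subset W] then 0 else 1.

(** Missing mass counts as failure, so that the errors of successive rounds add. *)
Definition fail_bound (p : R) (qs : seq R) (l : nat) (dl : R) :=
  forall H nu, spread_on H nu p -> (forall S, S \in H -> (#|S| <= l)%N) ->
    EU qs (fail H) <= 1 - mass nu + dl.

Lemma fail_bound0 p : fail_bound p [::] 0 0.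
Proof.
move=> H nu [n0 nH nS] H0 /=; rewrite addr0 /fail.
have m1 : mass nu <= 1.
  have := nS set0; rewrite cards0 expr0 /mass; under eq_bigl => S do rewrite sub0set.
  by [].
case: ifP => h; first by rewrite subr_ge0.
rewrite lerBrDr gerDl /mass big1 // => S _; apply/eqP/negPn/negP => /nH SH.
move/negbT/negP: h; apply; apply/existsP; exists S; rewrite SH.
by have := H0 S SH; rewrite leqn0 cards_eq0 => /eqP ->; apply: subxx.
Qed.

Lemma fail_boundS p q L qs l m dl err :
  0 < L -> 0 <= p -> p * L <= q -> 0 <= q <= 1 -> 0 <= err -> prob_seq qs ->
  fail_bound p qs m dl ->
  (forall S : {set X}, (#|S| <= l)%N ->
     \sum_(T : {set X} | (T \subset S) && (m < #|T|)%N) L^-1 ^+ #|T| <= err) ->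
  fail_bound p (q :: qs) l (dl + err).
Proof.
move=> L0 p0 pq q01 e0 pqs IH herr H nu spr Hl /=.
have hl := lost_le L0 p0 pq q01 e0 spr (fun S SH => herr S (Hl S SH)).
apply: (@le_trans _ _ (\sum_(W : {set X}) binw q W * (1 - mass nu + dl + lost H nu m W))).
  apply: ler_sum => W _; apply: ler_wpM2l; first exact: binw_ge0.
  have := IH _ _ (next_spread m W spr) _; rewrite (mass_next m W spr).
  move=> h; apply: (@le_trans _ _ (EU qs (fail (next_fam H m W)))).
    apply: EU_le => // W'; rewrite /fail; case: ifP => [|h1]; first by case: ifP => //; rewrite ler01.
    case: ifP => [/existsP [T /andP [TH TW]]|] //.
    move: TH; rewrite inE => /andP [_ /existsP [S /andP [SH /eqP fS]]].
    move/negbT/negP: h1; case; apply/existsP; exists (best H W S).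
    have [-> _ _] := bestP W SH; rewrite /=.
    by apply: subset_trans (best_frag H W S) _; rewrite fS setUS.
  apply: (le_trans (h _)); last by lra.
  by move=> T; rewrite inE => /andP [].
under eq_bigr => W _ do rewrite mulrDr.
rewrite big_split /= -mulr_suml sum_binw mul1r.
by rewrite addrA lerD2l.
Qed.

End Fragments.

(** * From binomial lists to uniform lists *)

Lemma perm_imset_eq (T : finType) (A B : {set T}) : #|A| = #|B| ->
  exists s : {perm T}, s @: A = B.
Proof.
move e : #|A :\: B| => n; elim: n A e => [|n IH] A e cAB.
  exists 1%g; rewrite (eq_imset (g := id)) ?imset_id => [|x]; last by rewrite perm1.
  by apply/eqP; rewrite eqEcard cAB leqnn andbT -setD_eq0 -cards_eq0 e.
have e' : #|B :\: A| = n.+1.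
  by have := cardsID B A; have := cardsID A B; rewrite setIC cAB e; clia.
have /card_gt0P [a aAB] : (0 < #|A :\: B|)%N by rewrite e.
have /card_gt0P [b bBA] : (0 < #|B :\: A|)%N by rewrite e'.
move: (aAB) (bBA); rewrite !in_setD => /andP [aB aA] /andP [bA bB].
have ab : a != b by apply: contraNneq aB => ->.
pose A' := tperm a b @: A.
have cA' : #|A'| = #|A| by apply: card_imset; apply: perm_inj.
have memA' x : (x \in A') = (tperm a b x \in A).
  by rewrite -{1}(tpermK a b x) /A' mem_imset //; apply: perm_inj.
have eA : A' :\: B = (A :\: B) :\ a.
  apply/setP => x; rewrite !in_setD in_set1 memA'.
  have [->|xa] := eqVneq x a; first by rewrite tpermL (negbTE bA) andbF.
  have [->|xb] := eqVneq x b; first by rewrite bB.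
  by rewrite tpermD // eq_sym.
have [] := IH A'.
- by rewrite eA; have := cardsD1 a (A :\: B); rewrite aAB e add1n => - [].
- by rewrite cA'.
move=> s hs; exists (tperm a b * s)%g; rewrite -hs /A' -imset_comp.
by apply: eq_imset => x; rewrite permM.
Qed.

Section Transfer.
Variables (R : realFieldType) (V : finType) (K k : nat).
Notation Lists := {ffun V -> {set 'I_K}}.
Notation Perms := {ffun V -> {perm 'I_K}}.
Implicit Types (L : Lists) (s : Perms) (W : {set V * 'I_K}).
Variable (G : pred Lists).
Hypothesis Gmono : forall L L', (forall v, L v \subset L' v) -> G L' -> G L.
Hypothesis kK : (k <= K)%N.

Definition lists W : Lists := [ffun v => [set c | (v, c) \in W]].
Definition act s L : Lists := [ffun v => s v @: L v].
Definition actX s (x : V * 'I_K) := (x.1, s x.1 x.2).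

Lemma actX_inj s : injective (actX s).
Proof. by move=> [v c] [w d] [-> ] /perm_inj ->. Qed.

Lemma act_inj s : injective (act s).
Proof.
move=> L L' /ffunP h; apply/ffunP => v; have := h v; rewrite !ffunE.
by apply: imset_inj; apply: perm_inj.
Qed.

Lemma lists_actX s W : lists (actX s @: W) = act s (lists W).
Proof.
apply/ffunP => v; rewrite !ffunE; apply/setP => c; rewrite inE.
apply/imsetP/imsetP => [[[w d] dW [-> ->]]|[d]]; first by exists d; rewrite ?inE.
by rewrite inE => dW ->; exists (v, d).
Qed.

Lemma act_klists s L : (act s L \in klists V K k) = (L \in klists V K k).
Proof.
rewrite !inE; apply: eq_forallb => v; rewrite ffunE card_imset //; exact: perm_inj.
Qed.

Lemma act_trans L L' : L \in klists V K k -> L' \in klists V K k ->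
  exists s, act s L = L'.
Proof.
rewrite !inE => /forallP hL /forallP hL'.
have /choice [f hf] : forall v, exists s : {perm 'I_K}, s @: L v = L' v.
  by move=> v; apply: perm_imset_eq; rewrite (eqP (hL v)) (eqP (hL' v)).
by exists [ffun v => f v]; apply/ffunP => v; rewrite !ffunE hf.
Qed.

Definition orbit_count L := (\sum_(s : Perms) G (act s L))%N.
Definition bad_lists := [set L in klists V K k | G L].

(** The palette permutations act transitively on [k]-lists, so the two counts differ by a
    translation in the group. *)
Lemma orbit_count_eq L L' : L \in klists V K k -> L' \in klists V K k ->
  orbit_count L = orbit_count L'.
Proof.
move=> hL hL'; have [r <-] := act_trans hL hL'; rewrite /orbit_count.
pose f s : Perms := [ffun v => (r v * s v)%g].
have fi : injective f.
  by move=> s s' /ffunP h; apply/ffunP => v; have := h v; rewrite !ffunE => /mulgI.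
rewrite (reindex_inj fi); apply: eq_bigr => s _; congr (nat_of_bool (G _)).
apply/ffunP => v; rewrite !ffunE -imset_comp; apply: eq_imset => x.
by rewrite permM.
Qed.

Lemma orbit_countE L : L \in klists V K k ->
  (#|klists V K k| * orbit_count L = #|{: Perms}| * #|bad_lists|)%N.
Proof.
move=> hL; rewrite -!sum_nat_const.
rewrite (eq_bigr (fun L' => orbit_count L')) => [|L' hL']; last exact: orbit_count_eq.
rewrite /orbit_count exchange_big /=; apply: eq_bigr => s _.
rewrite -sum1dep_card [LHS]big_mkcond [RHS]big_mkcond /= [RHS](reindex_inj (@act_inj s)) /=.
by apply: eq_bigr => L' _; rewrite act_klists; case: ifP => //=; case: (G _).
Qed.

Lemma klists_gt0 : (0 < #|klists V K k|)%N.
Proof.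
have [B _ cB] : exists2 B : {set 'I_K}, B \subset setT & #|B| = k.
  by apply: exists_subset; rewrite cardsT card_ord.
by apply/card_gt0P; exists [ffun=> B]; rewrite inE; apply/forallP => v; rewrite ffunE cB.
Qed.

Definition bad_freq : R := #|bad_lists|%:R / #|klists V K k|%:R.

Lemma klists_superset L : (forall v, (#|L v| <= k)%N) ->
  exists2 L', L' \in klists V K k & forall v, L v \subset L' v.
Proof.
move=> hL.
have /choice [f hf] : forall v, exists B : {set 'I_K}, #|B| = k /\ L v \subset B.
  move=> v; have [|B sB cB] := @exists_subset _ (~: L v) (k - #|L v|)%N.
    by rewrite leq_subLR cardsC card_ord.
  exists (L v :|: B); rewrite subsetUl; split => //.
  rewrite cardsU (_ : L v :&: B = set0) ?cards0 ?subn0 ?cB ?subnKC //.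
  apply/setP => x; rewrite !inE; apply/negP => /andP [h1 h2].
  by have := subsetP sB x h2; rewrite inE h1.
exists [ffun v => f v]; first by rewrite inE; apply/forallP => v; rewrite ffunE (hf v).1.
by move=> v; rewrite ffunE (hf v).2.
Qed.

Definition fiber v : {set V * 'I_K} := setX [set v] setT.

Lemma fiber_card v : #|fiber v| = K.
Proof. by rewrite cardsX cards1 mul1n cardsT card_ord. Qed.

Lemma lists_card W v : #|lists W v| = #|W :&: fiber v|.
Proof.
have inj : injective (fun c : 'I_K => (v, c)) by move=> x y [].
rewrite ffunE -(card_imset _ inj); apply: eq_card => - [w c].
rewrite in_setI in_setX in_set1 in_setT andbT.
apply/imsetP/andP => [[d] |[wW /eqP ew]]; first by rewrite inE => dW [-> ->].
by rewrite ew in wW *; exists c; rewrite ?inE.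
Qed.

(* k-lists containing the lists of W are worth no more than the latter, and permuting the
   palette at each vertex acts transitively on k-lists. *)
Lemma bad_freq_pointwise W :
  bad_freq <= (\sum_(s : Perms) (G (lists (actX s @: W)))%:R) / #|{: Perms}|%:R +
     \sum_v 2 ^+ #|W :&: fiber v| / 2 ^+ k.
Proof.
have P0 : 0 < #|{: Perms}|%:R :> R by rewrite ltr0n; apply/card_gt0P; exists [ffun=> 1%g].
have k0 : 0 < #|klists V K k|%:R :> R by rewrite ltr0n klists_gt0.
have two j : 0 <= 2 ^+ j / 2 ^+ k :> R by rewrite divr_ge0 // exprn_ge0.
have [/forallP hW|/forallPn [v hv]] := boolP [forall v, (#|lists W v| <= k)%N].
  apply: ler_wpDr; first by apply: sumr_ge0 => v _.
  have [L hL sL] := klists_superset hW.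
  rewrite -natr_sum /bad_freq ler_pdivlMr // mulrAC ler_pdivrMr // -!natrM ler_nat.
  rewrite mulnC -(orbit_countE hL) mulnC leq_mul2r; apply/orP; right.
  apply: leq_sum => s _; rewrite lists_actX; case: (boolP (G (act s L))) => // hG.
  rewrite (Gmono _ hG) // => v; rewrite !ffunE; apply: imsetS; have := sL v; by rewrite ffunE.
apply: (@le_trans _ _ 1).
  rewrite /bad_freq ler_pdivrMr // mul1r ler_nat; apply: subset_leq_card.
  by apply/subsetP => L; rewrite inE => /andP [].
apply: ler_wpDl; first by rewrite divr_ge0 // sumr_ge0 // => s _; rewrite ler0n.
rewrite (bigD1 v) //=; apply: ler_wpDr; first by apply: sumr_ge0.
rewrite ler_pdivlMr ?exprn_gt0 // mul1r; apply: ler_weXn2l; first by rewrite ler1n.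
by rewrite -lists_card ltnW // ltnNge.
Qed.

(** A binomial sample is invariant under palette permutations, which removes the average over [s].
    The other term is a Markov bound on the chance that some list exceeds [k]. *)
Lemma bad_freq_le (qs : seq R) : prob_seq qs ->
  bad_freq <= EU qs (fun W => (G (lists W))%:R) +
    #|V|%:R * (\prod_(q <- qs) (1 + q) ^+ K / 2 ^+ k).
Proof.
move=> pq; have P0 : 0 < #|{: Perms}|%:R :> R by rewrite ltr0n; apply/card_gt0P; exists [ffun=> 1%g].
rewrite -[X in X <= _](@EU_const R (V * 'I_K)%type qs bad_freq).
apply: (le_trans (EU_le pq bad_freq_pointwise)).
rewrite EU_add; apply: lerD.
  rewrite (@EU_ext _ _ _ _ (fun W => (#|{: Perms}|%:R)^-1 *
    \sum_(s : Perms) (G (lists (actX s @: W)))%:R)) => [|W]; last by rewrite mulrC.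
  rewrite EU_scale EU_sum ler_pdivrMl // mulr_natl -sumr_const; apply: ler_sum => s _.
  by rewrite (@EU_perm _ _ _ (fun W => (G (lists W))%:R) _ (@actX_inj s)).
rewrite EU_sum mulr_natl -sumr_const; apply: ler_sum => v _.
rewrite (@EU_ext _ _ _ _ (fun W => (2 ^+ k)^-1 * 2 ^+ #|W :&: fiber v|)) => [|W]; last by rewrite mulrC.
rewrite EU_scale mulrC; apply: ler_wpM2r; first by rewrite invr_ge0 exprn_ge0.
have := @EU_exp2 R _ qs (fiber v) pq; by rewrite fiber_card.
Qed.
End Transfer.

(** * Iterating the sampling rounds *)

Section Rounds.
Variables (R : realType) (X : finType).
Implicit Types (p q y L : R) (S T : {set X}).

Lemma sum_subsets S y : \sum_(T : {set X} | T \subset S) y ^+ #|T| = (1 + y) ^+ #|S|.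
Proof.
rewrite addrC -prodr_const prod_addE; apply: eq_bigr => T _.
by rewrite prodr_const [X in _ * X]big1 ?mulr1.
Qed.

(** Only an empty fragment is kept, so the error sums over all nonempty [T], giving at most
    [(1 + 1 / L) ^ l - 1]. *)
Lemma fail_bound_last p q L l : 0 <= p -> 0 < L -> p * L <= q -> 0 <= q <= 1 ->
  2 * l%:R <= L -> @fail_bound R X p [:: q] l (2 * l%:R / L).
Proof.
move=> p0 L0 pq q01 lL; rewrite -[2 * l%:R / L]add0r.
have e0 : 0 <= 2 * l%:R / L by rewrite divr_ge0 ?mulr_ge0 // ltW.
apply: (fail_boundS L0 p0 pq q01 e0 _ (@fail_bound0 R X p)) => // S Sl.
have Li : 0 <= L^-1 by rewrite invr_ge0 ltW.
have := sum_subsets S L^-1.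
rewrite (bigID (fun T => (0 < #|T|)%N)) /= addrC (big_pred1 set0) => [|T]; last first.
  by rewrite /= -leqNgt leqn0 cards_eq0; case: eqP => [->|]; rewrite ?sub0set ?andbF.
rewrite cards0 expr0 => h.
have h2 : (1 + L^-1) ^+ #|S| <= 1 + 2 * l%:R / L.
  apply: (@le_trans _ _ ((1 + L^-1) ^+ l)).
    by apply: ler_weXn2l => //; rewrite lerDl.
  apply: (@le_trans _ _ (expR (L^-1) ^+ l)).
    by apply: lerXn2r; rewrite ?nnegrE ?expR_ge0 ?addr_ge0 // expR_ge1Dx.
  rewrite -expRM_natl; set z := l%:R * L^-1.
  have z0 : 0 <= z by apply: mulr_ge0.
  have z1 : z <= 1 / 2 by rewrite /z ler_pdivrMr //; move: lL; lra.
  apply: (le_trans (expR_le_quad z1)).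
  have -> : 2 * l%:R / L = 2 * z by rewrite /z mulrA.
  by rewrite -addrA lerD2l; move: z0 z1; nra.
by move: h h2; lra.
Qed.

(** There are at most [2 ^ (2 m)] subsets, each of weight at most [64 ^ (- m) = 8 ^ (- 2 m)]. *)
Lemma fail_bound_half p q qs m dl : 0 <= p -> p * 64 <= q -> 0 <= q <= 1 -> prob_seq qs ->
  @fail_bound R X p qs m dl -> @fail_bound R X p (q :: qs) (m * 2) (dl + (1 / 4) ^+ (m * 2)).
Proof.
move=> p0 pq q01 pqs IH.
have e0 : 0 <= (1 / 4) ^+ (m * 2) :> R by rewrite exprn_ge0 // divr_ge0.
have L0 : 0 < 64 :> R by rewrite ltr0n.
apply: (fail_boundS L0 p0 pq q01 e0 pqs IH) => S Sm.
apply: (@le_trans _ _ (\sum_(T : {set X} | T \subset S) (1 / 8) ^+ (m * 2))).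
  rewrite [leLHS]big_mkcondr; apply: ler_sum => T _; case: ifP => [mT|_]; last first.
    by rewrite exprn_ge0 // divr_ge0.
  have -> : 64^-1 = (1 / 8) ^+ 2 :> R by field.
  rewrite -exprM; apply: ler_wiXn2l; rewrite ?divr_ge0 //; last by lia.
  by rewrite ler_pdivrMr // mul1r ler1n.
rewrite sumr_const -[X in X <= _]mulr_natl.
have -> : #|[pred T : {set X} | T \subset S]|%:R = 2 ^+ #|S| :> R.
  by have := sum_subsets S 1; rewrite -natr1 addrC => <-; rewrite -sum1_card natr_sum;
     apply: eq_bigr => T _; rewrite expr1n.
apply: (@le_trans _ _ (2 ^+ (m * 2) * (1 / 8) ^+ (m * 2))).
  apply: ler_wpM2r; first by rewrite exprn_ge0 // divr_ge0.
  by apply: ler_weXn2l => //; rewrite ler1n.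
by rewrite -exprMn (_ : 2 * (1 / 8) = 1 / 4 :> R) //; field.
Qed.

(** The errors [(1 / 4) ^+ (m * 2 ^ i)] are dominated by a geometric series, so their sum stays
    below [(1 / 4) ^+ m] whatever [r]. *)
Lemma fail_bound_rounds p q qs m dl r : (0 < m)%N -> 0 <= p -> p * 64 <= q -> 0 <= q <= 1 ->
  prob_seq qs -> @fail_bound R X p qs m dl ->
  prob_seq (nseq r q ++ qs) /\
  @fail_bound R X p (nseq r q ++ qs) (m * 2 ^ r) (dl + (1 / 4) ^+ m * (1 - (1 / 4) ^+ r)).
Proof.
move=> m0 p0 pq q01 pqs h; elim: r => [|r [IH1 IH2]] /=.
  by rewrite expn0 muln1 expr0 subrr mulr0 addr0.
have pq' : prob_seq (q :: nseq r q ++ qs).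
  by move=> x; rewrite inE => /orP [/eqP ->|/IH1].
split=> //; have := fail_bound_half p0 pq q01 IH1 IH2.
rewrite -mulnA -expnSr => hb H nu h1 h2; apply: (le_trans (hb H nu h1 h2)).
rewrite lerD2l -addrA lerD2l.
have f0 : 0 <= 1 / 4 :> R by rewrite divr_ge0.
have : (1 / 4) ^+ (m * 2 ^ r.+1) <= (1 / 4) ^+ (m + r.+1) :> R.
  apply: ler_wiXn2l => //; first by rewrite ler_pdivrMr // mul1r ler1n.
  have e2 : (r.+1 < 2 ^ r.+1)%N by apply: ltn_expl.
  apply: (@leq_trans (m * r.+2)); last by rewrite leq_mul2l e2 orbT.
  by rewrite mulnS leq_add2l leq_pmull.
rewrite exprD exprS; set a := (1 / 4) ^+ m; set b := (1 / 4) ^+ r => hh.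
have ab : 0 <= a * b by rewrite mulr_ge0 ?exprn_ge0.
by move: hh; rewrite mulrCA; set w := _ ^+ _ ; move: ab; lra.
Qed.

End Rounds.

(** * Uniform lists of logarithmic size *)

Section Lists.
Variable R : realType.

Lemma expR_half_le2 (k : nat) : expR (k%:R / 2) <= 2 ^+ k :> R.
Proof.
rewrite expRM_natl; apply: lerXn2r; rewrite ?nnegrE ?expR_ge0 //.
have h : 2^-1 <= expR (- 2^-1) :> R by have := expR_ge1Dx (- 2^-1 : R); lra.
by rewrite -[2^-1]opprK expRN -[leRHS]invrK lef_pV2 ?posrE ?expR_gt0 ?invr_gt0.
Qed.

Lemma prod_expR_le (qs : seq R) (K : nat) : prob_seq qs ->
  \prod_(q <- qs) (1 + q) ^+ K <= expR (K%:R * \sum_(q <- qs) q).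
Proof.
elim: qs => [|q qs IH] pq; first by rewrite !big_nil mulr0 expR0.
have /andP [q0 _] : 0 <= q <= 1 by apply: pq; rewrite mem_head.
rewrite !big_cons mulrDr expRD; apply: ler_pM.
- by rewrite exprn_ge0 // addr_ge0.
- rewrite big_seq; apply: prodr_ge0 => r rq; rewrite exprn_ge0 // addr_ge0 //.
  by have /andP [] := pq r (mem_behead (s := q :: qs) rq).
- rewrite expRM_natl; apply: lerXn2r; rewrite ?nnegrE ?expR_ge0 ?addr_ge0 //.
  exact: expR_ge1Dx.
- by apply: IH => r rq; apply: pq; rewrite inE rq orbT.
Qed.

Lemma prob_colorableE (V : finType) (e : rel V) (K k : nat) : (k <= K)%N ->
  prob_L_colorable R e K k = 1 - bad_freq R k (fun L => ~~ L_colorable e (K := K) L).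
Proof.
move=> kK; have h0 := klists_gt0 V kK; rewrite /prob_L_colorable /bad_freq.
have -> : bad_lists k (fun L => ~~ L_colorable e (K := K) L) =
   klists V K k :\: [set L in klists V K k | L_colorable e L].
  apply/setP => L; have hL : (L \in [set L in klists V K k | L_colorable e L]) =
    (L \in klists V K k) && L_colorable e L by rewrite inE.
  rewrite [LHS]inE in_setD hL; by case: (L \in klists V K k); rewrite //= ?andbT ?andbF.
have := cardsID [set L in klists V K k | L_colorable e L] (klists V K k).
have -> : klists V K k :&: [set L in klists V K k | L_colorable e L] =
   [set L in klists V K k | L_colorable e L].
  by apply/setIidPr; apply/subsetP => L; rewrite inE => /andP [].
move/(congr1 (fun n => n%:R : R)); rewrite natrD.
have hR : 0 < #|klists V K k|%:R :> R by rewrite ltr0n.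
move=> h.
rewrite -[X in X - _](divff (lt0r_neq0 hR)) -mulrBl; congr (_ / _).
by rewrite -h addrK.
Qed.

Lemma colorable_mono (V : finType) (e : rel V) (K : nat) (L L' : {ffun V -> {set 'I_K}}) :
  (forall v, L v \subset L' v) -> ~~ L_colorable e L' -> ~~ L_colorable e L.
Proof.
move=> sub; apply: contraNN => /existsP [s /andP [ps /forallP hs]].
by apply/existsP; exists s; rewrite ps; apply/forallP => v; apply: (subsetP (sub v)).
Qed.

Definition law (V : finType) (K : nat) (mu : {ffun {ffun V -> 'I_K} -> R})
  (S : {set V * 'I_K}) : R := \sum_(s | col_graph s == S) mu s.
Definition supp_graphs (V : finType) (K : nat) (mu : {ffun {ffun V -> 'I_K} -> R}) :
  {set {set V * 'I_K}} := [set S | [exists s, (mu s != 0) && (col_graph s == S)]].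

Lemma law_sum (V : finType) (K : nat) (mu : {ffun {ffun V -> 'I_K} -> R})
  (P : pred {set V * 'I_K}) :
  \sum_(S | P S) law mu S = \sum_(s | P (col_graph s)) mu s.
Proof.
rewrite [RHS](partition_big (@col_graph V K) P) //=; apply: eq_bigr => S PS.
by apply: eq_bigl => s; case: eqP => [->|]; rewrite ?PS ?andbF.
Qed.

Lemma law_spread (V : finType) (K : nat) (mu : {ffun {ffun V -> 'I_K} -> R}) p :
  is_distr mu -> col_spread mu p -> spread_on (supp_graphs mu) (law mu) p.
Proof.
move=> [m0 m1] ms; split.
- by move=> S; apply: sumr_ge0.
- move=> S; rewrite inE; apply: contraR => /existsPn h; rewrite /law big1 // => s sS.
  by have := h s; rewrite sS andbT negbK => /eqP.
- by move=> A; rewrite law_sum; apply: ms.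
Qed.

Lemma col_graph_card (V : finType) (K : nat) (s : {ffun V -> 'I_K}) :
  #|col_graph s| = #|V|.
Proof. by rewrite card_imset // => v w [->]. Qed.

Lemma notcolorable_fail (V : finType) (e : rel V) (K : nat)
  (mu : {ffun {ffun V -> 'I_K} -> R}) (W : {set V * 'I_K}) :
  (forall s, mu s != 0 -> proper_col e s) ->
  (~~ L_colorable e (lists W))%:R <= fail R (supp_graphs mu) W.
Proof.
move=> mp; rewrite /fail; case: existsP => [[S /andP [SH SW]]|_]; last by case: (~~ _).
move: SH; rewrite inE => /existsP [s /andP [/mp ps /eqP eS]].
rewrite (_ : L_colorable _ _ = true) //; apply/existsP; exists s; rewrite ps.
apply/forallP => v; rewrite ffunE inE; apply: (subsetP SW); rewrite -eS.
exact: imset_f.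
Qed.

Lemma edgeless_bad (V : finType) (e : rel V) (k : nat) : maxdeg e = 0%N -> (0 < k)%N ->
  bad_freq R k (fun L => ~~ L_colorable e (K := 1) L) = 0.
Proof.
move=> e0 k0; rewrite /bad_freq (_ : bad_lists _ _ = set0) ?cards0 ?mul0r //.
apply/setP => L; rewrite in_set0; apply/negP; rewrite inE => /andP [hL /negP]; apply.
move: hL; rewrite inE => /forallP hL; apply/existsP; exists [ffun=> ord0].
apply/andP; split.
  apply/forallP => u; apply/forallP => v; apply/implyP => euv.
  have := maxdeg_nbrs e u; rewrite e0 leqn0 cards_eq0 => /eqP/setP/(_ v).
  by rewrite !inE euv.
apply/forallP => v; rewrite ffunE.
have /card_gt0P [c cL] : (0 < #|L v|)%N by rewrite (eqP (hL v)).
suff -> : ord0 = c by [].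
by rewrite (ord1 c).
Qed.

(** At most [3 * l] halving rounds of density [64 * p] and one round of density [p * l] are made.
    Since [p * K <= 2 * C], the total density times [K] is at most [2 * C * 193 * l] with 193 = 3 *
    64 + 1; the constant 2000 puts this below [k / 4]. *)
Lemma palette_bound (V : finType) (e : rel V) (D k m : nat) (C eps : R)
    (mu : {ffun {ffun V -> 'I_D.+1} -> R}) :
  let l := ln (#|V|%:R : R) in
  1 < C -> (0 < D)%N -> (0 < m)%N -> (1 / 4) ^+ m <= eps / 4 ->
  1 <= l -> 2 * m%:R <= l -> 2 * m%:R / l <= eps / 4 -> (#|V|%:R)^-1 <= eps / 4 ->
  2000 * C * l <= k%:R -> (k <= D.+1)%N ->
  is_distr mu -> (forall s, mu s != 0 -> proper_col e s) -> col_spread mu (C / D%:R) ->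
  bad_freq R k (fun L => ~~ L_colorable e (K := D.+1) L) <= eps.
Proof.
move=> l C1 D0 m0 hm l1 lm lm2 hn hk kK dm pm sm.
have n0 : (0 < #|V|)%N.
  rewrite lt0n; apply/negP => /eqP V0; move: l1; rewrite /l V0 ln0 //.
  by rewrite ler10.
have nE : expR l = #|V|%:R by apply: lnK; rewrite posrE ltr0n.
set p := C / D%:R in sm; set K := D.+1 in kK mu dm pm sm *.
have DR : 0 < D%:R :> R by rewrite ltr0n.
have KR : 0 < K%:R :> R by rewrite ltr0n.
have p0 : 0 <= p by apply: divr_ge0; [move: C1; lra | exact: ltW].
have pK : p * K%:R <= 2 * C.
  have : K%:R <= 2 * D%:R :> R by rewrite -natrM ler_nat /K; move: D0; clear; lia.
  rewrite /p mulrAC ler_pdivrMr //; move: C1 => C1 h.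
  have := ler_wpM2l (_ : 0 <= C) h; have C0 : 0 <= C by move: C1; lra.
  by move=> /(_ C0); lra.
have kKR : k%:R <= K%:R :> R by rewrite ler_nat.
have Cl : C * 1 <= C * l by apply: ler_wpM2l => //; move: C1; lra.
have q1 : 0 <= p * 64 <= 1.
  rewrite mulr_ge0 //= -(ler_pM2r KR) mul1r mulrAC.
  by move: pK hk kKR Cl C1; lra.
have l0 : 0 < l by move: l1; lra.
have q2 : 0 <= p * l <= 1.
  rewrite mulr_ge0 ?(ltW l0) //= -(ler_pM2r KR) mul1r mulrAC.
  have := ler_wpM2r (ltW l0) pK; have C0 : 0 <= C * l by move: Cl C1; lra.
  by move: hk kKR C0; rewrite -!mulrA; lra.
(* Enough halvings to bring the [#|V|] pairs of a colouring down to [m]. *)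
set r := (trunc_log 2 #|V|).+1.
have hr : r%:R <= 3 * l.
  have h : (2 ^ trunc_log 2 #|V| <= #|V|)%N by apply: trunc_logP.
  have : expR ((trunc_log 2 #|V|)%:R / 2) <= expR l.
    by rewrite nE; apply: (le_trans (expR_half_le2 _)); rewrite -natrX ler_nat.
  rewrite ler_expR => h2.
  have -> : r%:R = (trunc_log 2 #|V|)%:R + 1 :> R by rewrite natr1.
  by move: h2 l1; lra.
have rn : (#|V| <= m * 2 ^ r)%N.
  have h : (#|V| < 2 ^ r)%N by apply: trunc_log_ltn.
  by apply: (leq_trans (ltnW h)); rewrite leq_pmull.
have pq2 : prob_seq [:: p * l] by move=> x; rewrite inE => /eqP ->.
have [pq fb] := fail_bound_rounds r m0 p0 (lexx _) q1 pq2
   (@fail_bound_last R (V * 'I_K)%type p (p * l) l m p0 l0 (lexx _) q2 lm).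
set qs := nseq r _ ++ _ in pq fb.
have spr := law_spread dm sm.
have ms : mass (law mu) = 1 by rewrite /mass law_sum; case: dm.
have hf := fb _ _ spr _; rewrite ms subrr add0r in hf.
apply: (le_trans (bad_freq_le (G := fun L => ~~ L_colorable e L) (@colorable_mono V e K) kK pq)).
have hEU : EU qs (fun W : {set V * 'I_K} => (~~ L_colorable e (lists W))%:R) <= eps / 4 + eps / 4.
  apply: (@le_trans _ _ (EU qs (fail R (supp_graphs mu)))).
    by apply: EU_le => // W; apply: notcolorable_fail.
  apply: (le_trans (hf _)).
    move=> S; rewrite inE => /existsP [s /andP [_ /eqP <-]].
    by rewrite col_graph_card; apply: rn.
  apply: lerD => //; apply: le_trans hm.
  rewrite -[X in _ <= X]mulr1; apply: ler_wpM2l; first by rewrite exprn_ge0 // divr_ge0.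
  by rewrite lerBlDr lerDl exprn_ge0 // divr_ge0.
have hsum : K%:R * \sum_(q <- qs) q <= k%:R / 4.
  rewrite /qs big_cat big_seq1 big_nseq iter_addr_0 /= -[X in X + _]mulr_natr.
  have -> : K%:R * (p * 64 * r%:R + p * l) = p * K%:R * (64 * r%:R + l) by ring.
  have h1 : 64 * r%:R + l <= 193 * l by move: hr; lra.
  have h2 : 0 <= 64 * r%:R + l by rewrite addr_ge0 ?mulr_ge0 // ltW.
  apply: (@le_trans _ _ (2 * C * (193 * l))).
    apply: ler_pM => //; first by rewrite mulr_ge0 // ltW.
  have C0 : 0 <= C * l by move: Cl C1; lra.
  by move: hk C0; rewrite -!mulrA; lra.
have hP : \prod_(q <- qs) (1 + q) ^+ K / 2 ^+ k <= expR (- (k%:R / 4)).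
  rewrite ler_pdivrMr ?exprn_gt0 //.
  apply: (le_trans (prod_expR_le K pq)).
  apply: (@le_trans _ _ (expR (- (k%:R / 4)) * expR (k%:R / 2))).
    by rewrite -expRD ler_expR; move: hsum; lra.
  by apply: ler_wpM2l; [exact: expR_ge0 | exact: expR_half_le2].
have hlast : #|V|%:R * (\prod_(q <- qs) (1 + q) ^+ K / 2 ^+ k) <= eps / 4.
  apply: le_trans hn; rewrite -nE -expRN.
  apply: (@le_trans _ _ (expR l * expR (- (k%:R / 4)))).
    by apply: ler_wpM2l => //; exact: expR_ge0.
  rewrite -expRD ler_expR.
  by move: hk Cl l0 C1; rewrite -!mulrA; nra.
have e0 : 0 <= eps / 4 by apply: le_trans hm; rewrite exprn_ge0 // divr_ge0.
by move: hEU hlast e0; lra.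
Qed.

End Lists.

(** [m] depends on [eps] alone; afterwards [#|T|] is taken so large that the last round, with error
    [2 * m / ln #|T|], is harmless. *)
Theorem list_coloring (R : realType) : exists C' : R, 1 < C' /\
  forall eps : R, 0 < eps -> exists N : nat,
    forall (T : finType) (e : rel T) (D k : nat),
      simple_graph e -> maxdeg e = D -> (N <= #|T|)%N ->
      C' * ln (#|T|%:R) <= k%:R -> (k <= D.+1)%N ->
      1 - eps <= prob_L_colorable R e D.+1 k.
Proof.
have [C [C1 hC]] := spread_coloring R.
exists (2000 * C); split.
  by move: C1; lra.
move=> eps eps0.
pose m := (Num.bound (4 / eps)).+1.
have e4 : 0 <= 4 / eps by apply: divr_ge0 => //; apply: ltW.
have hm0 : 4 / eps <= m%:R.
  by apply: ltW; apply: (lt_le_trans (archi_boundP e4)); rewrite ler_nat.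
have m1 : 1 <= m%:R :> R by rewrite ler1n.
have mR : 0 < m%:R :> R by rewrite ltr0n.
have im : m%:R^-1 <= eps / 4.
  rewrite -[eps / 4]invrK invf_div lef_pV2 // posrE ?divr_gt0 //.
have hm : (1 / 4) ^+ m <= eps / 4.
  apply: le_trans im; rewrite expr_div_n expr1n mul1r lef_pV2 ?posrE ?exprn_gt0 //.
  by rewrite -natrX ler_nat; apply: ltnW; apply: ltn_expl.
pose B : R := 2 * m%:R * (1 + 4 / eps) + 1.
have me : 0 <= m%:R * (4 / eps) by apply: mulr_ge0 => //; apply: ltW.
have me1 : 4 / eps <= m%:R * (4 / eps) by rewrite -[X in X <= _]mul1r; apply: ler_wpM2r.
have B0 : B = 2 * m%:R + 2 * (m%:R * (4 / eps)) + 1 by rewrite /B; ring.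
exists (Num.bound (expR B)) => T e D k [e_sym e_irr] eD hN hk kK.
rewrite prob_colorableE // lerD2l lerN2.
set l := ln _ in hk.
have nB : expR B <= #|T|%:R.
  apply: ltW; apply: (lt_le_trans (archi_boundP (expR_ge0 B))).
  by rewrite ler_nat.
have nR : 0 < #|T|%:R :> R by apply: lt_le_trans nB; apply: expR_gt0.
have lB : B <= l by rewrite -(ler_expR B) /l lnK // posrE.
have l1 : 1 <= l by apply: le_trans lB; rewrite B0; move: me mR; lra.
(* For [D = 0] the spread theorem does not apply, but the palette has one colour and every list is
   the whole palette. *)
have [D0|D0] := posnP D.
  subst D; rewrite D0 in kK hk *; rewrite edgeless_bad //; first exact: ltW.
  rewrite -(ltr_nat R) (lt_le_trans _ hk) // mulr_gt0 //; first by move: C1; lra.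
  by move: l1; lra.
have [mu [dm pm sm]] := hC T e D (conj e_sym e_irr) eD D0.
apply: (palette_bound C1 D0 (isT : (0 < m)%N) hm l1 _ _ _ hk kK dm pm sm).
- by apply: le_trans lB; rewrite B0; move: me; lra.
- have l0 : 0 < l by move: l1; lra.
  rewrite ler_pdivrMr // mulrAC ler_pdivlMr //.
  have h : 2 * (m%:R * (4 / eps)) <= l by apply: le_trans lB; rewrite B0; move: mR; lra.
  have := ler_wpM2l (ltW eps0) h.
  have -> : eps * (2 * (m%:R * (4 / eps))) = 2 * m%:R * 4 by field; rewrite gt_eqF.
  by [].
- rewrite -[eps / 4]invrK invf_div lef_pV2 ?posrE ?divr_gt0 //.
  apply: le_trans nB; apply: le_trans (expR_ge1Dx B); rewrite B0.
  by move: me me1 mR; lra.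
Qed.

Unset Implicit Arguments.

Theorem theorem1p7 (R : realType) :
  (exists C : R, 1 < C /\
    forall (T : finType) (e : rel T) (D : nat),
      simple_graph e -> maxdeg e = D -> (0 < D)%N ->
      exists mu : {ffun {ffun T -> 'I_D.+1} -> R},
        is_distr mu /\
        (forall s, mu s != 0 -> proper_col e s) /\
        col_spread mu (C / D%:R))
  /\
  (exists C' : R, 1 < C' /\
    forall eps : R, 0 < eps ->
    exists N : nat,
      forall (T : finType) (e : rel T) (D k : nat),
        simple_graph e -> maxdeg e = D ->
        (N <= #|T|)%N ->
        C' * ln (#|T|%:R) <= k%:R -> (k <= D.+1)%N ->
        1 - eps <= prob_L_colorable R e D.+1 k).
Proof.
split; last exact: list_coloring.
have [C [C1 hC]] := spread_coloring R; exists C; split=> // T e D sg md D0.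
by have [mu [? ? ?]] := hC T e D sg md D0; exists mu.
Qed.
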